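(* Let $d\ge1$ and $k,n\in\mathbb N_0$. For $1\le l\le d$ and every $v_h\in\mathcal Z_{n,k}^l$, the form $w_h=\mathcal H v_h$ is a member of $V_{n,k}^{l-1}$ that satisfies \[ \mathrm dw_h=v_h,\qquad \|w_h\|_{L^2(\Omega)}\le\frac1\pi\|v_h\|_{L^2(\Omega)}. \] In particular, the sparse-grid complex $(V_{n,k}^\bullet,\mathrm d^\bullet)$ is exact: \[ \ker(\mathrm d|_{V_{n,k}^0})=\mathbb R\ (\text{the constant functions}),\qquad \mathcal Z_{n,k}^l=\mathcal B_{n,k}^l,\quad 1\le l\le d. \]
   Context: $\Omega=(0,1)^d$, $[d]=\{1,\dots,d\}$, $\mathbb N_0=\{0,1,2,\dots\}$. For $I=\{i_1<\dots<i_l\}\subseteq[d]$ put $\mathrm dx_I=\mathrm dx_{i_1}\wedge\cdots\wedge\mathrm dx_{i_l}$. An $l$-form is $\omega=\sum_{|I|=l}u_I\,\mathrm dx_I$; its $L^2$ norm is $\|\omega\|_{L^2(\Omega)}^2=\sum_{|I|=l}\|u_I\|_{L^2(\Omega)}^2$. The (weak) exterior derivative is $\mathrm d\omega=\sum_{|I|=l}\sum_{j\notin I}\partial_{x_j}u_I\,\mathrm dx_j\wedge\mathrm dx_I$ ($\mathrm d=0$ on $d$-forms). One-dimensional spaces. $\mathbb P_r(K)$: polynomials of degree at most $r$ on the interval $K$. $\mathcal T_m$: uniform partition of $(0,1)$ into $2^m$ cells. $S_m^{k+1}=\{v\in C^0([0,1]):v|_K\in\mathbb P_{k+1}(K)\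 \forall K\in\mathcal T_m\}$, $Q_m^k=\{q\in L^2(0,1):q|_K\in\mathbb P_k(K)\ \forall K\in\mathcal T_m\}$. $Z_0^k=Q_0^k$, and for $m\ge1$, $Z_m^k$ is the $L^2(0,1)$-orthogonal complement of $Q_{m-1}^k$ in $Q_m^k$. One has $Z_m^k=\bigoplus_{K\in\mathcal T_{m-1}}Z_K^k$, where $Z_K^k$ consists of functions supported on $K$ that are polynomials of degree at most $k$ on each of the two halves of $K$ and are $L^2(K)$-orthogonal to $\mathbb P_k(K)$; let $\{\psi_{m,K,r}^k\}_{r=0}^k$ be an $L^2$-orthonormal basis of $Z_K^k$. For $K=[a_K,b_K]\in\mathcal T_{m-1}$ set $\theta_{m,K,r}^{k+1}(x)=\int_{a_K}^x\psi_{m,K,r}^k(s)\,\mathrm ds$ for $x\in K$ and $0$ for $x\notin K$. $Y_0^{k+1}=S_0^{k+1}$, and for $m\ge1$, $Y_m^{k+1}=\operatorname{span}\{\theta_{m,K,r}^{k+1}:K\in\mathcal T_{m-1},0\le r\le k\}$. Sparse spaces. $\mathcal M_n=\{\boldsymbol m\in\mathbb N_0^d:m_1+\dots+m_d\le n+d-1\}$, $W_{\boldsymbol m}^{I,k}=\big(\bigotimes_{i\in I}Z_{m_i}^k(x_i)\big)\otimes\big(\bigotimes_{j\notin I}Y_{m_j}^{k+1}(x_j)\big)$, and $V_{n,k}^l=\bigoplus_{|I|=l}\bigoplus_{\boldsymbol m\in\mathcal M_n}W_{\boldsymbol m}^{I,k}\,\mathrm dx_I$. $\mathcal Z_{n,k}^l=\ker(\mathrm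 d|_{V_{n,k}^l})$, $\mathcal B_{n,k}^l=\mathrm dV_{n,k}^{l-1}$. Homotopy. For $q\in L^2(0,1)$ let $Aq(x)=\int_0^xq(t)\,\mathrm dt-\int_0^1\int_0^yq(t)\,\mathrm dt\,\mathrm dy$, and let $A_i$ be $A$ acting only in $x_i$. For $i\in[d]$: $p_i(u_I\,\mathrm dx_I)=\big(\int_0^1u_I(x_1,\dots,t,\dots,x_d)\,\mathrm dt\big)\mathrm dx_I$ ($t$ in the $i$th slot) if $i\notin I$, and $p_i(u_I\,\mathrm dx_I)=0$ if $i\in I$; $h_i(u_I\,\mathrm dx_I)=0$ if $i\notin I$, and $h_i(u_I\,\mathrm dx_I)=(-1)^{r-1}(A_iu_I)\,\mathrm dx_{I\setminus\{i\}}$ if $i$ is the $r$th smallest element of $I$; both extended linearly. $P_{<1}=\mathrm{id}$, $P_{<i}=p_1\cdots p_{i-1}$, and $\mathcal H=\sum_{i=1}^dP_{<i}h_i$. *)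

(* Defs.v *)
From HB Require Import structures.
From mathcomp Require Import all_boot all_order all_algebra.
From mathcomp Require Import all_classical all_reals all_analysis.

Set Implicit Arguments.
Unset Strict Implicit.
Unset Printing Implicit Defensive.

Import Order.TTheory GRing.Theory Num.Theory.
Import numFieldNormedType.Exports.

Local Open Scope classical_set_scope.
Local Open Scope ring_scope.

Section LebesgueCons.
Context (R : realType) (n : nat).
Variable mu : {sigma_finite_measure set (n.-tuple R) -> \bar R}.

Definition cons_pt (p : R * n.-tuple R) :
  n.+1.-tuple R := [tuple of p.1 :: p.2].

Definition uncons_pt (x : n.+1.-tuple R) :
  R * n.-tuple R :=
  (thead x, [tuple of behead x]).

Lemma cons_ptK : cancel cons_pt uncons_pt.
Proof.
case=> a t; rewrite /uncons_pt /cons_pt; congr pair => //=.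
exact: val_inj.
Qed.

Lemma measurable_cons_pt : measurable_fun setT cons_pt.
Proof. exact: measurable_cons. Qed.

Lemma measurable_uncons_pt : measurable_fun setT uncons_pt.
Proof.
apply/measurable_fun_pairP; split => /=; [exact: measurable_tnth|exact: measurable_behead].
Qed.

Definition lebesgue_cons : set (n.+1.-tuple R) -> \bar R :=
  pushforward (lebesgue_measure \x mu)%E cons_pt.

Let lebesgue_cons0 : lebesgue_cons set0 = 0%E.
Proof. by rewrite /lebesgue_cons /pushforward preimage_set0 measure0. Qed.

Let lebesgue_cons_ge0 A : (0 <= lebesgue_cons A)%E.
Proof. by rewrite /lebesgue_cons /pushforward; exact: measure_ge0. Qed.

Let lebesgue_cons_sigma_additive : semi_sigma_additive lebesgue_cons.
Proof.
move=> F mF tF mUF; rewrite /lebesgue_cons /pushforward preimage_bigcup.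
apply: measure_semi_sigma_additive.
- by move=> i; rewrite -[X in measurable X]setTI; exact: measurable_cons_pt.
- apply/trivIsetP => /= i j _ _ ij; rewrite -preimage_setI.
  by move/trivIsetP : tF => /(_ _ _ _ _ ij) ->//; rewrite preimage_set0.
- rewrite -preimage_bigcup -[X in measurable X]setTI.
  exact: measurable_cons_pt.
Qed.

HB.instance Definition _ := isMeasure.Build _ _ _ lebesgue_cons
  lebesgue_cons0 lebesgue_cons_ge0 lebesgue_cons_sigma_additive.

Let lebesgue_cons_sigma_finite : sigma_finite setT lebesgue_cons.
Proof.
have /sigma_finiteP[F [TF ndF Foo]] := sigma_finiteT (@lebesgue_measure R).
have /sigma_finiteP[G [TG ndG Goo]] := sigma_finiteT mu.
exists (fun i => uncons_pt @^-1` (F i `*` G i)).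
  rewrite -preimage_bigcup (_ : \bigcup_i _ = setT) ?preimage_setT//.
  rewrite -setXTT TF TG predeqE => -[x y]; split.
    by move=> [i _ []/= ? ?]; split; exists i.
  move=> [/= [i _ Fix] [j _ Gjy]]; exists (maxn i j) => //; split.
  - by move: x Fix; exact/subsetPset/ndF/leq_maxl.
  - by move: y Gjy; exact/subsetPset/ndG/leq_maxr.
move=> i; have [mF Fi] := Foo i; have [mG Gi] := Goo i; split.
  rewrite -[X in measurable X]setTI; apply: measurable_uncons_pt => //.
  exact: measurableX.
rewrite /lebesgue_cons /pushforward -comp_preimage.
rewrite (_ : uncons_pt \o cons_pt = id); last first.
  by apply/funext => p /=; rewrite cons_ptK.
rewrite preimage_id product_measure1E// lte_mul_pinfty// ge0_fin_numE//.
Qed.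

HB.instance Definition _ := Measure_isSigmaFinite.Build _ _ _ lebesgue_cons
  lebesgue_cons_sigma_finite.

End LebesgueCons.

Fixpoint lebesgue_tuple (R : realType) (d : nat) :
    {sigma_finite_measure set (d.-tuple R) -> \bar R} :=
  match d with
  | 0 => dirac [tuple]
  | n.+1 => lebesgue_cons (lebesgue_tuple R n)
  end.


Section Forms.
Context {R : realType} {d : nat}.
Implicit Types (x : d.-tuple R) (i j : 'I_d) (I J : {set 'I_d}).

Definition cube : set (d.-tuple R) := [set x | forall i, 0 < tnth x i < 1].

Lemma measurable_cube : measurable cube.
Proof.
rewrite (_ : cube = \bigcap_(i in [set: 'I_d])
    ((fun x : d.-tuple R => tnth x i) @^-1` `]0, 1[)); last first.
  by apply/seteqP; split => x /= xI i => [_|]; have := xI i; rewrite /= in_itv/=;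
     [|apply].
apply: fin_bigcap_measurable => [|i _]; first exact: finite_finset.
rewrite -[X in measurable X]setTI.
by apply: (@measurable_tnth _ R d i) => //; exact: measurable_itv.
Qed.

(* Lebesgue measure on the unit cube, as a measure on the whole space; the
   values of a function outside the cube are therefore irrelevant to its norm
   and to its class modulo almost everywhere equality. *)
Definition cube_measure : set (d.-tuple R) -> \bar R :=
  mrestr (lebesgue_tuple R d) measurable_cube.

HB.instance Definition _ := Measure.on cube_measure.

(* A form is given by its coefficients u_I with respect to the basis dx_I.
   The whole graded space is used, so that an l-form is a form whose
   coefficients u_I vanish (almost everywhere) when #|I| <> l. *)
Definition dform := {set 'I_d} -> d.-tuple R -> R.

Definition L2form (w : dform) := forall I, w I \in Lfun cube_measure 2%:E.

Definition form_norm (w : dform) : R :=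
  Num.sqrt (\sum_I fine ('N[cube_measure]_2%:E [EFin \o w I]) ^+ 2).

Definition form0 : dform := fun _ _ => 0.

Fixpoint iter_partial (s : seq 'I_d) (phi : 'rV[R]_d -> R) : 'rV[R]_d -> R :=
  if s is i :: s' then
    fun a => 'D_(delta_mx 0 i) (iter_partial s' phi) a
  else phi.

Definition smooth (phi : 'rV[R]_d -> R) :=
  forall s, continuous (iter_partial s phi) /\
    forall i a, derivable (iter_partial s phi) a (delta_mx 0 i).

Definition test_function (phi : 'rV[R]_d -> R) :=
  smooth phi /\
  exists K : set 'rV[R]_d,
    [/\ compact K, K `<=` [set a | forall i, 0 < a 0 i < 1] &
        forall a, ~ K a -> phi a = 0].

Definition row_of x : 'rV[R]_d := \row_i tnth x i.

(* sum_{j in J} sgn(j,J) d_j w_{J \ j} = eta_J in the sense of distributions,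
   where dx_j /\ dx_{J \ j} = sgn(j,J) dx_J. *)
Definition weak_d (w eta : dform) :=
  forall J (phi : 'rV[R]_d -> R), test_function phi ->
    \int[cube_measure]_x (eta J x * phi (row_of x)) =
    - \sum_(j in J) (-1) ^+ #|[set i in J | (i < j)%N]| *
        \int[cube_measure]_x
          (w (J :\ j)%SET x * ('D_(delta_mx 0 j) phi (row_of x))).

Definition primitive0 (q : R -> R) (t : R) : R :=
  \int[lebesgue_measure]_(s in `[0, t]) q s
  - \int[lebesgue_measure]_(y in `]0, 1[)
      \int[lebesgue_measure]_(s in `[0, y]) q s.

Definition upd x i (t : R) : d.-tuple R :=
  [tuple if j == i then t else tnth x j | j < d].

Definition primitive_at i (u : d.-tuple R -> R) : d.-tuple R -> R :=
  fun x => primitive0 (fun t => u (upd x i t)) (tnth x i).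

Definition average_at i (u : d.-tuple R -> R) : d.-tuple R -> R :=
  fun x => \int[lebesgue_measure]_(t in `]0, 1[) u (upd x i t).

Definition p_op i (w : dform) : dform :=
  fun I => if i \in I then cst 0 else average_at i (w I).

(* The coefficient of dx_J collects the single term I = J u {i} with i \notin J;
   there i is the r-th smallest element of I with r - 1 = #{j in J | j < i}. *)
Definition h_op i (w : dform) : dform :=
  fun J => if i \in J then cst 0 else
    fun x => (-1) ^+ #|[set j in J | (j < i)%N]| *
             primitive_at i (w (i |: J)%SET) x.

Definition P_lt i (w : dform) : dform :=
  foldr p_op w [seq j : 'I_d <- enum 'I_d | (j < i)%N].

Definition homotopy (w : dform) : dform :=
  fun I x => \sum_(i < d) P_lt i (h_op i w) I x.

End Forms.

Arguments cube_measure R d : clear implicits.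
Arguments dform R d : clear implicits.

Section OneDim.
Context {R : realType}.
Implicit Types (k m p j : nat) (q v z y : R -> R).

(* The cells of T_m are [grid m j, grid m j.+1], j < 2 ^ m. *)
Definition grid m j : R := j%:R / 2 ^+ m.

Definition dot01 (f g : R -> R) : R :=
  \int[lebesgue_measure]_(x in `]0, 1[) (f x * g x).

(* Elements of L^2 spaces are described by representatives whose values at
   mesh points are arbitrary. *)
Definition Qspace k m q :=
  forall j, (j < 2 ^ m)%N -> exists2 P : {poly R}, (size P <= k.+1)%N &
    forall x, grid m j < x < grid m j.+1 -> q x = P.[x].

Definition Sspace (r : nat) m v :=
  {within `[0, 1], continuous v} /\
  forall j, (j < 2 ^ m)%N -> exists2 P : {poly R}, (size P <= r.+1)%N &
    forall x, grid m j <= x <= grid m j.+1 -> v x = P.[x].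

Definition Zspace k m z :=
  Qspace k m z /\
  match m with
  | 0 => True
  | p.+1 => forall q, Qspace k p q -> dot01 z q = 0
  end.

(* Z_K for K the j-th cell of T_p; its halves are cells 2j and 2j+1 of
   T_{p+1}. *)
Definition Zcell k p j z :=
  [/\ forall x, ~~ (grid p j <= x <= grid p j.+1) -> z x = 0,
      forall i, (i < 2)%N -> exists2 P : {poly R}, (size P <= k.+1)%N &
        forall x, grid p.+1 (2 * j + i) < x < grid p.+1 (2 * j + i).+1 ->
          z x = P.[x] &
      forall P : {poly R}, (size P <= k.+1)%N ->
        \int[lebesgue_measure]_(x in `[grid p j, grid p j.+1])
          (z x * P.[x]) = 0].

Definition orthonormal_basis (Z : (R -> R) -> Prop) N (e : 'I_N -> R -> R) :=
  [/\ forall r, Z (e r),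
      forall r s, dot01 (e r) (e s) = (r == s)%:R &
      forall z, Z z -> exists c : 'I_N -> R,
        {ae @lebesgue_measure R, forall x, 0 < x < 1 ->
          z x = \sum_(r < N) c r * e r x}].

(* [psi m j r] is the r-th basis function on the j-th cell of T_{m-1}. *)
Definition wavelet_basis k (psi : nat -> nat -> 'I_k.+1 -> R -> R) :=
  forall p j, (j < 2 ^ p)%N -> orthonormal_basis (Zcell k p j) (psi p.+1 j).

Definition theta k (psi : nat -> nat -> 'I_k.+1 -> R -> R) m j
    (r : 'I_k.+1) (x : R) : R :=
  if grid m.-1 j <= x <= grid m.-1 j.+1 then
    \int[lebesgue_measure]_(s in `[grid m.-1 j, x]) psi m j r s
  else 0.

Definition Yspace k (psi : nat -> nat -> 'I_k.+1 -> R -> R) m y :=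
  match m with
  | 0 => Sspace k.+1 0 y
  | p.+1 => exists c : nat -> 'I_k.+1 -> R, forall x, 0 <= x <= 1 ->
      y x = \sum_(j < 2 ^ p) \sum_(r < k.+1) c j r * theta psi p.+1 j r x
  end.

End OneDim.

Section Sparse.
Context {R : realType} (d k n : nat).
Variable psi : nat -> nat -> 'I_k.+1 -> R -> R.

Definition Wspace (m : 'I_d -> nat) (I : {set 'I_d}) (u : d.-tuple R -> R) :=
  exists (N : nat) (f : 'I_N -> 'I_d -> R -> R),
    (forall a i, if i \in I then Zspace k (m i) (f a i)
                 else Yspace psi (m i) (f a i)) /\
    forall x, u x = \sum_(a < N) \prod_(i < d) f a i (tnth x i).

(* For d > 0, every entry of a multi-index in M_n is at most n + d - 1, so
   that M_n is a finite set of functions into 'I_(n + d). *)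
Definition Mset (m : {ffun 'I_d -> 'I_(n + d)}) : bool :=
  (\sum_i m i <= n + d - 1)%N.

Definition sparse_coef (I : {set 'I_d}) (u : d.-tuple R -> R) :=
  exists w : {ffun 'I_d -> 'I_(n + d)} -> d.-tuple R -> R,
    (forall m, Mset m -> Wspace (fun i => m i) I (w m)) /\
    u = (fun x => \sum_(m | Mset m) w m x) %[ae (cube_measure R d)].

Definition Vspace (l : nat) : set (dform R d) :=
  [set w | L2form w /\ forall I : {set 'I_d},
    if #|I| == l then sparse_coef I (w I)
    else w I = cst 0 %[ae (cube_measure R d)]].

Definition Zkernel (l : nat) : set (dform R d) :=
  [set v | Vspace l v /\ weak_d v form0].

(* Meaningful for l > 0 only, since 0.-1 = 0. *)
Definition Bimage (l : nat) : set (dform R d) :=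
  [set v | L2form v /\ exists2 w, Vspace l.-1 w & weak_d w v].

End Sparse.

Arguments Vspace {R} d {k} n psi l.
Arguments Zkernel {R} d {k} n psi l.
Arguments Bimage {R} d {k} n psi l.

Definition constant_forms (R : realType) (d : nat) : set (dform R d) :=
  [set v | L2form v /\ exists c : R, forall I : {set 'I_d},
    v I = cst (if I == finset.set0 then c else 0) %[ae (cube_measure R d)]].

Arguments constant_forms R d : clear implicits.

(* Main.v *)
(** For i smaller than all elements of K, closedness of v on {i} u K expresses the combination of the
    derivatives d_j v_{ {i} u K \ j}, j in K, as d_i v_K; since A_i d_i = id - p_i,
    the coefficient of dx_K in d (H v) is then a telescoping sum equal to v_K.
    The weak derivatives are computed on representatives: an element of a sparse
    space is almost everywhere a finite sum of products of one-dimensional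
    functions, with strong partial derivatives in the variables j not in I, and
    the fundamental lemma of the calculus of variations identifies weak with
    strong derivatives. H preserves the sparse spaces because A maps Z_m^k into
    Y_m^{k+1} up to a constant and averages are constants, which lie in
    Y_0^{k+1}. The terms P_{<i} h_i v of H v are mutually orthogonal, averages
    are contractions, and each coefficient v_K contributes to at most one term,
    so the bound reduces to the one-dimensional inequality
    ||A q|| <= ||q|| / pi. By duality this is Wirtinger's inequality for functions
    vanishing at both ends, proved by completing a square with
    t = lam tan (lam (x - 1/2)), lam < pi. *)

From HB Require Import structures.
Require Import Defs.
From mathcomp Require Import all_boot all_order all_algebra.
From mathcomp Require Import all_classical all_reals all_analysis.
From mathcomp Require Import measurable_realfun lra ring zify.
Import Order.TTheory GRing.Theory Num.Theory.
Import numFieldNormedType.Exports.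
Local Open Scope classical_set_scope.
Local Open Scope ring_scope.

Set Implicit Arguments.
Unset Strict Implicit.
Unset Printing Implicit Defensive.

(** Two obstacles shape the argument. The spaces fix their members only almost everywhere, leaving
    values at mesh points and outside the unit interval arbitrary, whereas A_i and p_i integrate
    along lines, which may be null sets. Uniformly resampling one coordinate preserves the cube
    measure, so equality almost everywhere passes to almost every line, and Fubini applies in any
    coordinate without permuting variables. Secondly, the wavelets jump at mesh points, so the
    members of Y_m have no classical derivative there; calculus is done on pairs F, f with F x = F 0
    + int_0^x f and f merely bounded and measurable. The averages in P_{<i} serve two ends. They
    annihilate every coefficient containing an index below i, which leaves only trivial signs and
    makes the terms telescope, and they make later terms constant in x_i, which gives orthogonality.
    The bound needs lam < pi because at lam = pi the tangent blows up at both ends of the interval;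
    the sharp constant is recovered by contradiction. That images lie in kernels is a separate
    matter: it rests on differentiation mapping Y_m into Z_m at the same level. *)

Notation unif R := (uniform_prob (@ltr01 R)).

(** * The uniform probability measure on the unit interval *)

Section UnitInterval.
Context {R : realType}.

Lemma unif_oo (A : set R) : measurable A ->
  unif R A = lebesgue_measure (A `&` `]0, 1[).
Proof.
move=> mA; have := @integral_uniform R 0 1 ltr01 (EFin \o \1_A).
rewrite integral_indic// setIT => ->; last 2 first.
- by apply/measurable_EFinP; exact: measurable_indic.
- by move=> x; rewrite /= lee_fin.
rewrite subr0 invr1 mul1e integral_itv_bndoo ?integral_indic//=.
  by apply/measurable_EFinP; exact: measurable_indic.
Qed.

Lemma ge0_integral_unif (f : R -> \bar R) :
  measurable_fun setT f -> (forall x, 0 <= f x)%E ->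
  (\int[unif R]_x f x = \int[lebesgue_measure]_(x in `]0%R, 1%R[) f x)%E.
Proof.
move=> mf f0; rewrite integral_uniform// subr0 invr1 mul1e integral_itv_bndoo//.
exact: measurable_funTS.
Qed.

Lemma Rintegral_unif (f : R -> R) : measurable_fun setT f ->
  \int[unif R]_x f x = \int[lebesgue_measure]_(x in `]0, 1[) f x.
Proof.
move=> mf; have mEf : measurable_fun setT (EFin \o f) by exact/measurable_EFinP.
rewrite /Rintegral integralE [in RHS]integralE.
by rewrite !ge0_integral_unif//; [exact: measurable_funeneg|exact: measurable_funepos].
Qed.

Lemma integral_unif_cst (a : \bar R) : (\int[unif R]_x a = a)%E.
Proof. by rewrite integral_cst// (_ : _ setT = 1%E) ?mule1//; exact: probability_setT. Qed.

End UnitInterval.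

(** * Lebesgue measure on the cube *)

Section CubeMeasure.
Context {R : realType}.
Implicit Types d n : nat.

Lemma cube_measure_sigma_finite d : sigma_finite setT (cube_measure R d).
Proof.
have /sigma_finiteP[F [TF ndF Foo]] := sigma_finiteT (lebesgue_tuple R d).
exists F => // i; have [mF Fi] := Foo i; split => //.
apply: le_lt_trans Fi; rewrite /cube_measure/= /mrestr le_measure ?inE//.
by apply: measurableI => //; exact: measurable_cube.
Qed.

HB.instance Definition _ d := Measure_isSigmaFinite.Build _ _ _
  (cube_measure R d) (@cube_measure_sigma_finite d).

Lemma cube_measure_cons n (A : set (n.+1.-tuple R)) : measurable A ->
  cube_measure R n.+1 A =
  ((unif R \x cube_measure R n) (@cons_pt R n @^-1` A))%E.
Proof.
move=> mA.
have mcube : measurable (`]0%R, 1%R[%classic `*` @cube R n : set (R * n.-tuple R)).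
  by apply: measurableX => //; exact: measurable_cube.
have mcA : measurable (@cons_pt R n @^-1` A).
  by rewrite -[X in measurable X]setTI; exact: measurable_cons_pt.
rewrite (@product_measure_unique _ _ _ _ _ _ _
  (mrestr (lebesgue_measure \x lebesgue_tuple R n)%E mcube))//; last first.
  move=> B C mB mC; rewrite /= /mrestr -setXI product_measure1E//.
  - by rewrite unif_oo.
  - exact: measurableI.
  - by apply: measurableI => //; exact: measurable_cube.
rewrite /cube_measure /= /mrestr /= /lebesgue_cons /pushforward.
congr ((_ \x _)%E _); rewrite preimage_setI; congr setI.
apply/seteqP; split => -[t y]; rewrite /cube /= ?in_itv/=.
  move=> h; split; first by have := h ord0; rewrite /= (tnth_nth 0).
  move=> i; have := h (lift ord0 i).
  by rewrite !(tnth_nth 0).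
move=> [t01 h] i; case: (unliftP ord0 i) => [j ->|->]; rewrite !(tnth_nth 0)//=.
by have := h j; rewrite (tnth_nth 0).
Qed.

Local Open Scope ereal_scope.

Lemma ge0_integral_cube_cons n (F : n.+1.-tuple R -> \bar R) :
  measurable_fun setT F -> (forall x, 0 <= F x) ->
  \int[cube_measure R n.+1]_x F x =
  \int[unif R]_t \int[cube_measure R n]_y F (cons_pt (t, y)).
Proof.
move=> mF F0.
have mc := @measurable_cons_pt R n.
rewrite (eq_measure_integral
  (pushforward (unif R \x cube_measure R n) (@cons_pt R n))).
  rewrite ge0_integral_pushforward//.
  pose G (z : measurableTypeR R * n.-tuple R) := F (cons_pt z).
  by apply: (fubini_tonelli1 G) => [|z]; [exact: measurableT_comp mc|exact: F0].
by move=> A mA _; exact: cube_measure_cons.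
Qed.

Lemma cube_measure_setT d : cube_measure R d setT = 1%E.
Proof.
elim: d => [|d IH].
  rewrite /cube_measure/= /mrestr/= setTI diracE; apply/eqP.
  by rewrite eqe pnatr_eq1 eqb1; rewrite inE => -[].
have := @ge0_integral_cube_cons d (cst 1) (@measurable_cst _ _ _ _ _ _) (fun=> lee01).
rewrite integral_cst// mul1e => ->.
rewrite (eq_integral (cst 1)); last first.
  by move=> t _; rewrite /cst integral_cst// mul1e; exact: IH.
by rewrite integral_cst// mul1e; exact: probability_setT.
Qed.

HB.instance Definition _ d := Measure_isProbability.Build _ _ _
  (cube_measure R d) (@cube_measure_setT d).

Lemma ae_cube d : {ae cube_measure R d, forall x, cube x}.
Proof.
exists (~` cube); split => //; first by apply: measurableC; exact: measurable_cube.
by rewrite /cube_measure/= /mrestr setICl measure0.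
Qed.

Lemma tnth_upd d (x : d.-tuple R) i t j :
  tnth (upd x i t) j = if j == i then t else tnth x j.
Proof. by rewrite tnth_mktuple. Qed.

Lemma upd_id d (x : d.-tuple R) i : upd x i (tnth x i) = x.
Proof. by apply/eq_from_tnth => j; rewrite tnth_upd; case: eqP => [->|]. Qed.

Lemma upd_upd d (x : d.-tuple R) i s t : upd (upd x i s) i t = upd x i t.
Proof. by apply/eq_from_tnth => j; rewrite !tnth_upd; case: eqP. Qed.

Lemma updC d (x : d.-tuple R) i j s t : i != j ->
  upd (upd x i s) j t = upd (upd x j t) i s.
Proof.
move=> ij; apply/eq_from_tnth => k; rewrite !tnth_upd.
by case: eqP => // ->; rewrite eq_sym (negbTE ij).
Qed.

Lemma cube_upd d (x : d.-tuple R) i (t : R) : cube x -> (0 < t < 1)%R -> cube (upd x i t).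
Proof. by move=> cx t01 j; rewrite tnth_upd; case: eqP. Qed.

Lemma measurable_fun_upd {disp} {T : measurableType disp} d i
    (f : T -> d.-tuple R) (g : T -> R) :
  measurable_fun setT f -> measurable_fun setT g ->
  measurable_fun setT (fun z => upd (f z) i (g z)).
Proof.
move=> mf mg; apply/measurable_fun_tnthP => j.
rewrite (_ : _ \o _ = if j == i then g else fun z => tnth (f z) j).
  case: ifP => // _.
  exact: (measurableT_comp (measurable_tnth _) mf).
by apply/funext => z /=; rewrite tnth_upd; case: eqP.
Qed.

(** Resampling one coordinate uniformly preserves the cube measure, which is Tonelli in an arbitrary
    coordinate. The measure is built by adding a head coordinate, hence the induction on [d]:
    coordinate 0 is the one peeled off, any other falls to the induction hypothesis. *)
Lemma ge0_integral_cube_upd d i (F : d.-tuple R -> \bar R) :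
  measurable_fun setT F -> (forall x, 0 <= F x) ->
  \int[cube_measure R d]_x F x =
  \int[cube_measure R d]_x \int[unif R]_t F (upd x i t).
Proof.
elim: d i F => [[] //|d IH i F mF F0].
have mFupd j : measurable_fun setT
    (fun z : d.+1.-tuple R * measurableTypeR R => F (upd z.1 j z.2)).
  by apply: measurableT_comp => //; exact: measurable_fun_upd.
have mFc : measurable_fun setT (fun z : measurableTypeR R * d.-tuple R => F (cons_pt z)).
  by apply: measurableT_comp => //; exact: measurable_cons_pt.
rewrite [RHS]ge0_integral_cube_cons; last 2 first.
- apply: (measurable_fun_fubini_tonelli_F _ (mFupd i)) => z; exact: F0.
- by move=> x; apply: integral_ge0.
case: (unliftP ord0 i) => [j ->|->].
  rewrite (ge0_integral_cube_cons mF F0); apply: eq_integral => t _.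
  rewrite (IH j); last first.
  - by move=> y; exact: F0.
  -
    by apply: measurableT_comp mFc _; exact: measurable_fun_pair.
  apply: eq_integral => y _; apply: eq_integral => s _; congr F.
  apply/eq_from_tnth => k; rewrite tnth_upd !(tnth_nth 0%R)/=.
  case: (unliftP ord0 k) => [k' ->|->]; last by rewrite (negbTE (neq_lift _ _)).
  rewrite (inj_eq lift_inj) /= -[in LHS](tnth_nth 0%R (upd y j s)) tnth_upd.
  by case: eqP => //; rewrite (tnth_nth 0%R).
transitivity (\int[unif R]_t
   \int[cube_measure R d]_y \int[unif R]_s F (cons_pt (s, y))); last first.
  apply: eq_integral => t _; apply: eq_integral => y _; apply: eq_integral => s _.
  congr F; apply/eq_from_tnth => k; rewrite tnth_upd !(tnth_nth 0%R)/=.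
  case: (unliftP ord0 k) => [k' ->|->]; last by rewrite eqxx.
  by rewrite eq_sym (negbTE (neq_lift _ _)).
rewrite integral_unif_cst.
rewrite (ge0_integral_cube_cons mF F0).
by apply: (fubini_tonelli _ mFc) => z; exact: F0.
Qed.

Lemma cube_measure_upd d (i : 'I_d) (A : set (d.-tuple R)) : measurable A ->
  cube_measure R d A = (cube_measure R d \x unif R)
    ((fun z : d.-tuple R * measurableTypeR R => upd z.1 i z.2) @^-1` A).
Proof.
move=> mA.
have mU : measurable_fun setT
    (fun z : d.-tuple R * measurableTypeR R => upd z.1 i z.2).
  exact: measurable_fun_upd.
have mI : measurable_fun setT (EFin \o \1_A : d.-tuple R -> \bar R).
  by apply/measurable_EFinP; exact: measurable_indic.
rewrite -[in LHS](setIT A) -(integral_indic (cube_measure R d))//.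
rewrite (ge0_integral_cube_upd i mI); last by move=> x; rewrite lee_fin.
have mUA : measurable ((fun z : d.-tuple R * measurableTypeR R => upd z.1 i z.2) @^-1` A).
  by rewrite -[X in measurable X]setTI; exact: mU.
rewrite -[X in _ = _ X]setIT -integral_indic//.
have mI2 := @measurable_indic _ _ R setT _ mUA.
move/measurable_EFinP in mI2.
by rewrite (fubini_tonelli1 _ mI2)// => z; rewrite lee_fin.
Qed.

(** The indicator of a null set integrates to 0, hence by resampling so does the measure of its
    trace on lines: almost every line meets it in a null set. This lets averages and primitives act
    on classes modulo null sets. *)
Lemma ae_upd d (i : 'I_d) (P : d.-tuple R -> Prop) :
  {ae cube_measure R d, forall x, P x} ->
  {ae cube_measure R d, forall x, {ae unif R, forall t, P (upd x i t)}}.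
Proof.
move=> [N [mN N0 PN]].
have mU : measurable_fun setT
    (fun z : d.-tuple R * measurableTypeR R => upd z.1 i z.2).
  exact: measurable_fun_upd.
have mI : measurable_fun setT (EFin \o \1_N : d.-tuple R -> \bar R).
  by apply/measurable_EFinP; exact: measurable_indic.
have mIU : measurable_fun setT
    (fun z : d.-tuple R * measurableTypeR R => (\1_N (upd z.1 i z.2) : R)%:E).
  exact: (measurableT_comp mI mU).
have mF := @measurable_fun_fubini_tonelli_F _ _ _ _ _ (unif R) _ mIU.
have {}mF := mF (fun=> ltac:(by rewrite lee_fin)).
have h : \int[cube_measure R d]_x `|\int[unif R]_t (\1_N (upd x i t))%:E| = 0.
  under eq_integral do rewrite gee0_abs ?integral_ge0//.
  rewrite -(ge0_integral_cube_upd i mI); last by move=> x; rewrite lee_fin.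
  by rewrite integral_indic// setIT.
move: (h) => /(ae_eq_integral_abs _ measurableT mF).
apply: filterS => x /(_ I) xN.
have mNx : measurable ((fun t : measurableTypeR R => upd x i t) @^-1` N).
  rewrite -[X in measurable X]setTI.
  exact: (@measurable_fun_upd _ (measurableTypeR R) d i (cst x) id).
exists ((fun t : measurableTypeR R => upd x i t) @^-1` N); split => //.
  by have := integral_indic (unif R) measurableT mNx; rewrite setIT => <-; exact: xN.
by move=> t /= nP; exact: PN.
Qed.

Lemma cube_integrable d (f : d.-tuple R -> R) (M : R) : measurable_fun setT f ->
  (forall x, cube x -> (`|f x| <= M)%R) ->
  (cube_measure R d).-integrable setT (EFin \o f).
Proof.
move=> mf fM; apply/integrableP; split; first exact/measurable_EFinP.
apply: (@le_lt_trans _ _ `|M|%:E); last exact: ltry.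
rewrite -[leRHS]mule1 -(cube_measure_setT d).
apply: integral_le_bound => //.
- exact/measurable_EFinP.
- apply: filterS (ae_cube d) => x cx _ /=.
  by rewrite lee_fin (le_trans (fM x cx))// ler_norm.
Qed.

End CubeMeasure.

(** * Measurability and integration of averages and primitives in one coordinate *)

Section Averages.
Context {R : realType}.
Local Notation leb := (@lebesgue_measure R).

(** No integrability is assumed: Tonelli applies to the positive and the negative part, and [fine]
    of the difference is measurable in every case. *)
Lemma measurable_Rintegral {disp} {T : measurableType disp} (D : set R)
    (f : T * measurableTypeR R -> R) : measurable D -> measurable_fun setT f ->
  measurable_fun setT (fun x => \int[leb]_(t in D) f (x, t)).
Proof.
move=> mD mf.
pose g (z : T * measurableTypeR R) := (f z * \1_D z.2)%R.
have mg : measurable_fun setT (EFin \o g).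
  apply/measurable_EFinP/measurable_funM => //.
  by apply: measurableT_comp => //; exact: measurable_indic.
rewrite (_ : (fun x => _) = (fun x => fine
   (\int[leb]_t (EFin \o g)^\+ (x, t) - \int[leb]_t (EFin \o g)^\- (x, t))%E)).
  apply: measurableT_comp => //; apply: emeasurable_funB.
    exact: (measurable_fun_fubini_tonelli_F _ (measurable_funepos mg)).
  exact: (measurable_fun_fubini_tonelli_F _ (measurable_funeneg mg)).
apply/funext => x; rewrite Rintegral_mkcond /Rintegral; congr fine.
rewrite integralE; congr (_ - _)%E; apply: eq_integral => t _.
  by rewrite !funeposE /g /= patchE indicE; case: ifPn; rewrite ?mulr1 ?mulr0.
by rewrite !funenegE /g /= patchE indicE; case: ifPn; rewrite ?mulr1 ?mulr0.
Qed.

Lemma measurable_line d (u : d.-tuple R -> R) (x : d.-tuple R) i :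
  measurable_fun setT u -> measurable_fun setT (fun t : R => u (upd x i t)).
Proof.
move=> mu; apply: measurableT_comp => //.
exact: (@measurable_fun_upd _ _ (measurableTypeR R) d i (cst x) id).
Qed.

Lemma measurable_average_at d i (u : d.-tuple R -> R) :
  measurable_fun setT u -> measurable_fun setT (average_at i u).
Proof.
move=> mu; apply: (@measurable_Rintegral _ _ _ (fun z => u (upd z.1 i z.2))) => //.
by apply: measurableT_comp => //; exact: measurable_fun_upd.
Qed.

(** The variable upper limit is moved into the integrand as a condition, so that the domain of
    integration becomes fixed. *)
Lemma measurable_int0 {disp} {T : measurableType disp}
    (f : T * measurableTypeR R -> R) (b : T -> R) :
  measurable_fun setT f -> measurable_fun setT b ->
  measurable_fun setT (fun x => \int[leb]_(t in `[0, b x]) f (x, t)).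
Proof.
move=> mf mb.
rewrite (_ : (fun x => _) = (fun x => \int[leb]_(t in setT)
   (if (0 <= t) && (t <= b x) then f (x, t) else 0))).
  apply: (@measurable_Rintegral _ _ _
    (fun z => if (0 <= z.2) && (z.2 <= b z.1) then f z else 0)) => //.
  apply: measurable_fun_if => //; last exact: measurable_funTS.
  apply: measurable_and; apply: measurable_fun_ler => //.
  exact: measurableT_comp.
apply/funext => x; rewrite Rintegral_mkcond; apply: eq_Rintegral => t _.
by rewrite patchE mem_setE in_itv/=; case: ifP.
Qed.

Lemma measurable_primitive_at d i (u : d.-tuple R -> R) :
  measurable_fun setT u -> measurable_fun setT (primitive_at i u).
Proof.
move=> mu; have muu : measurable_fun setT
    (fun z : d.-tuple R * measurableTypeR R => u (upd z.1 i z.2)).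
  by apply: measurableT_comp => //; exact: measurable_fun_upd.
apply: measurable_funB.
  apply: (@measurable_int0 _ _ (fun z => u (upd z.1 i z.2))) => //.
  exact: measurable_tnth.
apply: (@measurable_Rintegral _ _ _
  (fun z => \int[leb]_(s in `[0, z.2]) u (upd z.1 i s))) => //.
apply: (@measurable_int0 _ _
  (fun z : (d.-tuple R * measurableTypeR R) * measurableTypeR R => u (upd z.1.1 i z.2))) => //.
apply: measurableT_comp => //; apply: measurable_fun_upd => //.
exact: measurableT_comp.
Qed.

Lemma average_at_unif d i (u : d.-tuple R -> R) x : measurable_fun setT u ->
  average_at i u x = \int[unif R]_t u (upd x i t).
Proof. by move=> mu; rewrite Rintegral_unif//; exact: measurable_line. Qed.

Lemma unif_integrable (f : R -> R) (M : R) : measurable_fun setT f ->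
  (forall t, 0 < t < 1 -> `|f t| <= M) -> (unif R).-integrable setT (EFin \o f).
Proof.
move=> mf fM; apply/integrableP; split; first exact/measurable_EFinP.
apply: (@le_lt_trans _ _ `|M|%:E); last exact: ltry.
rewrite ge0_integral_unif//; last exact/measurableT_comp/measurable_EFinP.
have : (lebesgue_measure (`]0%R, 1%R[%classic : set R) = 1 :> \bar R)%E.
  by rewrite lebesgue_measure_itv/= lte_fin ltr01 -EFinB subr0.
move=> l1; rewrite -[leRHS]mule1 -[X in (_ <= _ * X)%E]l1.
apply: integral_le_bound => //; first exact/measurable_EFinP/measurable_funTS.
apply: aeW => t /=; rewrite in_itv/= => t01.
by rewrite lee_fin (le_trans (fM t t01))// ler_norm.
Qed.

(** The signed form of the resampling identity; a bound on the cube yields integrability because the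
    measure is finite. *)
Lemma Rintegral_cube_average d i (f : d.-tuple R -> R) (M : R) :
  measurable_fun setT f -> (forall x, cube x -> `|f x| <= M) ->
  \int[cube_measure R d]_x f x = \int[cube_measure R d]_x average_at i f x.
Proof.
move=> mf fM.
have mU : measurable_fun setT
    (fun z : d.-tuple R * measurableTypeR R => upd z.1 i z.2).
  exact: measurable_fun_upd.
have mEf : measurable_fun setT (EFin \o f) by exact/measurable_EFinP.
have intf := cube_integrable mf fM.
have intfU : (cube_measure R d \x unif R)%E.-integrable setT
    ((EFin \o f) \o (fun z : d.-tuple R * measurableTypeR R => upd z.1 i z.2)).
  apply/integrableP; split; first exact: measurableT_comp mEf mU.
  move/integrableP : intf => [_]; apply: le_lt_trans.
  rewrite (ge0_integral_cube_upd i)//; last exact: measurableT_comp.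
  rewrite (fubini_tonelli1 (abse \o ((EFin \o f) \o
    (fun z : d.-tuple R * measurableTypeR R => upd z.1 i z.2))))//;
    last by move=> z; exact: abse_ge0.
  by apply: measurableT_comp => //; exact: measurableT_comp mEf mU.
rewrite [LHS]/Rintegral [RHS]/Rintegral; congr fine.
transitivity (\int[cube_measure R d]_x \int[unif R]_t (f (upd x i t))%:E)%E.
  rewrite (eq_measure_integral
    (pushforward (cube_measure R d \x unif R)%E
     (fun z : d.-tuple R * measurableTypeR R => upd z.1 i z.2))).
    rewrite integral_pushforward//.
    exact: (esym (integral12_prod_meas1 intfU)).
  by move=> A mA _; exact: cube_measure_upd.
apply: ae_eq_integral => //.
- exact: (measurable_fubini_F intfU).
- by apply: measurableT_comp => //; exact: measurable_average_at.
- apply: filterS (ae_cube d) => x cx _.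
  rewrite average_at_unif// fineK//; apply: integrable_fin_num => //.
  apply: (@unif_integrable _ M); first exact: measurable_line.
  by move=> t t01; apply: fM; exact: cube_upd.
Qed.

End Averages.

(** * One-dimensional integration *)

Section LocallyBounded.
Context {R : realType}.
Implicit Types f g F G : R -> R.
Local Notation leb := (@lebesgue_measure R).

(** A class containing piecewise polynomials, closed under sums, products and primitives, in which
    every integral over a bounded interval is finite; no integrability side condition survives. *)
Definition locbounded f :=
  measurable_fun setT f /\ forall r : R, exists M : R, forall x : R, `|x| <= r -> `|f x| <= M.

Lemma locbounded_cst (c : R) : locbounded (fun=> c).
Proof. by split => [|r]; [exact: measurable_cst|exists `|c|]. Qed.

Lemma locboundedD f g : locbounded f -> locbounded g ->
  locbounded (fun x => f x + g x).
Proof.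
move=> [mf bf] [mg bg]; split; first exact: measurable_funD.
move=> r; have [M fM] := bf r; have [N gN] := bg r; exists (M + N) => x xr.
by rewrite (le_trans (ler_normD _ _))// lerD ?fM ?gN.
Qed.

Lemma locboundedM f g : locbounded f -> locbounded g ->
  locbounded (fun x => f x * g x).
Proof.
move=> [mf bf] [mg bg]; split; first exact: measurable_funM.
move=> r; have [M fM] := bf r; have [N gN] := bg r; exists (M * N) => x xr.
by rewrite normrM ler_pM ?fM ?gN.
Qed.

Lemma locboundedZ (c : R) f : locbounded f -> locbounded (fun x => c * f x).
Proof. by move=> bf; apply: locboundedM => //; exact: locbounded_cst. Qed.

Lemma locbounded_sqr f : locbounded f -> locbounded (fun x => f x ^+ 2).
Proof. by move=> bf; exact: (locboundedM bf bf). Qed.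

Lemma locboundedN f : locbounded f -> locbounded (fun x => - f x).
Proof.
by move=> [mf bf]; split; [exact: measurableT_comp|move=> r; have [M fM] := bf r;
  exists M => x xr; rewrite normrN fM].
Qed.

Lemma locbounded_sum (I : Type) (s : seq I) (f : I -> R -> R) :
  (forall i, locbounded (f i)) -> locbounded (fun x => \sum_(i <- s) f i x).
Proof.
move=> bf; elim: s => [|i s IH].
  by under eq_fun do rewrite big_nil; exact: locbounded_cst.
by under eq_fun do rewrite big_cons; exact: locboundedD.
Qed.

Lemma locbounded_indic (A : set R) f : measurable A -> locbounded f ->
  locbounded (fun x => f x * \1_A x).
Proof.
move=> mA bf; apply: locboundedM => //; split; first exact: measurable_indic.
by move=> r; exists 1 => x _; rewrite indicE; case: (x \in A); rewrite ?normr1 ?normr0.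
Qed.

Lemma locbounded_bound (a b : R) f : locbounded f ->
  exists2 M : R, 0 < M & forall x : R, a <= x <= b -> `|f x| <= M.
Proof.
move=> [_ /(_ (`|a| + `|b|))[M fM]]; exists (`|M| + 1).
  by rewrite ltr_wpDl.
move=> x /andP[ax xb]; rewrite (@le_trans _ _ M) ?fM//; last first.
  by rewrite (le_trans (ler_norm _))// lerDl.
have : - `|a| <= a by rewrite lerNl -normrN ler_norm.
have := ler_norm b; have := normr_ge0 a; have := normr_ge0 b.
by rewrite ler_norml => *; apply/andP; split; lra.
Qed.

Lemma locbounded_integrable (b0 b1 : bool) (a b : R) f : locbounded f ->
  leb.-integrable [set` Interval (BSide b0 a) (BSide b1 b)] (EFin \o f).
Proof.
move=> bf; have [M _ fM] := locbounded_bound a b bf.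
suff : leb.-integrable `[a, b] (EFin \o f).
  by apply: integrableS => //; apply: subset_itv; case: b0 b1 => -[]; rewrite ?bnd_simp.
apply: measurable_bounded_integrable => //.
- by rewrite /= lebesgue_measure_itv/=; case: ifP => _; rewrite -?EFinB ltry.
- by apply: measurable_funTS; case: bf.
- exists M; split; first exact: num_real.
  move=> N MN x /=; rewrite in_itv/= => xab.
  by rewrite (le_trans (fM _ xab))// ltW.
Qed.

Definition int01 f : R := \int[leb]_(t in `]0, 1[) f t.
Definition prim f (x : R) : R := \int[leb]_(t in `[0, x]) f t.

Lemma int01_prim f : locbounded f -> int01 f = prim f 1.
Proof.
move=> bf; rewrite /int01 /prim [LHS]/Rintegral [RHS]/Rintegral [in RHS]integral_itv_bndoo//.
by apply/measurable_EFinP; apply: measurable_funTS; case: bf.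
Qed.

Lemma eq_int01 f g : (forall x : R, 0 < x < 1 -> f x = g x) -> int01 f = int01 g.
Proof. by move=> fg; apply: eq_Rintegral => x; rewrite mem_setE in_itv/= => /fg. Qed.

Lemma eq_prim f g x : (forall t : R, 0 <= t <= x -> f t = g t) -> prim f x = prim g x.
Proof. by move=> fg; apply: eq_Rintegral => t; rewrite mem_setE in_itv/= => /fg. Qed.

Lemma primD f g x : locbounded f -> locbounded g ->
  prim (fun t => f t + g t) x = prim f x + prim g x.
Proof. by move=> bf bg; rewrite /prim RintegralD//; exact: locbounded_integrable. Qed.

Lemma primZ c f x : locbounded f -> prim (fun t => c * f t) x = c * prim f x.
Proof. by move=> bf; rewrite /prim RintegralZl//; exact: locbounded_integrable. Qed.

Lemma prim_cst c x : 0 <= x -> prim (fun=> c) x = c * x.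
Proof.
move=> x0; rewrite /prim Rintegral_cst//= lebesgue_measure_itv/= lte_fin.
by case: ltgtP x0 => //= [x0 _|<- _]; rewrite ?subr0// mulr0.
Qed.

Lemma prim0 f : prim f 0 = 0.
Proof. by rewrite /prim set_itv1 Rintegral_set1. Qed.

Lemma prim_neg f x : x < 0 -> prim f x = 0.
Proof. by move=> x0; rewrite /prim set_itv_ge ?Rintegral_set0// bnd_simp -ltNge. Qed.

Lemma prim_sum (I : Type) (s : seq I) (f : I -> R -> R) x :
  (forall i, locbounded (f i)) ->
  prim (fun t => \sum_(i <- s) f i t) x = \sum_(i <- s) prim (f i) x.
Proof.
move=> bf; elim: s => [|i s IH].
  under eq_fun do rewrite big_nil; rewrite big_nil.
  have [x0|x0] := leP 0 x; first by rewrite prim_cst// mul0r.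
  by rewrite prim_neg.
under eq_fun do rewrite big_cons; rewrite big_cons primD ?IH//.
exact: locbounded_sum.
Qed.

Lemma int01D f g : locbounded f -> locbounded g ->
  int01 (fun t => f t + g t) = int01 f + int01 g.
Proof. by move=> bf bg; rewrite /int01 RintegralD//; exact: locbounded_integrable. Qed.

Lemma int01Z c f : locbounded f -> int01 (fun t => c * f t) = c * int01 f.
Proof. by move=> bf; rewrite /int01 RintegralZl//; exact: locbounded_integrable. Qed.

Lemma int01N f : locbounded f -> int01 (fun t => - f t) = - int01 f.
Proof.
move=> bf; rewrite -mulN1r -int01Z//; apply: eq_int01 => x _.
by rewrite mulN1r.
Qed.

Lemma int01_cst c : int01 (fun=> c) = c.
Proof.
by rewrite int01_prim ?prim_cst ?mulr1//; exact: locbounded_cst.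
Qed.

Lemma int01_sum (I : Type) (s : seq I) (f : I -> R -> R) :
  (forall i, locbounded (f i)) ->
  int01 (fun t => \sum_(i <- s) f i t) = \sum_(i <- s) int01 (f i).
Proof.
move=> bf; rewrite int01_prim; last exact: locbounded_sum.
by rewrite prim_sum//; apply: eq_bigr => i _; rewrite int01_prim.
Qed.

Lemma le_int01 f g : locbounded f -> locbounded g ->
  (forall x : R, 0 < x < 1 -> f x <= g x) -> int01 f <= int01 g.
Proof.
move=> bf bg fg; apply: le_Rintegral => //; exact: locbounded_integrable.
Qed.

Lemma int01_ge0 f : (forall x : R, 0 < x < 1 -> 0 <= f x) -> 0 <= int01 f.
Proof. by move=> f0; apply: Rintegral_ge0 => x /=; rewrite in_itv/=; exact: f0. Qed.

(** Turns primitives into integrals over a fixed probability space, where Fubini is available. *)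
Lemma prim_indic f (x : R) : 0 <= x <= 1 -> measurable_fun setT f ->
  prim f x = \int[unif R]_t (f t * \1_(`[0, x]) t).
Proof.
move=> /andP[x0 x1] mf; rewrite Rintegral_unif; last first.
  by apply: measurable_funM => //; exact: measurable_indic.
have -> : \int[leb]_(t in `]0, 1[) (f t * \1_`[0, x] t) =
    \int[leb]_(t in `[0, 1]) (f t * \1_`[0, x] t).
  rewrite [LHS]/Rintegral [RHS]/Rintegral [in RHS]integral_itv_bndoo//.
  by apply/measurable_EFinP; apply: measurable_funTS; apply: measurable_funM.
rewrite /prim Rintegral_mkcond [RHS]Rintegral_mkcond; apply: eq_Rintegral => t _.
rewrite !patchE indicE !mem_setE !in_itv/=.
have [t0|t0] := leP 0 t; rewrite /= ?mulr0 ?if_same//.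
have [tx|tx] := leP t x; rewrite /= ?mulr0 ?if_same// mulr1.
by rewrite (le_trans tx x1).
Qed.

Lemma locbounded_prim f : locbounded f -> locbounded (prim f).
Proof.
move=> bf; have [mf _] := bf; split.
  apply: (@measurable_int0 R _ (measurableTypeR R) (fun z => f z.2) id) => //.
  exact: measurableT_comp.
move=> r; have [M M0 fM] := locbounded_bound 0 r bf; exists (M * `|r|) => x xr.
have [x0|x0] := leP 0 x; last by rewrite prim_neg// normr0 mulr_ge0// ltW.
apply: (le_trans (le_normr_Rintegral _ (locbounded_integrable _ _ _ _ bf))) => //.
apply: (@le_trans _ _ (prim (fun=> M) x)).
  apply: le_Rintegral => //.
  - apply: (@locbounded_integrable _ _ _ _ (fun t => `|f t|)).
    split; first exact: measurableT_comp.
    by move=> s; have [N fN] := bf.2 s; exists N => t ts; rewrite normr_id fN.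
  - exact/locbounded_integrable/locbounded_cst.
  - move=> t /=; rewrite in_itv/= => /andP[t0 tx]; apply: fM.
    by rewrite t0/= (le_trans tx)// (le_trans (ler_norm _) xr).
rewrite prim_cst// ler_wpM2l ?(ltW M0)//.
by rewrite (le_trans _ (ler_norm r))// (le_trans (ler_norm x)).
Qed.

Lemma primitive0E f t : primitive0 f t = prim f t - int01 (prim f).
Proof. by []. Qed.

Lemma locbounded_primitive0 f : locbounded f -> locbounded (primitive0 f).
Proof.
move=> bf; apply: locboundedD; first exact: locbounded_prim.
exact: locbounded_cst.
Qed.

End LocallyBounded.

(** * Fubini on the unit square and integration by parts without continuity *)

Section Fubini.
Context {R : realType}.
Implicit Types f g F G : R -> R.
Local Notation leb := (@lebesgue_measure R).
Local Notation U := (unif R).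

Lemma ae_unif01 : {ae U, forall t : measurableTypeR R, 0 < t < 1}.
Proof.
exists (~` `]0, 1[); split; first exact: measurableC.
  by rewrite unif_oo ?setICl ?measure0//; exact: measurableC.
by apply: subsetC => t /=; rewrite in_itv.
Qed.

Lemma fubini_unif (h : measurableTypeR R * measurableTypeR R -> R) (M : R) :
  measurable_fun setT h ->
  (forall x s : R, 0 < x < 1 -> 0 < s < 1 -> `|h (x, s)| <= M) ->
  \int[U]_x \int[U]_s h (x, s) = \int[U]_s \int[U]_x h (x, s).
Proof.
move=> mh hM; have mEh : measurable_fun setT (EFin \o h) by exact/measurable_EFinP.
have ih : (U \x U)%E.-integrable setT (EFin \o h).
  apply/integrable12ltyP => //.
  apply: (@le_lt_trans _ _ (\int[U]_x `|M|%:E)%E); last first.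
    by rewrite integral_unif_cst ltry.
  apply: ae_ge0_le_integral => //=.
  - by move=> x _; apply: integral_ge0.
  - apply: (measurable_fun_fubini_tonelli_F (abse \o (EFin \o h))) => //.
    + exact: measurableT_comp.
    + by move=> z; exact: abse_ge0.
  - apply: filterS ae_unif01 => x x01 _; rewrite -[leRHS]integral_unif_cst.
    apply: ae_ge0_le_integral => //=.
    + apply/measurable_EFinP; apply: measurableT_comp => //.
      by apply: measurableT_comp mh _; exact: measurable_fun_pair.
    + by apply: filterS ae_unif01 => s s01 _; rewrite lee_fin (le_trans (hM _ _ x01 s01))// ler_norm.
have line1 x : 0 < x < 1 -> U.-integrable setT (EFin \o (fun s => h (x, s))).
  move=> x01; apply: (@unif_integrable _ _ M) => [|s s01]; last exact: hM.
  by apply: measurableT_comp mh _; exact: measurable_fun_pair.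
have line2 s : 0 < s < 1 -> U.-integrable setT (EFin \o (fun x => h (x, s))).
  move=> s01; apply: (@unif_integrable _ _ M) => [|x x01]; last exact: hM.
  by apply: measurableT_comp mh _; exact: measurable_fun_pair.
have m1 : measurable_fun setT (fun x : measurableTypeR R => \int[U]_s (EFin \o h) (x, s))%E.
  exact: (measurable_fubini_F ih).
have m2 : measurable_fun setT (fun s : measurableTypeR R => \int[U]_x (EFin \o h) (x, s))%E.
  exact: (measurable_fubini_G ih).
transitivity (fine (\int[U]_x \int[U]_s (EFin \o h) (x, s))%E).
  rewrite [LHS]/Rintegral; congr fine; apply: ae_eq_integral => //.
    by apply: measurableT_comp => //; apply: measurableT_comp m1.
  apply: filterS ae_unif01 => x x01 _; rewrite /= fineK//.
  exact: (integrable_fin_num _ (line1 x x01)).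
rewrite (Fubini ih).
rewrite [RHS]/Rintegral; congr fine; apply: ae_eq_integral => //.
  by apply: measurableT_comp => //; apply: measurableT_comp m2.
apply: filterS ae_unif01 => x x01 _; rewrite /= fineK//.
exact: (integrable_fin_num _ (line2 x x01)).
Qed.

Lemma unif_set1 (x : R) : U [set x] = 0%E.
Proof.
rewrite unif_oo//; apply/eqP; rewrite -measure_le0.
rewrite -(lebesgue_measure_set1 x); apply: le_measure; rewrite ?inE//.
by apply: measurableI.
Qed.

Lemma measurable_natr_bool {disp} {T : measurableType disp} (b : T -> bool) :
  measurable_fun setT b -> measurable_fun setT (fun z => (b z)%:R : R).
Proof.
move=> mb; rewrite (_ : (fun z => _) = fun z => if b z then 1 else 0).
  by apply: measurable_fun_if.
by apply/funext => z; case: (b z).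
Qed.

Lemma oo_integrable (h : R -> R) (N : R) : measurable_fun setT h ->
  (forall r : R, 0 < r < 1 -> `|h r| <= N) -> leb.-integrable `]0, 1[ (EFin \o h).
Proof.
move=> mh hN; apply: measurable_bounded_integrable => //.
- by rewrite /= lebesgue_measure_itv/=; case: ifP => _; rewrite -?EFinB ltry.
- exact: measurable_funTS.
- exists N; split; first exact: num_real.
  move=> K NK x /=; rewrite in_itv/= => x01.
  by rewrite (le_trans (hN _ x01))// ltW.
Qed.

Lemma measurable_int_unif (h : measurableTypeR R * measurableTypeR R -> R) :
  measurable_fun setT h -> measurable_fun setT (fun s : measurableTypeR R => \int[U]_r h (s, r)).
Proof.
move=> mh; rewrite (_ : (fun s => _) =
      fun s : R => \int[leb]_(r in `]0, 1[) h (s, r)).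
    exact: (@measurable_Rintegral R _ (measurableTypeR R) _ h).
  apply/funext => s; rewrite Rintegral_unif//.
  by apply: measurableT_comp mh _; exact: measurable_fun_pair.
Qed.

Lemma norm_int_unif_le (h : R -> R) (N : R) : measurable_fun setT h ->
  (forall r : R, 0 < r < 1 -> `|h r| <= N) -> `|\int[U]_r h r| <= N.
Proof.
move=> mh hN; rewrite Rintegral_unif; last exact: mh.
have ih := oo_integrable mh hN.
apply: le_trans (le_normr_Rintegral _ ih) _; first exact: measurable_itv.
rewrite -[leRHS]int01_cst; apply: le_Rintegral.
- exact: measurable_itv.
- apply: (@oo_integrable (fun t => `|h t|) N); first exact: measurableT_comp.
  by move=> x x01; rewrite normr_id hN.
- exact: (locbounded_integrable _ _ _ _ (locbounded_cst N)).
- by move=> x /=; rewrite in_itv/=; exact: hN.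
Qed.

Lemma int_unif_split (g : R -> R) (s : R) : measurable_fun setT g ->
  \int[U]_r (g r * ((r <= s)%R)%:R + g r * ((s <= r)%R)%:R) = \int[U]_r g r.
Proof.
move=> mg; rewrite [LHS]/Rintegral [RHS]/Rintegral; congr fine.
apply: ae_eq_integral => //.
- apply/measurable_EFinP/measurable_funD; apply: measurable_funM => //;
    by apply: measurable_natr_bool; exact: measurable_fun_ler.
- exact/measurable_EFinP.
(* Both conditions hold on the diagonal [r = s], which is counted twice but has measure 0. *)
exists [set s]; split => //; first exact: unif_set1.
move=> r /= /not_implyP[_ h]; apply/eqP/negPn/negP => rs; apply: h.
by rewrite -mulrDr; case: ltgtP rs => // _ _; rewrite ?addr0 ?add0r mulr1.
Qed.

(** The unit square is the union of the triangles [r <= s] and [s <= r], which overlap in a null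
    diagonal, and Fubini identifies the second summand with the integral over the second triangle.
    This is integration by parts for primitives of bounded functions. *)
Lemma triangle_unif f g (M N : R) :
  measurable_fun setT f -> measurable_fun setT g ->
  (forall x : R, 0 < x < 1 -> `|f x| <= M) -> (forall x : R, 0 < x < 1 -> `|g x| <= N) ->
  \int[U]_s (f s * \int[U]_r (g r * ((r <= s)%R)%:R)) +
  \int[U]_s (g s * \int[U]_r (f r * ((r <= s)%R)%:R)) =
  \int[U]_s f s * \int[U]_s g s.
Proof.
move=> mf mg fM gN.
have half01 : 0 < (2^-1 : R) < 1 by rewrite invr_gt0 invf_lt1 ?ltr1n ?ltr0n.
have M0 : 0 <= M by rewrite (le_trans _ (fM _ half01)).
have N0 : 0 <= N by rewrite (le_trans _ (gN _ half01)).
have mleR : measurable_fun setT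
    (fun z : measurableTypeR R * measurableTypeR R => ((z.2 <= z.1)%R)%:R : R).
  apply: measurable_natr_bool.
  exact: measurable_fun_ler.
have mler (s : R) : measurable_fun setT (fun r : R => ((r <= s)%R)%:R : R).
  apply: measurable_natr_bool.
  exact: measurable_fun_ler.
have mgel (s : R) : measurable_fun setT (fun r : R => ((s <= r)%R)%:R : R).
  apply: measurable_natr_bool.
  exact: measurable_fun_ler.
have ind1 (b : bool) : `|b%:R| <= 1 :> R by case: b; rewrite ?normr1 ?normr0.
have bnd (a b : R) (c : bool) K : `|a| <= K -> `|a * c%:R| <= K.
  move=> aK; rewrite normrM (le_trans _ aK)// ler_piMr//.
have ig s : U.-integrable setT (EFin \o (fun r : R => g r * ((r <= s)%R)%:R)).
  apply: (@unif_integrable _ _ N); first exact: measurable_funM.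
  by move=> t t01; apply: bnd => //; exact: gN.
have ig' s : U.-integrable setT (EFin \o (fun r : R => g r * ((s <= r)%R)%:R)).
  apply: (@unif_integrable _ _ N); first exact: measurable_funM.
  by move=> t t01; apply: bnd => //; exact: gN.
have iF s : U.-integrable setT (EFin \o (fun r : R => f r * ((r <= s)%R)%:R)).
  apply: (@unif_integrable _ _ M); first exact: measurable_funM.
  by move=> t t01; apply: bnd => //; exact: fM.
have igg : U.-integrable setT (EFin \o g) by exact: (@unif_integrable _ _ N).
have iff : U.-integrable setT (EFin \o f) by exact: (@unif_integrable _ _ M).
have swapped : \int[U]_s (g s * \int[U]_r (f r * ((r <= s)%R)%:R)) =
    \int[U]_s (f s * \int[U]_r (g r * ((s <= r)%R)%:R)).
  transitivity (\int[U]_s \int[U]_r (g s * (f r * ((r <= s)%R)%:R))).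
    by apply: eq_Rintegral => s _; rewrite RintegralZl.
  rewrite (@fubini_unif (fun z => g z.1 * (f z.2 * ((z.2 <= z.1)%R)%:R)) (N * M)).
  - apply: eq_Rintegral => s _; rewrite -RintegralZl//.
    by apply: eq_Rintegral => r _ /=; rewrite mulrCA.
  - apply: measurable_funM; first exact: measurableT_comp.
    by apply: measurable_funM => //; exact: measurableT_comp.
  - move=> x s x01 s01; rewrite normrM ler_pM ?gN//=.
    by apply: bnd => //; exact: fM.
have iA : U.-integrable setT (EFin \o (fun s => f s * \int[U]_r (g r * ((r <= s)%R)%:R))).
  apply: (@unif_integrable _ _ (M * N)).
    apply: measurable_funM; first exact: mf.
    apply: (measurable_int_unif (h := fun z => g z.2 * ((z.2 <= z.1)%R)%:R)).
    by apply: measurable_funM mleR; exact: measurableT_comp mg _.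
  move=> t t01; clear ig ig' iF igg iff swapped.
  rewrite normrM ler_pM ?(fM _ t01)//; apply: norm_int_unif_le; first exact: measurable_funM.
  by move=> r r01; apply: bnd => //; exact: gN.
have iB : U.-integrable setT (EFin \o (fun s => f s * \int[U]_r (g r * ((s <= r)%R)%:R))).
  apply: (@unif_integrable _ _ (M * N)).
    apply: measurable_funM; first exact: mf.
    apply: (measurable_int_unif (h := fun z => g z.2 * ((z.1 <= z.2)%R)%:R)).
    apply: measurable_funM; first exact: measurableT_comp mg _.
    by apply: measurable_natr_bool; exact: measurable_fun_ler.
  move=> t t01; clear ig ig' iF igg iff swapped.
  rewrite normrM ler_pM ?(fM _ t01)//; apply: norm_int_unif_le; first exact: measurable_funM.
  by move=> r r01; apply: bnd => //; exact: gN.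
rewrite swapped -(RintegralD measurableT iA iB) -(RintegralZr _ measurableT iff).
apply: eq_Rintegral => s _.
rewrite -mulrDr -(RintegralD measurableT (ig s) (ig' s)); congr (_ * _).
exact: int_unif_split.
Qed.

(** Absolute continuity on the closed unit interval with a bounded density. Piecewise polynomials
    qualify although they lack derivatives at mesh points, and values outside the interval are left
    free. *)
Definition ac F f := locbounded f /\
  forall x : R, 0 <= x <= 1 -> F x = F 0 + prim f x.

Lemma ac_prim f : locbounded f -> ac (prim f) f.
Proof. by move=> bf; split=> // x _; rewrite prim0 add0r. Qed.

Lemma ac_cst c : ac (fun=> c) (fun=> 0).
Proof.
split; first exact: locbounded_cst.
by move=> x /andP[x0 _]; rewrite prim_cst// mul0r addr0.
Qed.

Lemma acD F G f g : ac F f -> ac G g -> ac (fun x => F x + G x) (fun x => f x + g x).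
Proof.
move=> [bf FE] [bg GE]; split; first exact: locboundedD.
by move=> x x01; rewrite primD// FE// GE//; ring.
Qed.

Lemma acZ c F f : ac F f -> ac (fun x => c * F x) (fun x => c * f x).
Proof.
move=> [bf FE]; split; first exact: locboundedZ.
by move=> x x01; rewrite primZ// FE//; ring.
Qed.

Lemma ac_eq F F' f f' : (forall x : R, 0 <= x <= 1 -> F x = F' x) -> f =1 f' ->
  ac F f -> ac F' f'.
Proof.
move=> FF' ff' [bf FE]; have <- : f = f' by exact/funext.
by split => // x x01; rewrite -!FF' ?lexx ?ler01//; exact: FE.
Qed.

Lemma prim_primM f g (x : R) : locbounded f -> locbounded g -> 0 <= x <= 1 ->
  prim (fun s => f s * prim g s) x + prim (fun s => g s * prim f s) x =
  prim f x * prim g x.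
Proof.
move=> bf bg x01; have [x0 x1] := andP x01.
have mI : measurable (`[0, x]%classic : set R) by [].
have [M _ fM] := locbounded_bound 0 1 (locbounded_indic mI bf).
have [N _ gN] := locbounded_bound 0 1 (locbounded_indic mI bg).
(* Cutting both functions off beyond [x] reduces the interval from 0 to [x] to the whole unit
   interval. *)
have inner (h k : R -> R) : locbounded h -> locbounded k ->
    prim (fun s => h s * prim k s) x = \int[U]_s ((h s * \1_(`[0, x]) s) *
      \int[U]_r (k r * \1_(`[0, x]) r * ((r <= s)%R)%:R)).
  move=> bh bk; rewrite prim_indic//; last first.
    by apply: measurable_funM; [case: bh|case: (locbounded_prim bk)].
  apply: eq_Rintegral => s _; rewrite [RHS]mulrAC !indicE mem_setE in_itv/=.
  have [/andP[s0 sx]|] := boolP (0 <= s <= x); last by rewrite !mulr0.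
  rewrite !mulr1; congr (_ * _); rewrite prim_indic; last by case: bk.
    apply: eq_Rintegral => r _; rewrite !indicE !mem_setE !in_itv/= -mulrA -natrM mulnb.
    have [r0|//] := leP 0 r; rewrite /=.
    have [rs|rs] := leP r s; rewrite ?andbF ?andbT//.
    by rewrite (le_trans rs sx).
  by rewrite s0 (le_trans sx).
rewrite !inner// (triangle_unif _ _ (M := M) (N := N)).
- by rewrite -!prim_indic//; [case: bg|case: bf].
- by case: (locbounded_indic mI bf).
- by case: (locbounded_indic mI bg).
- by move=> t /andP[t0 t1]; apply: fM; rewrite !ltW.
- by move=> t /andP[t0 t1]; apply: gN; rewrite !ltW.
Qed.

Lemma acM F G f g : locbounded F -> locbounded G -> ac F f -> ac G g ->
  ac (fun x => F x * G x) (fun x => f x * G x + F x * g x).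
Proof.
move=> bF bG [bf FE] [bg GE]; split.
  by apply: locboundedD; exact: locboundedM.
move=> x x01; have [x0 x1] := andP x01.
(* Writing each function as its value at 0 plus a primitive leaves only one nontrivial product, that
   of the two primitives. *)
rewrite (@eq_prim _ _ (fun t => (G 0 * f t + f t * prim g t) + (F 0 * g t + g t * prim f t))).
  have bfg := locboundedM bf (locbounded_prim bg).
  have bgf := locboundedM bg (locbounded_prim bf).
  rewrite primD ?primD ?primZ//; try by apply: locboundedD => //; exact: locboundedZ.
  - have := prim_primM bf bg x01; rewrite (FE x)// (GE x)// => e.
    have gen (a b c d p q : R) : a + b = c * d ->
        (p + c) * (q + d) = p * q + (q * c + a + (p * d + b)).
      by move=> h; transitivity (p * q + q * c + p * d + c * d); [ring|rewrite -h; ring].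
    exact: gen.
  - exact: locboundedZ.
  - exact: locboundedZ.
move=> t /andP[t0 tx]; rewrite (FE t) ?(GE t) ?t0 ?(le_trans tx)//; ring.
Qed.

Lemma ac_int01 F f : ac F f -> int01 f = F 1 - F 0.
Proof. by move=> [bf FE]; rewrite FE ?ler01 ?lexx// int01_prim//; ring. Qed.

Lemma ac_byparts F G f g : locbounded F -> locbounded G -> ac F f -> ac G g ->
  int01 (fun x => f x * G x) + int01 (fun x => F x * g x) = F 1 * G 1 - F 0 * G 0.
Proof.
move=> bF bG aF aG; rewrite -(ac_int01 (acM bF bG aF aG)) int01D//.
- by apply: locboundedM => //; case: aF.
- by apply: locboundedM => //; case: aG.
Qed.

(** Members of the one-dimensional spaces are uncontrolled outside the unit interval; truncation
    makes them locally bounded without affecting integrals inside it. *)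
Definition cut01 f x : R := if 0 <= x <= 1 then f x else 0.

Lemma cut01E f (x : R) : 0 <= x <= 1 -> cut01 f x = f x.
Proof. by rewrite /cut01 => ->. Qed.

Lemma prim_cut01 f (x : R) : x <= 1 -> prim (cut01 f) x = prim f x.
Proof.
by move=> x1; apply: eq_prim => t /andP[t0 tx]; rewrite cut01E// t0 (le_trans tx).
Qed.

Lemma locbounded_cut01 f (M : R) : measurable_fun (`[0, 1]%classic : set R) f ->
  (forall x : R, 0 <= x <= 1 -> `|f x| <= M) -> locbounded (cut01 f).
Proof.
move=> mf fM; split.
  rewrite (_ : cut01 f = f \_ `[0, 1]); last first.
    by apply/funext => x; rewrite patchE mem_setE in_itv/=.
  by apply/measurable_restrict => //; rewrite setTI.
move=> r; exists `|M| => x _; rewrite /cut01; case: ifPn => x01.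
  by rewrite (le_trans (fM x x01))// ler_norm.
by rewrite normr0.
Qed.

Lemma locbounded_cut01_continuous f : {within `[0, 1], continuous f} ->
  locbounded (cut01 f).
Proof.
move=> cf; have [M _ fM] : exists2 M : R, True & forall x : R, 0 <= x <= 1 -> `|f x| <= M.
  have cnf : {within `[0, 1], continuous (fun x => `|f x|)}.
    by move=> x; apply: continuous_comp; [exact: cf|exact: norm_continuous].
  have [c _ cM] := @EVT_max R (fun x => `|f x|) 0 1 ler01 cnf.
  by exists `|f c| => // x x01; apply: cM; rewrite in_itv.
apply: (@locbounded_cut01 _ M) => //.
exact: subspace_continuous_measurable_fun.
Qed.

Lemma ac_C1 F f :
  (forall x : R, 0 <= x <= 1 -> is_derive x 1 F (f x)) ->
  {within `[0, 1], continuous f} -> ac F (cut01 f).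
Proof.
move=> dF cf; split; first exact: locbounded_cut01_continuous.
move=> x /andP[x0 x1]; rewrite prim_cut01//.
move: x0; rewrite le_eqVlt => /orP[/eqP <-|x0]; first by rewrite prim0 addr0.
have Fc y : 0 <= y <= 1 -> {for y, continuous F}.
  move=> /dF[d _]; apply: differentiable_continuous; exact/derivable1_diffP.
have := @continuous_FTC2 R f F 0 x x0.
rewrite /prim /Rintegral => ->.
- by rewrite -EFinB/=; ring.
- by apply: continuous_subspaceW cf; apply: subset_itvl; rewrite bnd_simp.
- split.
  + move=> y; rewrite in_itv/= => /andP[y0 yx].
    by have [] := dF y; rewrite ?(ltW y0) ?(le_trans (ltW yx)).
  + by apply: cvg_at_right_filter; apply: Fc; rewrite lexx ler01.
  + by apply: cvg_at_left_filter; apply: Fc; rewrite (ltW x0).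
- move=> y; rewrite in_itv/= => /andP[y0 yx].
  have y01 : 0 <= y <= 1 by rewrite (ltW y0) (le_trans (ltW yx)).
  by rewrite derive1E (@derive_val _ _ _ _ _ _ _ (dF y y01)).
Qed.

End Fubini.

(** * The one-dimensional inequality *)

Section Wirtinger.
Context {R : realType}.
Implicit Types f u w : R -> R.

Lemma ac_tan (lam : R) : 0 < lam < pi ->
  exists2 t : R -> R, locbounded t & ac t (fun x => lam ^+ 2 * cut01 (fun=> 1) x + t x ^+ 2).
Proof.
move=> /andP[l0 lpi].
(* Centring at 1/2 keeps the angle within lam / 2 of 0, hence strictly inside the interval where the
   cosine is positive, up to and including both ends. *)
pose th (x : R) := lam * (x - 2^-1).
have cth (x : R) : 0 <= x <= 1 -> 0 < cos (th x).
  move=> /andP[x0 x1]; apply: cos_gt0_pihalf; rewrite /th; apply/andP; split; nra.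
have dth (x : R) : is_derive x 1 th lam.
  have := is_deriveZ lam (is_deriveB (is_derive_id x (1 : R)) (is_derive_cst (2^-1 : R) x (1 : R))).
  by rewrite subr0 /GRing.scale/= mulr1.
pose t x := lam * tan (th x).
have dt (x : R) : 0 <= x <= 1 -> is_derive x 1 t (lam ^+ 2 + t x ^+ 2).
  move=> x01; have c0 : cos (th x) != 0 by rewrite gt_eqF ?cth.
  have dtan := is_derive_tan c0.
  have := @is_derive1_comp R tan th x _ _ dtan (dth x).
  move=> /(is_deriveZ lam).
  have -> : (cos (th x)) ^- 2 = 1 + tan (th x) ^+ 2.
    rewrite /tan expr_div_n -[X in X + _](@divff _ (cos (th x) ^+ 2)) ?sqrf_eq0//.
    by rewrite -mulrDl addrC sin2cos2 subrK mul1r.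
  rewrite /GRing.scale/= /t.
  by have -> : lam * ((1 + tan (th x) ^+ 2) * lam) = lam ^+ 2 + (lam * tan (th x)) ^+ 2 by ring.
have tc (x : R) : 0 <= x <= 1 -> {for x, continuous t}.
  move=> /dt[d _]; apply: differentiable_continuous; exact/derivable1_diffP.
have ct : {within `[0, 1], continuous t}.
  apply: continuous_in_subspaceT => x; rewrite mem_setE in_itv/=; exact: tc.
have ct2 : {within `[0, 1], continuous (fun x => lam ^+ 2 + t x ^+ 2)}.
  apply: continuous_in_subspaceT => x; rewrite mem_setE in_itv/= => x01.
  apply: (@cvgD _ R^o); first exact: cvg_cst.
  by apply: (@cvgM R _ (nbhs x) _ t t); exact: tc.
exists (cut01 t); first exact: locbounded_cut01_continuous.
apply: ac_eq (ac_C1 dt ct2) => [x x01|x]; first by rewrite cut01E.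
by rewrite /cut01; case: ifP => _; rewrite ?mulr1// mulr0 expr0n/= addr0.
Qed.

(* With t' = lam^2 + t^2, the derivative of t w^2 completes u^2 - lam^2 w^2 to
   the square (u + t w)^2. *)
Lemma wirtinger_dirichlet_lt (lam : R) w u : 0 < lam < pi ->
  locbounded w -> locbounded u -> ac w u -> w 0 = 0 -> w 1 = 0 ->
  lam ^+ 2 * int01 (fun x => w x ^+ 2) <= int01 (fun x => u x ^+ 2).
Proof.
move=> lpi bw bu awu w0 w1; have [t bt at'] := ac_tan lpi.
have bw2 := locboundedM bw bw; have bu2 := locboundedM bu bu.
have H := ac_int01 (acM bt bw2 at' (acM bw bw awu awu)).
rewrite w0 w1 !mulr0 subrr in H.
have b1 : locbounded (fun x : R => u x * w x + w x * u x).
  by apply: locboundedD; exact: locboundedM.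
have b2 := at'.1.
set D := (X in int01 X = 0) in H.
have bD : locbounded D by apply: locboundedD; exact: locboundedM.
rewrite -int01Z; last exact: locbounded_sqr.
rewrite -[leRHS]addr0 -H -int01D//.
apply: le_int01; [exact/locboundedZ/bw2|exact: locboundedD|].
move=> x /andP[x0 x1]; rewrite /D cut01E ?(ltW x0) ?(ltW x1)// -subr_ge0.
by have := sqr_ge0 (u x + t x * w x); congr (_ <= _); ring.
Qed.

(** A Rayleigh quotient [q] below pi^2 would leave room for some [lam] strictly between the square
    root of [q] and pi, contradicting the inequality for that [lam]; the midpoint is taken. *)
Lemma wirtinger_dirichlet w u :
  locbounded w -> locbounded u -> ac w u -> w 0 = 0 -> w 1 = 0 ->
  pi ^+ 2 * int01 (fun x => w x ^+ 2) <= int01 (fun x => u x ^+ 2).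
Proof.
move=> bw bu awu w0 w1.
set W := int01 _; set V := int01 _.
have W0 : 0 <= W by apply: int01_ge0 => x _; exact: sqr_ge0.
have V0 : 0 <= V by apply: int01_ge0 => x _; exact: sqr_ge0.
rewrite leNgt; apply/negP => VW.
have pi0 := @pi_gt0 R.
have {W0}Wpos : 0 < W.
  rewrite lt_neqAle W0 andbT eq_sym; apply: contraL VW => /eqP ->.
  by rewrite mulr0 -leNgt.
pose q := V / W.
have qpi : q < pi ^+ 2 by rewrite ltr_pdivrMr.
have q0 : 0 <= q by rewrite divr_ge0// ltW.
have sq : Num.sqrt q < pi.
  by rewrite -(ger0_norm (ltW pi0)) -sqrtr_sqr ltr_sqrt// exprn_gt0.
have s0 := sqrtr_ge0 q.
pose lam := (Num.sqrt q + pi) / 2.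
have lam1 : Num.sqrt q < lam by rewrite /lam; lra.
have lam2 : 0 < lam < pi by apply/andP; split; rewrite /lam; lra.
have := wirtinger_dirichlet_lt lam2 bw bu awu w0 w1.
rewrite -/W -/V -ler_pdivlMr// -/q leNgt => /negP; apply.
by rewrite -[ltLHS]sqr_sqrtr// ltr_pXn2r// ?nnegrE// ltW// (le_lt_trans s0).
Qed.

Lemma int01_primitive0 f : locbounded f -> int01 (primitive0 f) = 0.
Proof.
move=> bf; rewrite (int01D (locbounded_prim bf) (locbounded_cst _)).
by rewrite int01_cst subrr.
Qed.

Lemma ac_primitive0 f : locbounded f -> ac (primitive0 f) f.
Proof.
move=> bf; apply: ac_eq (acD (ac_prim bf) (ac_cst (- int01 (prim f)))) => //.
by move=> x; rewrite addr0.
Qed.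

(* Duality: with u = primitive0 f of mean zero and w the primitive of u, which
   vanishes at both ends, int u^2 = - int f w. *)
Lemma wirtinger_neumann f : locbounded f ->
  int01 (fun x => primitive0 f x ^+ 2) <= pi ^- 2 * int01 (fun x => f x ^+ 2).
Proof.
move=> bf; set u := primitive0 f.
have bu : locbounded u by exact: locbounded_primitive0.
have u0 : int01 u = 0 by exact: int01_primitive0.
pose w := prim u; have bw : locbounded w by exact: locbounded_prim.
have w0 : w 0 = 0 by exact: prim0.
have w1 : w 1 = 0 by rewrite /w -int01_prim.
have := ac_byparts bu bw (ac_primitive0 bf) (ac_prim bu).
rewrite -/w -/u w0 w1 !mulr0 subrr => /eqP; rewrite addrC addr_eq0 => /eqP uu.
have WD := wirtinger_dirichlet bw bu (ac_prim bu) w0 w1.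
have pi0 := @pi_gt0 R; have pi2 : 0 < pi ^+ 2 :> R by rewrite exprn_gt0.
have bf2 : locbounded (fun x => f x ^+ 2) by exact: locbounded_sqr.
have bw2 : locbounded (fun x => w x ^+ 2) by exact: locbounded_sqr.
have bu2 : locbounded (fun x => u x ^+ 2) by exact: locbounded_sqr.
have eu : int01 (fun x => u x ^+ 2) = - int01 (fun x => f x * w x).
  by rewrite -uu; apply: eq_int01 => x _; rewrite expr2.
(* Young's inequality with weights 1 / pi and pi: the Dirichlet inequality bounds pi^2 int w^2 by
   int u^2, which cancels one of the two copies of int u^2 on the left. *)
suff : 2 * - int01 (fun x => f x * w x) <=
    pi ^- 2 * int01 (fun x => f x ^+ 2) + pi ^+ 2 * int01 (fun x => w x ^+ 2).
  by rewrite -eu => h; lra.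
rewrite -int01N; last exact: locboundedM.
rewrite -!int01Z//; last by apply: locboundedN; exact: locboundedM.
rewrite -int01D; [|exact: locboundedZ..].
apply: le_int01.
- by apply/locboundedZ/locboundedN; exact: locboundedM.
- by apply: locboundedD; exact: locboundedZ.
move=> x _; rewrite -subr_ge0.
have := sqr_ge0 (pi^-1 * f x + pi * w x); congr (_ <= _).
have : pi^-1 * pi = 1 :> R by rewrite mulVf// gt_eqF.
move=> e; rewrite sqrrD exprMn exprVn mulrACA e mul1r exprMn mulr2n; ring.
Qed.

(** The variance of [f] is nonnegative. Integrated over lines, this makes averages contractions. *)
Lemma sqr_int01_le f : locbounded f -> int01 f ^+ 2 <= int01 (fun x => f x ^+ 2).
Proof.
move=> bf; set m := int01 f.
have bf2 : locbounded (fun x => f x ^+ 2) by exact: locbounded_sqr.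
have : 0 <= int01 (fun x => f x ^+ 2 + ((- 2 * m) * f x + m ^+ 2)).
  apply: int01_ge0 => x _; have := sqr_ge0 (f x - m); congr (_ <= _); ring.
rewrite int01D//; last by apply: locboundedD; [exact: locboundedZ|exact: locbounded_cst].
rewrite int01D ?int01Z ?int01_cst//; last 3 first.
- exact: locbounded_cst.
- exact: locboundedZ.
- exact: locbounded_cst.
by rewrite -/m => h; rewrite -subr_ge0; move: h; congr (_ <= _); ring.
Qed.

End Wirtinger.

(** * Finite sums of product functions *)

Section Tensors.
Context {R : realType} {d : nat}.
Implicit Types (x : d.-tuple R) (i j k : 'I_d) (f : 'I_d -> R -> R) (u g : d.-tuple R -> R).

Definition line x i u (t : R) : R := u (upd x i t).

Definition rank1 f x : R := \prod_i f i (tnth x i).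
Definition ten (s : seq ('I_d -> R -> R)) x : R := \sum_(f <- s) rank1 f x.
Definition lbfactors f := forall i, locbounded (f i).
(** A literal equality of functions, not one almost everywhere: averages, primitives and derivatives
    in one variable then act on a single factor of each product. *)
Definition tens u := exists2 s, List.Forall lbfactors s & u = ten s.

Definition setfactor f i (h : R -> R) : 'I_d -> R -> R :=
  fun j => if j == i then h else f j.

Lemma lbfactors_set f i h : lbfactors f -> locbounded h -> lbfactors (setfactor f i h).
Proof. by move=> bf bh j; rewrite /setfactor; case: eqP. Qed.

Definition cofactor1 f i x : R := \prod_(j | j != i) f j (tnth x j).

Lemma line_rank1 f x i : line x i (rank1 f) = (fun t => cofactor1 f i x * f i t).
Proof.
apply/funext => t; rewrite /line /rank1 (bigD1 i)//= tnth_upd eqxx mulrC.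
by congr (_ * _); apply: eq_bigr => j ji; rewrite tnth_upd (negbTE ji).
Qed.

Lemma rank1_setfactor f i h x : rank1 (setfactor f i h) x = cofactor1 f i x * h (tnth x i).
Proof.
rewrite /rank1 (bigD1 i)//= /setfactor eqxx mulrC.
by congr (_ * _); apply: eq_bigr => j /negbTE ->.
Qed.

Lemma locbounded_line_rank1 f x i : lbfactors f -> locbounded (line x i (rank1 f)).
Proof. by move=> bf; rewrite line_rank1; exact: locboundedZ. Qed.

Lemma line_ten s x i : line x i (ten s) = fun t => \sum_(f <- s) line x i (rank1 f) t.
Proof. by []. Qed.

Lemma locbounded_ten s x i : List.Forall lbfactors s -> locbounded (line x i (ten s)).
Proof.
rewrite line_ten; elim=> [|f {}s bf _ IH].
  by under eq_fun do rewrite big_nil; exact: locbounded_cst.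
under eq_fun do rewrite big_cons; apply: locboundedD => //.
exact: locbounded_line_rank1.
Qed.

Lemma locbounded_line x i u : tens u -> locbounded (line x i u).
Proof. by move=> [s bs ->]; exact: locbounded_ten. Qed.

Lemma ten_cat s1 s2 x : ten (s1 ++ s2) x = ten s1 x + ten s2 x.
Proof. by rewrite /ten big_cat. Qed.

Lemma tens0 : tens (fun=> 0).
Proof. by exists [::] => //; apply/funext => x; rewrite /ten big_nil. Qed.

Lemma tensD u v : tens u -> tens v -> tens (fun x => u x + v x).
Proof.
move=> [s bs ->] [t bt ->]; exists (s ++ t); first by apply/List.Forall_app.
by apply/funext => x; rewrite ten_cat.
Qed.

Lemma rank1_tens f : lbfactors f -> tens (rank1 f).
Proof.
move=> bf; exists [:: f]; first by constructor.
by apply/funext => x; rewrite /ten big_seq1.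
Qed.

(** Every operator in use is linear on this class, so its properties need a check on products
    only. *)
Lemma tens_rec (P : (d.-tuple R -> R) -> Prop) :
  P (fun=> 0) -> (forall u v, tens u -> tens v -> P u -> P v -> P (fun x => u x + v x)) ->
  (forall f, lbfactors f -> P (rank1 f)) -> forall u, tens u -> P u.
Proof.
move=> P0 PD P1 u [s bs ->]; elim: bs => [|f {}s bf bs IH].
  by rewrite (_ : ten _ = fun=> 0)//; apply/funext => x; rewrite /ten big_nil.
rewrite (_ : ten _ = fun x => rank1 f x + ten s x); last first.
  by apply/funext => x; rewrite /ten big_cons.
by apply: PD => //; [exact: rank1_tens|exists s|exact: P1].
Qed.

Lemma tensM u v : tens u -> tens v -> tens (fun x => u x * v x).
Proof.
move=> tu tv; move: u tu; apply: tens_rec => [|u w _ _ tu tw|f bf].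
- by under eq_fun do rewrite mul0r; exact: tens0.
- by under eq_fun do rewrite mulrDl; exact: tensD.
move: v tv; apply: tens_rec => [|u w _ _ tu tw|g bg].
- by under eq_fun do rewrite mulr0; exact: tens0.
- by under eq_fun do rewrite mulrDr; exact: tensD.
have <- : rank1 (fun i t => f i t * g i t) = fun x => rank1 f x * rank1 g x.
  by apply/funext => x; rewrite /rank1 -big_split.
by apply: rank1_tens => i; exact: locboundedM.
Qed.

Lemma rank1Z i c f : (fun x => c * rank1 f x) = rank1 (setfactor f i (fun t => c * f i t)).
Proof.
apply/funext => x; rewrite rank1_setfactor mulrCA; congr (_ * _).
have := line_rank1 f x i; move/(congr1 (fun h => h (tnth x i))).
by rewrite /line upd_id.
Qed.

(* The index i witnesses that d > 0: the scalar is absorbed by one factor. *)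
Lemma tensZ i c u : tens u -> tens (fun x => c * u x).
Proof.
move: u; apply: tens_rec => [|u v _ _ tu tv|f bf].
- by under eq_fun do rewrite mulr0; exact: tens0.
- by under eq_fun do rewrite mulrDr; exact: tensD.
rewrite (rank1Z i); apply: rank1_tens; apply: lbfactors_set => //.
exact: locboundedZ.
Qed.

Lemma tens_sum (I : Type) (r : seq I) (P : pred I) (F : I -> d.-tuple R -> R) :
  (forall a, P a -> tens (F a)) -> tens (fun x => \sum_(a <- r | P a) F a x).
Proof.
move=> tF; elim: r => [|a r IH].
  by under eq_fun do rewrite big_nil; exact: tens0.
under eq_fun do rewrite big_cons.
case: (boolP (P a)) => // Pa.
by apply: tensD => //; exact: tF.
Qed.

Lemma tens_measurable u : tens u -> measurable_fun setT u.
Proof.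
move: u; apply: tens_rec => [|u v _ _ mu mv|f bf].
- exact: measurable_cst.
- exact: measurable_funD.
apply: measurable_prod => i _; apply: measurableT_comp; first by case: (bf i).
exact: measurable_tnth.
Qed.

(** The one-dimensional descriptions hold up to the endpoints, so identities between representatives
    are proved at every point of the closed cube; the open cube inside it has full measure. *)
Definition cubec : set (d.-tuple R) := [set x | forall i, 0 <= tnth x i <= 1].

Lemma cube_cubec x : cube x -> cubec x.
Proof. by move=> cx i; have /andP[h1 h2] := cx i; rewrite !ltW. Qed.

Lemma cubec_upd x i (t : R) : cubec x -> 0 <= t <= 1 -> cubec (upd x i t).
Proof. by move=> cx t01 j; rewrite tnth_upd; case: eqP. Qed.

Lemma tens_bounded u : tens u -> exists M : R, forall x, cubec x -> `|u x| <= M.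
Proof.
move: u; apply: tens_rec => [|u v _ _ [M uM] [N vN]|f bf].
- by exists 0 => x _; rewrite normr0.
- by exists (M + N) => x cx; rewrite (le_trans (ler_normD _ _))// lerD ?uM ?vN.
have /choice[M fM] : forall i, exists M : R, forall t : R, 0 <= t <= 1 -> `|f i t| <= M.
  by move=> i; have [M _ fM] := locbounded_bound 0 1 (bf i); exists M.
exists (\prod_i M i) => x cx; rewrite normr_prod; apply: ler_prod => i _.
by rewrite normr_ge0 fM.
Qed.

Lemma tens_integrable u : tens u -> (cube_measure R d).-integrable setT (EFin \o u).
Proof.
move=> tu; have [M uM] := tens_bounded tu.
by apply: (@cube_integrable _ _ _ M) => [|x cx]; [exact: tens_measurable|exact/uM/cube_cubec].
Qed.

Lemma average_atE i u x : average_at i u x = int01 (line x i u).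
Proof. by []. Qed.

Lemma primitive_atE i u x :
  primitive_at i u x = prim (line x i u) (tnth x i) - int01 (prim (line x i u)).
Proof. by []. Qed.

Lemma average_atD i u v : tens u -> tens v ->
  average_at i (fun x => u x + v x) = fun x => average_at i u x + average_at i v x.
Proof.
move=> tu tv; apply/funext => x.
by rewrite !average_atE -int01D//; exact: locbounded_line.
Qed.

Lemma primitive0D (f g : R -> R) (t : R) : locbounded f -> locbounded g ->
  primitive0 (fun s => f s + g s) t = primitive0 f t + primitive0 g t.
Proof.
move=> bf bg; rewrite !primitive0E primD//.
rewrite (@eq_int01 _ _ (fun t => prim f t + prim g t)); last by move=> s _; exact: primD.
by rewrite (int01D (locbounded_prim bf) (locbounded_prim bg)) opprD addrACA.
Qed.

Lemma primitive0Z c (f : R -> R) (t : R) : locbounded f ->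
  primitive0 (fun s => c * f s) t = c * primitive0 f t.
Proof.
move=> bf; rewrite !primitive0E primZ//.
rewrite (@eq_int01 _ _ (fun t => c * prim f t)); last by move=> s _; exact: primZ.
by rewrite (int01Z _ (locbounded_prim bf)) mulrBr.
Qed.

Lemma primitive_atD i u v : tens u -> tens v ->
  primitive_at i (fun x => u x + v x) = fun x => primitive_at i u x + primitive_at i v x.
Proof.
move=> tu tv; apply/funext => x.
exact: (primitive0D _ (locbounded_line x i tu) (locbounded_line x i tv)).
Qed.

Lemma average_atZ i c u : tens u ->
  average_at i (fun x => c * u x) = fun x => c * average_at i u x.
Proof.
move=> tu; apply/funext => x.
exact: (int01Z _ (locbounded_line x i tu)).
Qed.

Lemma primitive_atZ i c u : tens u ->
  primitive_at i (fun x => c * u x) = fun x => c * primitive_at i u x.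
Proof.
move=> tu; apply/funext => x; exact: (primitive0Z _ _ (locbounded_line x i tu)).
Qed.

Lemma average_at0 i : average_at i (fun=> 0 : R) = fun=> 0.
Proof. by apply/funext => x; exact: int01_cst. Qed.

Lemma primitive_at0 i : primitive_at i (fun=> 0 : R) = fun=> 0.
Proof.
apply/funext => x; have := primitive0Z 0 (tnth x i) (locbounded_cst (0 : R)).
by rewrite !mul0r.
Qed.

Lemma average_at_rank1 i f : lbfactors f ->
  average_at i (rank1 f) = rank1 (setfactor f i (fun=> int01 (f i))).
Proof.
move=> bf; apply/funext => x; rewrite average_atE line_rank1 rank1_setfactor.
exact: int01Z.
Qed.

Lemma primitive_at_rank1 i f : lbfactors f ->
  primitive_at i (rank1 f) = rank1 (setfactor f i (primitive0 (f i))).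
Proof.
move=> bf; apply/funext => x.
rewrite /primitive_at -/(line x i (rank1 f)) line_rank1 rank1_setfactor.
exact: primitive0Z.
Qed.

Lemma average_at_tens i u : tens u -> tens (average_at i u).
Proof.
move: u; apply: tens_rec => [|u v tu tv tau tav|f bf].
- by rewrite average_at0; exact: tens0.
- by rewrite average_atD//; exact: tensD.
rewrite average_at_rank1//; apply: rank1_tens; apply: lbfactors_set => //.
exact: locbounded_cst.
Qed.

Lemma primitive_at_tens i u : tens u -> tens (primitive_at i u).
Proof.
move: u; apply: tens_rec => [|u v tu tv tau tav|f bf].
- by rewrite primitive_at0; exact: tens0.
- by rewrite primitive_atD//; exact: tensD.
rewrite primitive_at_rank1//; apply: rank1_tens; apply: lbfactors_set => //.
exact: locbounded_primitive0.
Qed.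

Lemma setfactorC f i j a b : i != j ->
  setfactor (setfactor f i a) j b = setfactor (setfactor f j b) i a.
Proof.
move=> ij; apply/funext => k; rewrite /setfactor.
by case: (eqVneq k j) => // ->; rewrite eq_sym (negbTE ij).
Qed.

Lemma setfactorE f i a : setfactor f i a i = a.
Proof. by rewrite /setfactor eqxx. Qed.

Lemma setfactor_neq f i j a : j != i -> setfactor f i a j = f j.
Proof. by rewrite /setfactor => /negbTE ->. Qed.

Lemma average_atC i j u : i != j -> tens u ->
  average_at i (average_at j u) = average_at j (average_at i u).
Proof.
move=> ij; move: u; apply: tens_rec => [|u v tu tv e1 e2|f bf].
- by rewrite !average_at0.
- rewrite (average_atD j tu tv) (average_atD i tu tv).
  rewrite (average_atD i (average_at_tens j tu) (average_at_tens j tv)).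
  by rewrite (average_atD j (average_at_tens i tu) (average_at_tens i tv)) e1 e2.
have bi k (g : 'I_d -> R -> R) (c : R) : lbfactors g -> lbfactors (setfactor g k (fun=> c)).
  by move=> bg; apply: lbfactors_set => //; exact: locbounded_cst.
rewrite (average_at_rank1 j bf) (average_at_rank1 i bf).
rewrite (average_at_rank1 i (bi j f _ bf)) (average_at_rank1 j (bi i f _ bf)); congr rank1.
by rewrite !setfactor_neq// 1?eq_sym// setfactorC// eq_sym.
Qed.

Lemma average_at_primitive_at i u x : tens u ->
  average_at i (primitive_at i u) x = 0.
Proof.
move: u; apply: tens_rec => [|u v tu tv e1 e2|f bf].
- by rewrite primitive_at0 average_at0.
- rewrite primitive_atD//.
  by rewrite (average_atD i (primitive_at_tens i tu) (primitive_at_tens i tv)) e1 e2 addr0.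
rewrite primitive_at_rank1// average_at_rank1; last first.
  by apply: lbfactors_set => //; exact: locbounded_primitive0.
by rewrite rank1_setfactor setfactorE int01_primitive0// mulr0.
Qed.

Definition indep j u := forall x t, u (upd x j t) = u x.

Lemma average_at_indep j u : indep j (average_at j u).
Proof. by move=> x t; rewrite !average_atE; congr int01; apply/funext => s; rewrite /line upd_upd. Qed.

Lemma average_at_indepW i j u : indep j u -> indep j (average_at i u).
Proof.
have [-> _|ij] := eqVneq i j; first exact: average_at_indep.
move=> uj x t; rewrite !average_atE; congr int01; apply/funext => s; rewrite /line.
by rewrite updC 1?eq_sym// uj.
Qed.

Lemma average_at_mulr i u v x : tens u -> indep i v ->
  average_at i (fun x => u x * v x) x = average_at i u x * v x.
Proof.
move=> tu vi; rewrite !average_atE mulrC -int01Z; last exact: locbounded_line.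
by congr int01; apply/funext => t; rewrite /line vi mulrC.
Qed.

Lemma Rintegral_average i u : tens u ->
  \int[cube_measure R d]_x average_at i u x = \int[cube_measure R d]_x u x.
Proof.
move=> tu; have [M uM] := tens_bounded tu; apply: esym.
apply: (@Rintegral_cube_average _ _ i u M) => [|x cx]; first exact: tens_measurable.
exact/uM/cube_cubec.
Qed.

Lemma le_Rintegral_cube u v : tens u -> tens v -> (forall x, u x <= v x) ->
  \int[cube_measure R d]_x u x <= \int[cube_measure R d]_x v x.
Proof. by move=> tu tv uv; apply: le_Rintegral => //; exact: tens_integrable. Qed.

Lemma average_at_contraction i u : tens u ->
  \int[cube_measure R d]_x (average_at i u x ^+ 2) <= \int[cube_measure R d]_x (u x ^+ 2).
Proof.
move=> tu; have tuu := tensM tu tu; have tau := average_at_tens i tu.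
rewrite -(Rintegral_average i tuu).
apply: le_Rintegral_cube => [||x]; [exact: (tensM tau tau)|exact: average_at_tens|].
exact/sqr_int01_le/locbounded_line.
Qed.

Lemma primitive_at_contraction i u : tens u ->
  \int[cube_measure R d]_x (primitive_at i u x ^+ 2) <=
  pi ^- 2 * \int[cube_measure R d]_x (u x ^+ 2).
Proof.
move=> tu; have tuu := tensM tu tu; have tau := primitive_at_tens i tu.
have tauu := tensM tau tau.
(* Integrating in [x_i] first reduces the claim to the one-dimensional inequality on each line. *)
rewrite -(Rintegral_average i tuu) -(Rintegral_average i tauu).
rewrite -RintegralZl//; last exact/tens_integrable/average_at_tens.
apply: le_Rintegral_cube => [||x]; [exact: average_at_tens|exact/(tensZ i)/average_at_tens|].
suff <- : int01 (fun t => primitive0 (line x i u) t ^+ 2) =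
    average_at i (fun x0 => primitive_at i u x0 * primitive_at i u x0) x.
  exact: (wirtinger_neumann (locbounded_line x i tu)).
rewrite /average_at /int01; apply: eq_Rintegral => t _; rewrite /line.
rewrite /primitive_at tnth_upd eqxx.
by rewrite (_ : (fun s => u (upd (upd x i t) i s)) = line x i u)//;
  apply/funext => s; rewrite /line upd_upd.
Qed.

(* A term pairs the factors of a rank-one tensor with their derivatives; sel X
   differentiates in the variables of X. *)
Definition term : Type := (('I_d -> R -> R) * ('I_d -> R -> R))%type.

Definition sel (X : {set 'I_d}) (t : term) : 'I_d -> R -> R :=
  fun i => if i \in X then t.2 i else t.1 i.

Definition tenX (X : {set 'I_d}) (s : seq term) := ten [seq sel X t | t <- s].

Definition lbterm (t : term) := lbfactors t.1 /\ lbfactors t.2.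

(* g is a strong partial derivative of u, by differentiating the j-th factors. *)
Definition dtens j u g := exists s : seq term,
  [/\ List.Forall (fun t => lbterm t /\ ac (t.1 j) (t.2 j)) s,
      u = tenX finset.set0 s & g = tenX [set j]%SET s].

Lemma tenX_tens X s : List.Forall lbterm s -> tens (tenX X s).
Proof.
move=> bs; exists [seq sel X t | t <- s] => //.
elim: bs => [|t {}s [b1 b2] _ IH] /=; constructor => // i.
by rewrite /sel; case: ifP.
Qed.

Lemma sel0 (t : term) : sel finset.set0 t = t.1.
Proof. by apply/funext => i; rewrite /sel inE. Qed.

Lemma sel1 j (t : term) : sel [set j]%SET t = setfactor t.1 j (t.2 j).
Proof. by apply/funext => i; rewrite /sel inE /setfactor; case: eqP => // ->. Qed.

Lemma dtens_tensl j u g : dtens j u g -> tens u.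
Proof.
move=> [s [bs -> _]]; apply: tenX_tens; apply: List.Forall_impl bs.
by move=> t [].
Qed.

Lemma dtens_tensr j u g : dtens j u g -> tens g.
Proof.
move=> [s [bs _ ->]]; apply: tenX_tens; apply: List.Forall_impl bs.
by move=> t [].
Qed.

Lemma dtens0 j : dtens j (fun=> 0) (fun=> 0).
Proof.
by exists [::]; split => //; apply/funext => x; rewrite /tenX /ten big_nil.
Qed.

Lemma dtensD j u v g h : dtens j u g -> dtens j v h ->
  dtens j (fun x => u x + v x) (fun x => g x + h x).
Proof.
move=> [s [bs -> ->]] [t [bt -> ->]]; exists (s ++ t); split.
- by apply/List.Forall_app.
- by apply/funext => x; rewrite /tenX map_cat ten_cat.
- by apply/funext => x; rewrite /tenX map_cat ten_cat.
Qed.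

Lemma dtens_rank1 j f h : lbfactors f -> ac (f j) h ->
  dtens j (rank1 f) (rank1 (setfactor f j h)).
Proof.
move=> bf fh; exists [:: (f, setfactor f j h)]; split.
- constructor => //; split; last by rewrite /= setfactorE.
  by split => //; apply: lbfactors_set => //; case: fh.
- by apply/funext => x; rewrite /tenX /= sel0 /ten big_seq1.
- by apply/funext => x; rewrite /tenX /= sel1 /= setfactorE /ten big_seq1.
Qed.

Lemma dtens_rec j (P : (d.-tuple R -> R) -> (d.-tuple R -> R) -> Prop) :
  P (fun=> 0) (fun=> 0) ->
  (forall u v g h, dtens j u g -> dtens j v h -> P u g -> P v h ->
    P (fun x => u x + v x) (fun x => g x + h x)) ->
  (forall f h, lbfactors f -> ac (f j) h -> P (rank1 f) (rank1 (setfactor f j h))) ->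
  forall u g, dtens j u g -> P u g.
Proof.
move=> P0 PD P1 u g [s [bs -> ->]]; elim: bs => [|t {}s [bt at_] bs IH].
  rewrite (_ : tenX _ _ = fun=> 0); last by apply/funext => x; rewrite /tenX /ten big_nil.
  by rewrite (_ : tenX _ _ = fun=> 0)//; apply/funext => x; rewrite /tenX /ten big_nil.
have E X : tenX X (t :: s) = fun x => rank1 (sel X t) x + tenX X s x.
  by apply/funext => x; rewrite /tenX /ten /= big_cons.
rewrite !E sel0 sel1; apply: PD => //.
- by apply: dtens_rank1 => //; case: bt.
- by exists s.
- by apply: P1 => //; case: bt.
Qed.

Lemma dtens_sum j (I : Type) (r : seq I) (P : pred I) (F G : I -> d.-tuple R -> R) :
  (forall a, P a -> dtens j (F a) (G a)) ->
  dtens j (fun x => \sum_(a <- r | P a) F a x) (fun x => \sum_(a <- r | P a) G a x).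
Proof.
move=> tF; elim: r => [|a r IH].
  by under eq_fun do rewrite big_nil; under [X in dtens _ _ X]eq_fun do rewrite big_nil; exact: dtens0.
under eq_fun do rewrite big_cons; under [X in dtens _ _ X]eq_fun do rewrite big_cons.
case: (boolP (P a)) => // Pa.
by apply: dtensD => //; exact: tF.
Qed.

Lemma dtens_average i j u g : i != j -> dtens j u g ->
  dtens j (average_at i u) (average_at i g).
Proof.
move=> ij; move: u g; apply: dtens_rec => [|u v g h ug vh e1 e2|f h bf fh].
- by rewrite !average_at0; exact: dtens0.
- rewrite (average_atD i (dtens_tensl ug) (dtens_tensl vh)).
  by rewrite (average_atD i (dtens_tensr ug) (dtens_tensr vh)); exact: dtensD.
rewrite average_at_rank1// average_at_rank1; last by apply: lbfactors_set => //; case: fh.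
rewrite setfactor_neq// setfactorC 1?eq_sym//; apply: dtens_rank1.
  by apply: lbfactors_set => //; exact: locbounded_cst.
by rewrite setfactor_neq 1?eq_sym.
Qed.

Lemma dtens_primitive i j u g : i != j -> dtens j u g ->
  dtens j (primitive_at i u) (primitive_at i g).
Proof.
move=> ij; move: u g; apply: dtens_rec => [|u v g h ug vh e1 e2|f h bf fh].
- by rewrite !primitive_at0; exact: dtens0.
- rewrite (primitive_atD i (dtens_tensl ug) (dtens_tensl vh)).
  by rewrite (primitive_atD i (dtens_tensr ug) (dtens_tensr vh)); exact: dtensD.
rewrite primitive_at_rank1// primitive_at_rank1; last by apply: lbfactors_set => //; case: fh.
rewrite setfactor_neq// setfactorC 1?eq_sym//; apply: dtens_rank1.
  by apply: lbfactors_set => //; exact: locbounded_primitive0.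
by rewrite setfactor_neq 1?eq_sym.
Qed.

Lemma dtens_primitive_same i u : tens u -> dtens i (primitive_at i u) u.
Proof.
move: u; apply: tens_rec => [|u v tu tv e1 e2|f bf].
- by rewrite primitive_at0; exact: dtens0.
- by rewrite primitive_atD//; exact: dtensD.
rewrite primitive_at_rank1//.
rewrite [X in dtens _ _ X](_ : rank1 f =
    rank1 (setfactor (setfactor f i (primitive0 (f i))) i (f i))); last first.
  by congr rank1; apply/funext => k; rewrite /setfactor; case: eqP => // ->.
apply: dtens_rank1; first by apply: lbfactors_set => //; exact: locbounded_primitive0.
by rewrite setfactorE; exact: ac_primitive0.
Qed.

Lemma dtens_average_same i u : tens u -> dtens i (average_at i u) (fun=> 0).
Proof.
move: u; apply: tens_rec => [|u v tu tv e1 e2|f bf].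
- by rewrite average_at0; exact: dtens0.
- by rewrite average_atD//; have := dtensD e1 e2; under [X in dtens _ _ X -> _]eq_fun do rewrite addr0.
rewrite average_at_rank1//.
have -> : (fun=> 0 : R) = rank1 (setfactor (setfactor f i (fun=> int01 (f i))) i (fun=> 0)).
  by apply/funext => x; rewrite rank1_setfactor mulr0.
apply: dtens_rank1; first by apply: lbfactors_set => //; exact: locbounded_cst.
by rewrite setfactorE; exact: ac_cst.
Qed.

Lemma dtens_line j u g x : dtens j u g -> ac (line x j u) (line x j g).
Proof.
move: u g; apply: dtens_rec => [|u v g h ug vh e1 e2|f h bf fh].
- exact: ac_cst.
- exact: acD.
by rewrite !line_rank1 setfactorE (_ : cofactor1 _ _ _ = cofactor1 f j x);
  [exact: acZ|apply: eq_bigr => k /negbTE kj; rewrite /setfactor kj].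
Qed.

(** Primitives of [f] differ from [F] by the unknown [F 0]; normalising to mean zero trades it for
    the mean of [F]. This is the one-dimensional homotopy formula. *)
Lemma ac_primitive0_deriv (F f : R -> R) (t : R) : locbounded F -> ac F f -> 0 <= t <= 1 ->
  primitive0 f t = F t - int01 F.
Proof.
move=> bF [bf FE] t01; rewrite primitive0E (FE t)//.
have -> : int01 F = F 0 + int01 (prim f).
  rewrite -[X in X + _]int01_cst -int01D; [|exact: locbounded_cst|exact: locbounded_prim].
  by apply: eq_int01 => s /andP[s0 s1]; apply: FE; rewrite !ltW.
by rewrite opprD addrACA subrr add0r.
Qed.

Lemma primitive_at_deriv i u g x : dtens i u g -> cubec x ->
  primitive_at i g x = u x - average_at i u x.
Proof.
move=> ug cx; rewrite -[X in u X](upd_id x i).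
exact: (ac_primitive0_deriv (locbounded_line x i (dtens_tensl ug)) (dtens_line x ug) (cx i)).
Qed.

End Tensors.

(** * Test functions and the fundamental lemma *)

Section Bump.
Context {R : realType}.

(* The powers x^-k make the family closed under differentiation. *)
Definition flat (k : nat) (x : R) : R := if 0 < x then x ^- k * expR (- x^-1) else 0.

Lemma flat_ge0 k x : 0 <= flat k x.
Proof.
by rewrite /flat; case: ifP => // x0; rewrite mulr_ge0 ?expR_ge0// invr_ge0 exprn_ge0// ltW.
Qed.

Lemma flat_le0 k x : x <= 0 -> flat k x = 0.
Proof. by move=> x0; rewrite /flat (le_gtF x0). Qed.

Lemma flat0_le1 x : flat 0 x <= 1.
Proof.
rewrite /flat; case: ifP => // x0; rewrite expr0 invr1 mul1r -expR0 ler_expR.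
by rewrite oppr_le0 invr_ge0 ltW.
Qed.

(** One term of the exponential series at 1 / x, of degree k + 1, beats the power in front. A bound
    linear in [x], for every [k], is all that differentiability at 0 requires. *)
Lemma flat_bound k (x : R) : 0 < x -> flat k x <= k.+1`!%:R * x.
Proof.
move=> x0; rewrite /flat x0 expRN.
have xi0 : 0 <= x^-1 by rewrite invr_ge0 ltW.
have h : x^-1 ^+ k.+1 <= k.+1`!%:R * expR x^-1.
  rewrite -ler_pdivrMl ?ltr0n ?fact_gt0// mulrC.
  by rewrite (le_trans _ (expR_ge1Dxn k xi0))// lerDr.
rewrite ler_pdivrMr ?expR_gt0// mulrAC -ler_pdivrMr// -exprVn.
by rewrite -exprSr.
Qed.

Lemma is_derive_flat k (x : R) :
  is_derive x 1 (flat k) (- k%:R * flat k.+1 x + flat k.+2 x).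
Proof.
have [x0|x0|x0] := ltgtP x 0.
- rewrite {2 3}/flat ltNge (ltW x0)/= mulr0 addr0.
  have /near_eq_is_derive : {near x, (cst 0 : R -> R) =1 flat k}.
    near=> y; rewrite /flat ltNge.
    have -> // : y <= 0.
    by apply/ltW; near: y; exact: lt_nbhsl.
  by apply.
- have nx : x != 0 by rewrite gt_eqF.
  pose F (y : R) := (y ^+ k)^-1 * expR (- y^-1).
  have dF : is_derive x 1 F (- k%:R * flat k.+1 x + flat k.+2 x).
    have d1 : is_derive x 1 (fun y : R => y^-1) (- x ^- 2).
      have := is_deriveV nx (is_derive_id x (1 : R)).
      by rewrite /GRing.scale/= mulr1.
    have d2 : is_derive x 1 (fun y : R => (y ^+ k)^-1) (- (k%:R * x ^- k.+1)).
      have dX : is_derive x 1 (fun y : R => y ^+ k) (k%:R * x ^+ k.-1).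
        have := is_deriveX k (is_derive_id x (1 : R)).
        by rewrite exprfctE /GRing.scale/= mulr1.
      have := @is_deriveV R (fun y : R => y ^+ k) x _ 1 (expf_neq0 k nx) dX.
      rewrite /GRing.scale/=.
      suff -> : - (x ^+ k) ^- 2 * (k%:R * x ^+ k.-1) = - (k%:R * x ^- k.+1) by [].
      case: k {F dX} => [|k]; first by rewrite !mul0r mulr0 oppr0.
      rewrite /= mulNr mulrCA; congr (- (_ * _)).
      rewrite -exprM muln2 -addnn.
      by rewrite addSnnS exprD invfM mulrAC mulVf ?mul1r// expf_neq0.
    have d3 : is_derive x 1 (fun y : R => expR (- y^-1)) (expR (- x^-1) * x ^- 2).
      have := @is_derive1_comp R expR (fun y => - y^-1) x _ _ (is_derive_expR _) (is_deriveN d1).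
      by rewrite opprK.
    have := is_deriveM d2 d3.
    rewrite /flat x0 /GRing.scale/=.
    suff -> : - k%:R * (x ^- k.+1 * expR (- x^-1)) + x ^- k.+2 * expR (- x^-1) =
      x ^- k * (expR (- x^-1) * x ^- 2) + expR (- x^-1) * - (k%:R * x ^- k.+1) by [].
    have -> : x ^- k.+2 = x ^- k * x ^- 2 by rewrite -addn2 exprD invfM.
    ring.
  have /near_eq_is_derive : {near x, F =1 flat k}.
    near=> y; rewrite /flat /F.
    have -> // : 0 < y.
    by near: y; exact: lt_nbhsr.
  exact.
rewrite x0 {2 3}/flat ltxx mulr0 addr0.
(* On the right of 0 the difference quotient of [flat k] is [flat k.+1], which the linear bound
   sends to 0. *)
have lim0 : h^-1 *: (flat k (h *: 1 + 0 : R) - flat k 0) @[h --> (0 : R)^'] --> (0 : R).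
  apply/cvgr0Pnorm_lt => e e0.
  pose C : R := k.+2`!%:R; have C0 : 0 < C by rewrite ltr0n fact_gt0.
  near=> h.
  rewrite {2}/flat ltxx subr0 addr0 /GRing.scale/= mulr1.
  have [h0|h0] := leP h 0; first by rewrite /flat (le_gtF h0) mulr0 normr0.
  have -> : h^-1 * flat k h = flat k.+1 h.
    by rewrite /flat h0 mulrA -invfM -exprS.
  rewrite ger0_norm ?flat_ge0// (le_lt_trans (flat_bound _ h0))//.
  rewrite -/C mulrC -ltr_pdivlMr//.
  have : `|0 - h| < e / C.
    near: h; apply: nbhs_dnbhs; apply: (@nbhsx_ballx _ R^o 0 (e / C)).
    by rewrite divr_gt0.
  by rewrite sub0r normrN gtr0_norm.
split; first by apply/cvg_ex; exists 0.
exact: (cvg_lim _ lim0).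
Unshelve. all: by end_near. Qed.

(** A syntactic class that contains its own derivatives, so that a single differentiation lemma
    yields derivatives of all orders. *)
Inductive smooth1 : (R -> R) -> Prop :=
  | smooth1_flat k c e : smooth1 (fun x => flat k (c * x + e))
  | smooth1D f g : smooth1 f -> smooth1 g -> smooth1 (fun x => f x + g x)
  | smooth1M f g : smooth1 f -> smooth1 g -> smooth1 (fun x => f x * g x)
  | smooth1Z c f : smooth1 f -> smooth1 (fun x => c * f x).

Lemma smooth1_derive f : smooth1 f ->
  exists2 g, smooth1 g & forall x : R, is_derive x 1 f (g x).
Proof.
elim=> [k c e|{}f g sf [f' sf' df] sg [g' sg' dg]|{}f g sf [f' sf' df] sg [g' sg' dg]|c {}f sf [f' sf' df]].
- exists (fun x => c * (- k%:R * flat k.+1 (c * x + e) + flat k.+2 (c * x + e))).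
    apply/smooth1Z/smooth1D; last exact: smooth1_flat.
    by apply/smooth1Z; exact: smooth1_flat.
  move=> x.
  have dth : is_derive x 1 (fun y : R => c * y + e) c.
    have := is_deriveD (is_deriveZ c (is_derive_id x (1 : R))) (is_derive_cst e x (1 : R)).
    by rewrite addr0 /GRing.scale/= mulr1.
  rewrite mulrC.
  exact: (@is_derive1_comp R (flat k) (fun y => c * y + e) x _ _ (is_derive_flat _ _) dth).
- by exists (fun x => f' x + g' x); [exact: smooth1D|move=> x; exact: is_deriveD].
- exists (fun x => f x * g' x + g x * f' x); last by move=> x; exact: is_deriveM.
  by apply: smooth1D; exact: smooth1M.
- by exists (fun x => c * f' x); [exact: smooth1Z|move=> x; exact: is_deriveZ].
Qed.

Lemma smooth1_continuous f : smooth1 f -> continuous f.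
Proof.
move=> /smooth1_derive[g _ df] x; apply: differentiable_continuous.
by apply/derivable1_diffP; case: (df x).
Qed.

End Bump.

(** * Test functions on the cube and functions that pair to zero with all of them *)

Section TestFunctions.
Context {R : realType} {d : nat}.
Implicit Types (x : d.-tuple R) (i j : 'I_d) (a : 'rV[R]_d).

Definition prodf (f : 'I_d -> R -> R) a : R := \prod_i f i (a 0 i).

Lemma prodfE f a i : prodf f a = (\prod_(j | j != i) f j (a 0 j)) * f i (a 0 i).
Proof. by rewrite /prodf (bigD1 i)//= mulrC. Qed.

Lemma is_derive_prodf f i (g : R -> R) a : is_derive (a 0 i) 1 (f i) (g (a 0 i)) ->
  is_derive a (delta_mx 0 i) (prodf f) (prodf (setfactor f i g) a).
Proof.
move=> [dfi gE]; set C := \prod_(j | j != i) f j (a 0 j).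
have quot h : prodf f (h *: delta_mx 0 i + a) = C * f i (h *: 1 + a 0 i).
  rewrite (prodfE _ _ i) !mxE !eqxx /= mulr1; congr (_ * _ ).
    by apply: eq_bigr => j /negbTE ji; rewrite !mxE ji andbF mulr0 add0r.
  by rewrite /GRing.scale/= mulr1.
have lim : h^-1 *: (prodf f (h *: delta_mx 0 i + a) - prodf f a) @[h --> (0 : R)^'] -->
    C * g (a 0 i).
  under eq_fun => h do rewrite quot (prodfE _ _ i) -/C -mulrBr scalerAr.
  apply: (@cvgMr R _ _ _ _ C).
  by rewrite -gE; exact: dfi.
have -> : prodf (setfactor f i g) a = C * g (a 0 i).
  rewrite (prodfE _ _ i) setfactorE; congr (_ * _).
  by apply: eq_bigr => j ji; rewrite setfactor_neq.
split; first by apply/cvg_ex; exists (C * g (a 0 i)).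
exact: (cvg_lim _ lim).
Qed.

Lemma iter_partial_prodf s f : (forall i, smooth1 (f i)) ->
  exists2 g, (forall i, smooth1 (g i)) & iter_partial s (prodf f) = prodf g.
Proof.
elim: s => [|i s IH] sf /=; first by exists f.
have [g sg ->] := IH sf; have [g' sg' dg'] := smooth1_derive (sg i).
exists (setfactor g i g'); first by move=> j; rewrite /setfactor; case: eqP.
by apply/funext => a; rewrite (@derive_val _ _ _ _ _ _ _ (is_derive_prodf (dg' (a 0 i)))).
Qed.

Lemma continuous_bigprod (T : topologicalType) (I : Type) (r : seq I) (g : I -> T -> R) :
  (forall k, continuous (g k)) -> continuous (fun b : T => \prod_(k <- r) g k b).
Proof.
move=> cg a; elim: r => [|i r IH].
  rewrite /continuous_at big_nil (_ : (fun b => _) = cst 1); first exact: cvg_cst.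
  by apply/funext => b; rewrite big_nil.
rewrite /continuous_at big_cons; under eq_fun do rewrite big_cons.
exact: cvgM (cg i a) IH.
Qed.

Lemma continuous_prodf (f : 'I_d -> R -> R) :
  (forall i, continuous (f i : R -> R)) -> continuous (prodf f).
Proof.
move=> cf; apply: continuous_bigprod => i a.
apply: (@continuous_comp _ _ _ (fun a : 'rV[R]_d => a 0 i) (f i)); last exact: cf.
exact: coord_continuous.
Qed.

Lemma smooth_prodf f : (forall i, smooth1 (f i)) -> smooth (prodf f).
Proof.
move=> sf s; have [g sg ->] := iter_partial_prodf s sf; split.
  by apply: continuous_prodf => i; exact: smooth1_continuous.
move=> i a; have [g' _ dg'] := smooth1_derive (sg i).
by have [] := is_derive_prodf (dg' (a 0 i)).
Qed.

Lemma test_prodf f (al be : R) : 0 < al -> be < 1 -> (forall i, smooth1 (f i)) ->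
  (forall i t, ~~ (al <= t <= be) -> f i t = 0) -> test_function (prodf f).
Proof.
move=> al0 be1 sf f0; split; first exact: smooth_prodf.
exists [set a : 'rV[R]_d | forall i, `[al, be]%classic (a ord0 i)]; split.
- by apply: (@rV_compact R d (fun=> `[al, be]%classic)) => i; exact: segment_compact.
- move=> a /= aK i; have := aK i; rewrite in_itv/= => /andP[h1 h2].
  by rewrite (lt_le_trans al0)//= (le_lt_trans h2).
- move=> a /existsNP[i]; rewrite /= in_itv/= => /negP h.
  by rewrite (prodfE _ _ i) f0// mulr0.
Qed.

Lemma test_continuous phi : @test_function R d phi -> continuous phi.
Proof. by move=> [/(_ [::])[]]. Qed.

Lemma test_derivable phi : @test_function R d phi ->
  forall i a, derivable phi a (delta_mx 0 i).
Proof. by move=> [/(_ [::])[]]. Qed.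

Lemma test_bounded phi : @test_function R d phi -> exists M : R, forall a, `|phi a| <= M.
Proof.
move=> tphi; have cphi := test_continuous tphi; case: tphi => _ [K [cK _ phi0]].
have [K0|/set0P/negP/negPn/eqP K0] := pselect (K !=set0); last first.
  by exists 0 => a; rewrite phi0 ?normr0// K0.
have cnphi : {within K, continuous (fun a => `|phi a|)}.
  by apply: continuous_subspaceT => a; apply: continuous_comp; [exact: cphi|exact: norm_continuous].
have [c _ cM] := EVT_max_rV K0 cK cnphi.
exists `|phi c| => a; have [aK|aK] := pselect (K a); first by apply: cM; rewrite inE.
by rewrite phi0// normr0.
Qed.

Lemma iter_partial_cat s1 s2 (phi : 'rV[R]_d -> R) :
  iter_partial (s1 ++ s2) phi = iter_partial s1 (iter_partial s2 phi).
Proof. by elim: s1 => //= i s ->. Qed.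

Lemma test_partial phi j : @test_function R d phi ->
  test_function (fun a => 'D_(delta_mx 0 j) phi a).
Proof.
move=> [sphi [K [cK Kcube phi0]]]; split.
  by move=> s; have := sphi (s ++ [:: j]); rewrite iter_partial_cat.
exists K; split => // a aK.
(* As [K] is closed, [phi] vanishes in a neighbourhood of each point outside it, so its derivative
   keeps the same compact support. *)
have clK : closed K by apply: compact_closed => //; exact: norm_hausdorff.
have nK : \near a, cst 0 a = phi a.
  have : nbhs a (~` K) by apply: open_nbhs_nbhs; split => //; exact: closed_openC.
  by apply: filterS => b /phi0 ->.
by rewrite -(near_eq_derive _ nK) derive_cst.
Qed.

Lemma row_of_upd x j (t h : R) :
  row_of (upd x j (h *: 1 + t)) = h *: delta_mx 0 j + row_of (upd x j t).
Proof.
apply/rowP => i; rewrite !mxE !tnth_upd eqxx /=.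
by case: eqP => _; rewrite ?mulr0 ?add0r.
Qed.

Lemma is_derive_test_line phi x j (t : R) : test_function phi ->
  is_derive t 1 (line x j (phi \o row_of))
    (line x j (fun x => 'D_(delta_mx 0 j) phi (row_of x)) t).
Proof.
move=> tphi; have dphi := @test_derivable phi tphi j (row_of (upd x j t)).
have E : (fun h => h^-1 *: (line x j (phi \o row_of) (h *: 1 + t) - line x j (phi \o row_of) t))
  = (fun h => h^-1 *: (phi (h *: delta_mx 0 j + row_of (upd x j t)) - phi (row_of (upd x j t)))).
  by apply/funext => h; rewrite /line /= row_of_upd.
by split; rewrite /derivable /derive /= E.
Qed.

(** Continuity refers to the topology of row vectors, measurability to the sigma-algebra generated
    by tuple coordinates. Countably many boxes with rational centres link the two, since they
    exhaust every open preimage. *)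
Lemma measurable_continuous_row_of (phi : 'rV[R]_d -> R) : continuous phi ->
  measurable_fun setT (phi \o @row_of R d).
Proof.
move=> cphi.
pose B (p : {ffun 'I_d -> rat} * nat) : set (d.-tuple R) :=
  [set x | forall i, `|ratr (p.1 i) - tnth x i| < p.2.+1%:R^-1].
have mB p : measurable (B p).
  rewrite (_ : B p = \bigcap_(i in [set: 'I_d])
      ((fun x => `|ratr (p.1 i) - tnth x i|) @^-1` `]-oo, p.2.+1%:R^-1[)); last first.
    by apply/seteqP; split => x /= h i => [_|]; have := h i; rewrite /= in_itv/= => //; apply.
  apply: fin_bigcap_measurable => [|i _]; first exact: finite_finset.
  rewrite -[X in measurable X]setTI; apply: (_ : measurable_fun setT _) => //.
  apply: measurableT_comp => //; apply: measurable_funB => //.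
  exact: measurable_tnth.
apply: (measurability _ (RGenOInfty.measurableE R)).
move=> _ [_ [a ->]] <-; rewrite setTI.
set W := _ @^-1` _.
have -> : W = \bigcup_(n in [set n | exists2 p, unpickle n = Some p & B p `<=` W])
    (if unpickle n is Some p then B p else set0).
  apply/seteqP; split => [x Wx|x [n [p Ep pW]]]; last by rewrite Ep => /pW.
  have : nbhs (row_of x) (phi @^-1` `]a, +oo[).
    by apply: cphi; apply: open_nbhs_nbhs; split => //; exact: interval_open.
  move=> /nbhs_ballP[e /= e0 eW].
  (* Half of [e], since two points of one box are compared through its rational centre. *)
  have [n] : exists n : nat, n.+1%:R^-1 < e / 2.
    have e2 : 0 < e / 2 by rewrite divr_gt0.
    have [n _ nP] := near_infty_natSinv_lt (PosNum e2).
    by exists n; apply: (nP n); rewrite /=.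
  move=> ne.
  have n0 : 0 < n.+1%:R^-1 :> R by rewrite invr_gt0.
  have /choice[q qP] i : exists q : rat, `|ratr q - tnth x i| < n.+1%:R^-1 :> R.
    have lt1 : tnth x i - n.+1%:R^-1 < tnth x i + n.+1%:R^-1.
      by rewrite ltrBlDr -addrA ltrDl addr_gt0.
    have [q] := rat_in_itvoo lt1.
    rewrite in_itv/= => /andP[h1 h2]; exists q.
    by rewrite ltr_distl; apply/andP; split; [exact: h1|exact: h2].
  pose p := ([ffun i => q i], n).
  exists (pickle p); last by rewrite pickleK => i /=; rewrite ffunE; exact: qP.
  exists p; rewrite ?pickleK// => y yB; apply: eW.
  split => // i0 i; rewrite !mxE /ball /=.
  have := yB i; rewrite /= ffunE; have := qP i => h1 h2.
  have -> : tnth x i - tnth y i = (ratr (q i) - tnth y i) - (ratr (q i) - tnth x i) by ring.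
  rewrite (le_lt_trans (ler_normB _ _))// [ltRHS](splitr e).
  by apply: ltrD; [exact: lt_trans h2 ne|exact: lt_trans h1 ne].
by apply: bigcup_measurable => n _; case: unpickle.
Qed.

Lemma measurable_test phi : test_function phi ->
  measurable_fun setT (phi \o @row_of R d).
Proof. by move=> /test_continuous; exact: measurable_continuous_row_of. Qed.

Lemma bounded_locbounded (f : R -> R) (M : R) : measurable_fun setT f ->
  (forall t, `|f t| <= M) -> locbounded f.
Proof. by move=> mf fM; split => // r; exists M. Qed.

Lemma locbounded_test_line phi x j : test_function phi ->
  locbounded (line x j (phi \o row_of)).
Proof.
move=> tphi; have [M phiM] := test_bounded tphi.
apply: (@bounded_locbounded _ M) => [|t]; last exact: phiM.
exact: (measurable_line x j (measurable_test tphi)).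
Qed.

Lemma ac_test_line phi x j : test_function phi ->
  ac (line x j (phi \o row_of)) (line x j ((fun a => 'D_(delta_mx 0 j) phi a) \o row_of)).
Proof.
move=> tphi; have tdphi := test_partial j tphi; split.
  exact: locbounded_test_line.
have dl (t : R) : 0 <= t <= 1 -> is_derive t 1 (line x j (phi \o row_of))
    (line x j ((fun a => 'D_(delta_mx 0 j) phi a) \o row_of) t).
  by move=> _; exact: is_derive_test_line.
have cl : {within `[0, 1], continuous (line x j ((fun a => 'D_(delta_mx 0 j) phi a) \o row_of))}.
  apply: continuous_subspaceT => t; apply: differentiable_continuous.
  apply/derivable1_diffP.
  by have [] := is_derive_test_line x j t tdphi.
have [_ acl] := ac_C1 dl cl.
by move=> t t01; rewrite acl// prim_cut01//; case/andP: t01.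
Qed.

Lemma test_line_ends phi x j (t : R) : test_function phi -> ~~ (0 < t < 1) ->
  phi (row_of (upd x j t)) = 0.
Proof.
move=> [_ [K [_ Kcube phi0]]] t01; apply: phi0 => /Kcube/(_ j).
by rewrite !mxE tnth_upd eqxx (negbTE t01).
Qed.

Lemma tens_test_integrable u phi : tens u -> test_function phi ->
  (cube_measure R d).-integrable setT (EFin \o (fun x => u x * phi (row_of x))).
Proof.
move=> tu tphi; have [M uM] := tens_bounded tu; have [N phiN] := test_bounded tphi.
apply: (@cube_integrable _ _ _ (M * N)) => [|x cx].
  by apply: measurable_funM; [exact: tens_measurable|exact: measurable_test].
by rewrite normrM ler_pM// uM//; exact: cube_cubec.
Qed.

(** Integration in [x_j] comes first: on each line integration by parts applies, and the boundary
    terms vanish because [phi] does outside the open cube. *)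
Lemma dtens_weak j u g phi : dtens j u g -> test_function phi ->
  \int[cube_measure R d]_x (g x * phi (row_of x)) =
  - \int[cube_measure R d]_x (u x * 'D_(delta_mx 0 j) phi (row_of x)).
Proof.
move=> ug tphi; have tdphi := test_partial j tphi.
have tu := dtens_tensl ug; have tg := dtens_tensr ug.
apply/eqP; rewrite -subr_eq0 opprK -RintegralD//; last 2 first.
- exact: tens_test_integrable.
- exact: (tens_test_integrable tu tdphi).
set F := (fun x => _).
have [M1 uM] := tens_bounded tu; have [M2 gM] := tens_bounded tg.
have [N1 phiN] := test_bounded tphi; have [N2 dphiN] := test_bounded tdphi.
rewrite (@Rintegral_cube_average _ _ j F (M2 * N1 + M1 * N2)); last 2 first.
- apply: measurable_funD; apply: measurable_funM; try exact: tens_measurable.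
    exact: measurable_test.
  exact: (measurable_test tdphi).
- move=> x /cube_cubec cx; rewrite (le_trans (ler_normD _ _))// !normrM lerD ?ler_pM ?gM ?uM//.
apply/eqP; rewrite [LHS](_ : _ = \int[cube_measure R d]_x 0).
  by rewrite Rintegral_cst// mul0r.
apply: eq_Rintegral => x _.
have bphi := locbounded_test_line x j tphi.
have := ac_byparts (locbounded_line x j tu) bphi (dtens_line x ug) (ac_test_line x j tphi).
rewrite /line /= !test_line_ends ?ltxx ?andbF// !mulr0 subrr => <-.
rewrite -int01D//.
- by apply: locboundedM => //; exact: locbounded_line.
- by apply: locboundedM; [exact: locbounded_line|exact: (locbounded_test_line x j tdphi)].
Qed.

(** On the open unit interval it tends to the indicator of [a < t] as [n] grows. The shifts by -1
    push the support away from both ends, which makes it compact inside the interval when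
    [0 <= a]. *)
Definition bump n (a t : R) : R :=
  flat 0 (n%:R * (t - a) - 1) * flat 0 (n%:R * (1 - t) - 1).

Lemma smooth1_bump n (a : R) : smooth1 (bump n a).
Proof.
have h1 : smooth1 (fun t : R => flat 0 (n%:R * t + (- n%:R * a - 1))) by exact: smooth1_flat.
have h2 : smooth1 (fun t : R => flat 0 (- n%:R * t + (n%:R - 1))) by exact: smooth1_flat.
have := smooth1M h1 h2; congr smooth1; apply/funext => t; rewrite /bump.
by congr (flat _ _ * flat _ _); ring.
Qed.

Lemma bump_ge0 n (a t : R) : 0 <= bump n a t.
Proof. by rewrite mulr_ge0 ?flat_ge0. Qed.

Lemma bump_le1 n (a t : R) : bump n a t <= 1.
Proof. by rewrite -[leRHS]mulr1 ler_pM ?flat_ge0 ?flat0_le1. Qed.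

Lemma bump_out n (a t : R) : 0 <= a -> ~~ (n%:R^-1 <= t <= 1 - n%:R^-1) -> bump n a t = 0.
Proof.
move=> a0; rewrite /bump.
case: n => [|n]; first by rewrite !mul0r sub0r flat_le0 ?lerN10// mul0r.
have n0 : 0 < n.+1%:R :> R by [].
rewrite negb_and -!ltNge => /orP[h|h].
  rewrite flat_le0 ?mul0r// subr_le0 -ler_pdivlMl// mulr1.
  by rewrite (le_trans _ (ltW h))// lerBlDr lerDl.
rewrite [X in _ * X]flat_le0 ?mulr0// subr_le0 -ler_pdivlMl// mulr1.
by rewrite lerBlDr -lerBlDl ltW.
Qed.

Lemma cvg_flat0 (s : R) : 0 < s -> flat 0 (n%:R * s - 1) @[n --> \oo] --> (1 : R).
Proof.
move=> s0; have half : 0 < s / 2 by rewrite divr_gt0.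
have big : \forall n \near \oo, 0 < n%:R * s - 1 :> R.
  near=> n; rewrite subr_gt0 -ltr_pdivrMr// div1r.
  by near: n; exact: nbhs_infty_gtr.
suff : expR (- (n%:R * s - 1)^-1) @[n --> \oo] --> (1 : R).
  apply: cvg_trans; apply: near_eq_cvg; near=> n.
  rewrite /flat ifT ?expr0 ?invr1 ?mul1r//; near: n; exact: big.
rewrite -[X in _ --> X]expR0; apply: continuous_cvg; first exact: continuous_expR.
rewrite -[X in _ --> X]oppr0; apply: cvgN; apply/gtr0_cvgV0; first exact: big.
apply/cvgryPge => A; near=> n.
rewrite lerBrDr -ler_pdivrMr//.
by near: n; exact: nbhs_infty_ger.
Unshelve. all: by end_near. Qed.

Lemma cvg_bump (a t : R) : 0 < t < 1 ->
  bump n a t @[n --> \oo] --> ((a < t)%R%:R : R).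
Proof.
move=> /andP[t0 t1]; have [at_|ta] := ltP a t.
  rewrite -[X in _ --> X]mulr1; apply: cvgM; apply: cvg_flat0; lra.
have -> : (fun n => bump n a t) = cst 0; last exact: cvg_cst.
apply/funext => n; rewrite /bump flat_le0 ?mul0r//.
by rewrite subr_le0 (@le_trans _ _ 0)// mulr_ge0_le0// subr_le0.
Qed.

(* Products of one-dimensional bumps converge boundedly to the indicator of an
   orthant intersected with the cube. *)
Lemma fundamental_orthant (f : d.-tuple R -> R) :
  (cube_measure R d).-integrable setT (EFin \o f) ->
  (forall phi, test_function phi -> \int[cube_measure R d]_x (f x * phi (row_of x)) = 0) ->
  forall c : 'I_d -> R,
    (\int[cube_measure R d]_(x in [set x | forall i, (c i < tnth x i)%R]) (f x)%:E = 0)%E.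
Proof.
move=> intf fphi c.
have mf : measurable_fun setT f by apply/measurable_EFinP; case/integrableP : intf.
(* Raising a negative corner to 0 changes nothing inside the cube and keeps the bumps supported
   there; the shift of [n] by 3 below keeps its inverse positive. *)
pose a i := Num.max (c i) 0.
pose phi n : 'rV[R]_d -> R := prodf (fun i => bump n.+3 (a i)).
have tphi n : test_function (phi n).
  apply: (@test_prodf _ n.+3%:R^-1 (1 - n.+3%:R^-1)).
  - by rewrite invr_gt0.
  - by rewrite ltrBlDr ltrDl invr_gt0.
  - by move=> i; exact: smooth1_bump.
  - by move=> i t h; apply: bump_out => //; rewrite /a le_max lexx orbT.
pose g x : R := \prod_(i < d) ((a i < tnth x i)%R)%:R.
have mg : measurable_fun setT g.
  apply: measurable_prod => i _; apply: measurable_natr_bool.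
  by apply: measurable_fun_ltr => //; exact: measurable_tnth.
have phi1 n y : `|phi n y| <= 1.
  rewrite /phi /prodf normr_prod; apply: prodr_ile1 => i _.
  by rewrite normr_ge0 ger0_norm ?bump_ge0 ?bump_le1.
have cvg_int : (\int[cube_measure R d]_x (f x * phi n (row_of x))%:E)%E @[n --> \oo] -->
    (\int[cube_measure R d]_x (f x * g x)%:E)%E.
  have [] := @dominated_convergence _ _ R (cube_measure R d) setT measurableT
    (fun n x => (f x * phi n (row_of x))%:E) (fun x => (f x * g x)%:E)
    (fun x => `|f x|%:E).
  - by move=> n; apply/measurable_EFinP; apply: measurable_funM => //; exact: measurable_test.
  - by apply/measurable_EFinP; exact: measurable_funM.
  - apply: filterS (ae_cube d) => x cx _.
    apply: cvg_EFin; first exact: nearW.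
    apply: cvgMr; rewrite /phi /prodf /g.
    rewrite (_ : (fun n => _) = fun n => \prod_(i < d) bump n.+3 (a i) (tnth x i)); last first.
      by apply/funext => n /=; apply: eq_bigr => i _; rewrite mxE.
    elim: (index_enum _) => [|i r IH].
      rewrite big_nil (_ : (fun n => _) = cst 1); first exact: cvg_cst.
      by apply/funext => n; rewrite big_nil.
    rewrite big_cons; under eq_fun do rewrite big_cons.
    apply: cvgM IH.
    have := @cvg_bump (a i) (tnth x i) (cx i).
    by rewrite -(cvg_shiftn 3); under eq_fun do rewrite addn3.
  - exact: integrable_norm.
  - apply: aeW => n x _ /=; rewrite lee_fin normrM -[leRHS]mulr1.
    by rewrite ler_wpM2l.
  - by move=> _ _; apply.
have int0 : (\int[cube_measure R d]_x (f x * g x)%:E = 0)%E.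
  apply/esym; apply: cvg_unique cvg_int => //.
  rewrite (_ : (fun n => _) = cst 0%E); first exact: cvg_cst.
  apply/funext => n; have := fphi _ (tphi n); rewrite /Rintegral => /eqP.
  rewrite fine_eq0; first by move/eqP.
  apply: integrable_fin_num => //.
  apply: le_integrable intf => //.
    apply/measurable_EFinP; apply: measurable_funM => //; exact: measurable_test.
  by move=> x _ /=; rewrite lee_fin normrM ler_piMr.
have mO : measurable [set x : d.-tuple R | forall i, c i < tnth x i].
  rewrite (_ : [set x | _] = \bigcap_(i in [set: 'I_d])
    ((fun x : d.-tuple R => tnth x i) @^-1` `]c i, +oo[)); last first.
    by apply/seteqP; split => x /= h i => [_|]; have := h i; rewrite /= in_itv/= andbT => //; apply.
  apply: fin_bigcap_measurable => [|i _]; first exact: finite_finset.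
  by rewrite -[X in measurable X]setTI; exact: (@measurable_tnth _ R d i).
rewrite -int0 integral_mkcond; apply: ae_eq_integral => //.
- by apply/measurable_restrict => //; rewrite setTI; apply/measurable_EFinP/measurable_funTS.
- by apply/measurable_EFinP; exact: measurable_funM.
apply: filterS (ae_cube d) => x cx _; rewrite patchE /g /a.
have E i : (Num.max (c i) 0 < tnth x i) = (c i < tnth x i).
  by rewrite gt_max; have /andP[-> _] := cx i; rewrite andbT.
case: ifPn => [|]; rewrite ?inE ?notin_setE/=.
  by move=> h; rewrite big1 ?mulr1// => i _; rewrite E h.
move=> /existsNP[i /negP ci]; rewrite (bigD1 i)//= E (negbTE ci) mul0r mulr0//.
Unshelve. all: by end_near. Qed.

(** Orthants are stable under intersection, as the Dynkin argument requires. They generate because a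
    half-space in one coordinate is a countable union of orthants whose other corners tend to minus
    infinity. *)
Lemma tuple_sigma_orthants : @measurable _ (d.-tuple R) =
  <<s [set A : set (d.-tuple R) | exists c : 'I_d -> R, A = [set x | forall i, c i < tnth x i]] >>.
Proof.
set G := (X in <<s X >>).
apply/seteqP; split; last first.
  apply: smallest_sub; first exact: sigma_algebra_measurable.
  move=> _ [c ->].
  rewrite (_ : [set x | _] = \bigcap_(i in [set: 'I_d])
    ((fun x : d.-tuple R => tnth x i) @^-1` `]c i, +oo[)); last first.
    by apply/seteqP; split => x /= h i => [_|]; have := h i; rewrite /= in_itv/= andbT => //; apply.
  apply: fin_bigcap_measurable => [|i _]; first exact: finite_finset.
  by rewrite -[X in measurable X]setTI; exact: (@measurable_tnth _ R d i).
apply: smallest_sub; first exact: smallest_sigma_algebra.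
move=> A; rewrite -bigcup_seq => -[i _] [B mB <-]; rewrite setTI.
suff : (@measurable _ (measurableTypeR R)) `<=` [set B | <<s G >> ((fun x : d.-tuple R => tnth x i) @^-1` B)].
  by move=> /(_ B mB).
rewrite RGenOInfty.measurableE; apply: smallest_sub.
  split.
  - by rewrite /= preimage_set0; exact: sigma_algebra0.
  - by move=> C /= hC; rewrite setTD preimage_setC; exact: sigma_algebraC.
  - by move=> F /= hF; rewrite preimage_bigcup; exact: sigma_algebra_bigcup.
move=> _ [a ->] /=.
have -> : (fun x : d.-tuple R => tnth x i) @^-1` `]a, +oo[ =
    \bigcup_n [set x | forall j, (if j == i then a else - n%:R) < tnth x j].
  apply/seteqP; split => [x /=|x [n _] /= /(_ i)]; rewrite in_itv/= andbT ?eqxx//.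
  move=> ax; exists (Num.bound (\sum_j `|tnth x j|)) => //= j; case: eqP => [->//|_].
  rewrite ltrNl (le_lt_trans (ler_norm _))// normrN.
  rewrite (@le_lt_trans _ _ (\sum_j `|tnth x j|))//; last first.
    by apply: archi_boundP; exact: sumr_ge0.
  by rewrite (bigD1 j)//= lerDl sumr_ge0.
apply: sigma_algebra_bigcup => n; apply: sub_sigma_algebra.
by exists (fun j => if j == i then a else - n%:R).
Qed.

(** The integrals over orthants vanish; orthants form a generating pi-system, so the integrals over
    all measurable sets vanish, and an integrable function with this property is zero almost
    everywhere. *)
Lemma fundamental_lemma (f : d.-tuple R -> R) :
  (cube_measure R d).-integrable setT (EFin \o f) ->
  (forall phi, test_function phi -> \int[cube_measure R d]_x (f x * phi (row_of x)) = 0) ->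
  {ae cube_measure R d, forall x, f x = 0}.
Proof.
move=> intf fphi; have ort := fundamental_orthant intf fphi.
have mf : measurable_fun setT (EFin \o f) by case/integrableP : intf.
have cube_int (A : set (d.-tuple R)) : measurable A -> cube `<=` A ->
    (\int[cube_measure R d]_(x in A) (f x)%:E = \int[cube_measure R d]_x (f x)%:E)%E.
  move=> mA cA; rewrite integral_mkcond; apply: ae_eq_integral => //.
    by apply/measurable_restrict => //; rewrite setTI; exact: measurable_funTS.
  by apply: filterS (ae_cube d) => x cx _; rewrite patchE mem_set//; exact: cA.
(* Complements in the Dynkin step need the total integral. The orthant with corner -1 contains the
   cube and so captures it. *)
have intT : (\int[cube_measure R d]_x (f x)%:E = 0)%E.
  rewrite -(cube_int [set x | forall i, (-1 < tnth x i)%R]); first exact: (ort (fun=> -1)).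
    rewrite tuple_sigma_orthants; apply: sub_sigma_algebra; by exists (fun=> -1).
  by move=> x cx i; have /andP[x0 _] := cx i; rewrite (lt_trans _ x0)// ltrN10.
have allA A : measurable A -> (\int[cube_measure R d]_(x in A) (f x)%:E = 0)%E.
  move=> mA.
  have mA' := mA; rewrite tuple_sigma_orthants in mA'.
  move: A mA' {mA}; apply: (dynkin_induction
    (P := fun A => (\int[cube_measure R d]_(x in A) (f x)%:E = 0)%E)).
  - exact: tuple_sigma_orthants.
  - move=> _ _ [c ->] [c' ->]; exists (fun i => Num.max (c i) (c' i)).
    apply/seteqP; split => x /=.
      by move=> [h h'] i; rewrite gt_max h h'.
    by move=> h; split => i; have := h i; rewrite gt_max => /andP[].
  - exact: intT.
  - by move=> _ [c ->]; exact: ort.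
  - move=> S mS S0.
    have := @integral_setU_EFin _ _ R (cube_measure R d) S (~` S) f mS (measurableC mS).
    rewrite setUCr S0 add0e intT => <- //; first exact/measurable_EFinP.
    by rewrite disj_set2E setICr.
  - move=> F mF tF F0.
    have mUF : measurable (\bigcup_k F k) by exact: bigcup_measurable.
    rewrite integral_bigcup//; last by apply: integrableS intf.
    by under eq_eseriesr do rewrite F0; rewrite eseries0.
have := @integral_ae_eq _ _ R (cube_measure R d) setT measurableT (cst 0%E) (EFin \o f) intf
  (measurable_cst _).
have h E : E `<=` setT -> measurable E ->
    (\int[cube_measure R d]_(x in E) (EFin \o f) x = \int[cube_measure R d]_(x in E) cst 0%E x)%E.
  by move=> _ mE; rewrite integral0; exact: allA.
move=> /(_ h); apply: filterS => x /(_ I) /= [].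
by [].
Qed.

End TestFunctions.

(** * The one-dimensional spaces *)

Section Spaces.
Context {R : realType}.
Implicit Types (k m p j : nat) (f g q v z y : R -> R).
Local Notation leb := (@lebesgue_measure R).

Lemma grid0 m : grid m 0 = 0 :> R.
Proof. by rewrite /grid mul0r. Qed.

Lemma exp2_gt0 m : 0 < 2 ^+ m :> R.
Proof. by rewrite exprn_gt0. Qed.

Lemma grid_last m : grid m (2 ^ m) = 1 :> R.
Proof. by rewrite /grid natrX divff// gt_eqF// exp2_gt0. Qed.

Lemma ler_grid m i j : (grid m i <= grid m j :> R) = (i <= j)%N.
Proof. by rewrite /grid ler_pM2r ?invr_gt0 ?exp2_gt0// ler_nat. Qed.

Lemma ltr_grid m i j : (grid m i < grid m j :> R) = (i < j)%N.
Proof. by rewrite /grid ltr_pM2r ?invr_gt0 ?exp2_gt0// ltr_nat. Qed.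

Lemma grid_ge0 m j : 0 <= grid m j :> R.
Proof. by rewrite -(grid0 m) ler_grid. Qed.

Lemma grid_le1 m j : (grid m j <= 1 :> R) = (j <= 2 ^ m)%N.
Proof. by rewrite -[X in _ <= X](grid_last m) ler_grid. Qed.

Lemma grid_double m j : grid m.+1 (2 * j) = grid m j :> R.
Proof.
by rewrite /grid natrM exprS invfM mulrACA divff ?mul1r// pnatr_eq0.
Qed.

Lemma grid_cell m (x : R) : 0 <= x < 1 ->
  exists2 j, (j < 2 ^ m)%N & grid m j <= x < grid m j.+1.
Proof.
move=> /andP[x0 x1]; exists (Num.truncn (x * 2 ^+ m)).
  rewrite -(ltr_nat R) natrX (le_lt_trans (y := x * 2 ^+ m))//.
    by have /andP[] := truncn_itv (mulr_ge0 x0 (ltW (exp2_gt0 m))).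
  by rewrite gtr_pMl// exp2_gt0.
have /andP[h1 h2] := truncn_itv (mulr_ge0 x0 (ltW (exp2_gt0 m))).
by rewrite /grid ler_pdivrMr ?exp2_gt0// h1 ltr_pdivlMr ?exp2_gt0.
Qed.

(** A notion that glues over unions: open cells carry polynomials, while at mesh points, where the
    value is arbitrary, singletons always qualify. *)
Definition mbounded (D : set R) f :=
  measurable_fun D f /\ exists M : R, forall x, D x -> `|f x| <= M.

Lemma mboundedU (A B : set R) f : measurable A -> measurable B ->
  mbounded A f -> mbounded B f -> mbounded (A `|` B) f.
Proof.
move=> mA mB [mfA [M fM]] [mfB [N fN]]; split; first exact/measurable_funU.
exists (Num.max M N) => x [Ax|Bx]; first by rewrite le_max fM.
by rewrite le_max fN// orbT.
Qed.

Lemma mbounded1 (x : R) f : mbounded [set x] f.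
Proof.
split; first exact: measurable_fun_set1.
by exists `|f x| => _ ->.
Qed.

Lemma horner_continuous (P : {poly R}) : continuous (horner P).
Proof.
move=> x; apply: differentiable_continuous; apply/derivable1_diffP.
exact: derivable_horner.
Qed.

Lemma locbounded_continuous f : continuous f -> locbounded f.
Proof.
move=> cf; split; first exact: continuous_measurable_fun.
move=> r.
have cnf : {within `[- `|r|, `|r|], continuous (fun x => `|f x|)}.
  apply: continuous_subspaceT => x.
  by apply: continuous_comp; [exact: cf|exact: norm_continuous].
have [|c _ cM] := @EVT_max R _ (- `|r|) `|r| _ cnf.
  by rewrite (@le_trans _ _ 0)// oppr_le0.
exists `|f c| => x xr; apply: cM; rewrite in_itv/= -ler_norml.
by rewrite (le_trans xr)// ler_norm.
Qed.

Lemma locbounded_horner (P : {poly R}) : locbounded (horner P).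
Proof. by apply: locbounded_continuous; exact: horner_continuous. Qed.

Lemma mbounded_poly (a b : R) f (P : {poly R}) :
  (forall x, a < x < b -> f x = P.[x]) -> mbounded `]a, b[ f.
Proof.
move=> fP; split.
  apply: (eq_measurable_fun (horner P)).
    by move=> x; rewrite mem_setE in_itv/= => /fP.
  by apply: measurable_funTS; case: (locbounded_horner P).
have [M _ PM] := locbounded_bound a b (locbounded_horner P).
by exists M => x /=; rewrite in_itv/= => xab; rewrite fP// PM//; case/andP: xab => *; rewrite !ltW.
Qed.

Lemma Qspace_mbounded k m q : Qspace k m q -> mbounded `[0, 1] q.
Proof.
move=> Qq; suff H N : (N <= 2 ^ m)%N -> mbounded `[0, grid m N] q.
  by have := H _ (leqnn _); rewrite grid_last.
elim: N => [_|N IH Nm]; first by rewrite grid0 set_itv1; exact: mbounded1.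
have [P _ qP] := Qq N Nm.
have gN : grid m N < grid m N.+1 :> R by rewrite ltr_grid.
have -> : (`[0, grid m N.+1] : set R)%classic =
    (`[0, grid m N] `|` (`]grid m N, grid m N.+1[ `|` [set grid m N.+1]))%classic.
  apply/seteqP; split => x /=; rewrite !in_itv/=.
    move=> /andP[x0 x1]; have [xN|xN] := leP x (grid m N); first by left; rewrite x0.
    right; move: x1; rewrite le_eqVlt => /orP[/eqP ->|x1]; first by right.
    by left.
  move=> [/andP[-> h]|[/andP[h h']|->]].
  - by rewrite (le_trans h)// ltW.
  - by rewrite (ltW h') (le_trans (grid_ge0 m N))// ltW.
  - by rewrite grid_ge0 lexx.
apply: mboundedU => //; first exact: measurableU.
  by apply: IH; exact: ltnW.
apply: mboundedU => //; first exact: mbounded_poly qP.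
exact: mbounded1.
Qed.

Lemma locbounded_cut01_Qspace k m q : Qspace k m q -> locbounded (cut01 q).
Proof.
move=> /Qspace_mbounded[mq [M qM]]; apply: (@locbounded_cut01 _ _ M) => // x x01.
Qed.

Lemma cell01 m j (x : R) : (j < 2 ^ m)%N -> grid m j < x < grid m j.+1 -> 0 < x < 1.
Proof.
move=> jm /andP[h1 h2]; rewrite (le_lt_trans (grid_ge0 m j))//=.
by rewrite (lt_le_trans h2)// grid_le1.
Qed.

Lemma Qspace_cut01 k m q : Qspace k m q -> Qspace k m (cut01 q).
Proof.
move=> Qq j jm; have [P sP qP] := Qq j jm; exists P => // x xj.
by rewrite cut01E ?qP//; have /andP[h1 h2] := cell01 jm xj; rewrite !ltW.
Qed.

Lemma dot01E f g : dot01 f g = int01 (fun x => f x * g x).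
Proof. by []. Qed.

Lemma Zspace_cut01 k m z : Zspace k m z -> Zspace k m (cut01 z).
Proof.
move=> [Qz]; case: m Qz => [|p] Qz zq; split => //; try exact: Qspace_cut01.
move=> q Qq; rewrite -(zq q Qq) !dot01E; apply: eq_int01 => x /andP[x0 x1].
by rewrite cut01E// !ltW.
Qed.

Lemma Qspace_locbounded k m q : (forall x : R, ~~ (0 <= x <= 1) -> q x = 0) ->
  Qspace k m q -> locbounded q.
Proof.
move=> q0 Qq; have -> : q = cut01 q.
  by apply/funext => x; rewrite /cut01; case: ifPn => // /q0.
exact: locbounded_cut01_Qspace Qq.
Qed.

Lemma QspaceD k m q v : Qspace k m q -> Qspace k m v -> Qspace k m (fun x => q x + v x).
Proof.
move=> Qq Qv j jm; have [P sP qP] := Qq j jm; have [S sS vS] := Qv j jm.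
exists (P + S); first by rewrite (leq_trans (size_polyD _ _))// geq_max sP.
by move=> x xj; rewrite qP// vS// hornerD.
Qed.

Lemma QspaceZ k m c q : Qspace k m q -> Qspace k m (fun x => c * q x).
Proof.
move=> Qq j jm; have [P sP qP] := Qq j jm.
exists (c *: P); first by rewrite (leq_trans (size_scale_leq _ _)).
by move=> x xj; rewrite qP// hornerZ.
Qed.

Lemma Qspace0 k m : @Qspace R k m (fun=> 0).
Proof. by move=> j _; exists 0; rewrite ?size_poly0// => x _; rewrite horner0. Qed.

Lemma Qspace_sum k m (I : Type) (r : seq I) (F : I -> R -> R) :
  (forall i, Qspace k m (F i)) -> Qspace k m (fun x => \sum_(i <- r) F i x).
Proof.
move=> QF; elim: r => [|i r IH].
  by under eq_fun do rewrite big_nil; exact: Qspace0.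
by under eq_fun do rewrite big_cons; exact: QspaceD.
Qed.

Lemma ZspaceZ k m c z : Zspace k m z -> Zspace k m (fun x => c * z x).
Proof.
move=> [Qz]; case: m Qz => [|p] Qz zq; split => //; try exact: QspaceZ.
move=> q Qq.
have Z0 : dot01 (cut01 z) (cut01 q) = 0.
  rewrite -(zq q Qq) !dot01E; apply: eq_int01 => x /andP[x0 x1].
  by rewrite !cut01E// !ltW.
rewrite -[RHS](mulr0 c) -Z0 !dot01E -int01Z.
  by apply: eq_int01 => x /andP[x0 x1]; rewrite !cut01E ?(ltW x0) ?(ltW x1)// mulrA.
by apply: locboundedM; [exact: locbounded_cut01_Qspace Qz|exact: locbounded_cut01_Qspace Qq].
Qed.

Lemma Zcell_out k p j z x : Zcell k p j z -> ~~ (grid p j <= x <= grid p j.+1) -> z x = 0.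
Proof. by case=> z0 _ _; exact: z0. Qed.

Lemma Zcell_Qspace k p j z : Zcell k p j z -> Qspace k p.+1 z.
Proof.
move=> [z0 zP _] i ip.
(* Cell [i] of level p + 1 is a half of cell [i./2] of level p, and the parity of [i] tells which
   half. *)
have [ij|ij] := eqVneq i./2 j.
  have [P sP zE] := zP (odd i) (leq_b1 _).
  exists P => // x xi; apply: zE; move: xi.
  by rewrite -ij mul2n addnC odd_double_half.
exists 0; first by rewrite size_poly0.
move=> x /andP[h1 h2]; rewrite horner0; apply: z0.
rewrite -!(grid_double p); apply/negP => /andP[h3 h4].
have := lt_le_trans h1 h4; have := le_lt_trans h3 h2.
rewrite !ltr_grid; move/eqP: ij; rewrite !mul2n => ij a b; apply: ij.
by lia.
Qed.

Lemma cell_sub01 p j (x : R) : (j < 2 ^ p)%N -> grid p j <= x <= grid p j.+1 -> 0 <= x <= 1.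
Proof.
move=> jp /andP[h1 h2]; rewrite (le_trans (grid_ge0 p j))//=.
by rewrite (le_trans h2)// grid_le1.
Qed.

Lemma locbounded_Zcell k p j z : (j < 2 ^ p)%N -> Zcell k p j z -> locbounded z.
Proof.
move=> jp Zz; apply: Qspace_locbounded (Zcell_Qspace Zz) => x x01.
by apply: Zcell_out Zz _; apply: contra x01; exact: cell_sub01.
Qed.

Lemma Rintegral_eq_supp (A B : set R) f : (forall x, f x != 0 -> A x <-> B x) ->
  \int[leb]_(x in A) f x = \int[leb]_(x in B) f x.
Proof.
move=> AB; rewrite Rintegral_mkcond [RHS]Rintegral_mkcond; apply: eq_Rintegral => x _.
rewrite !patchE; have [->|fx] := eqVneq (f x) 0; first by rewrite !if_same.
by congr (if _ then _ else _); apply/idP/idP; rewrite !inE => /(AB x fx).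
Qed.

Lemma Zcell_integral k p j z (P : {poly R}) : Zcell k p j z -> (size P <= k.+1)%N ->
  \int[leb]_(x in `[grid p j, grid p j.+1]) (z x * P.[x]) = 0.
Proof. by case=> _ _; apply. Qed.

(** Orthogonality to constants makes the integral over the cell zero, so the primitive vanishes
    again to the right of it. Hence the functions [theta], defined cell by cell, are global
    primitives. *)
Lemma prim_Zcell k p j z x : (j < 2 ^ p)%N -> Zcell k p j z -> 0 <= x <= 1 ->
  prim z x = if grid p j <= x <= grid p j.+1
             then \int[leb]_(s in `[grid p j, x]) z s else 0.
Proof.
move=> jp Zz /andP[x0 x1]; have zx s : z s != 0 -> grid p j <= s <= grid p j.+1.
  by move=> zs; apply/negPn/negP => /(Zcell_out Zz)/eqP; rewrite (negbTE zs).
have [ax|xa] := leP (grid p j) x; last first.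
  rewrite /= /prim (@Rintegral_eq_supp _ set0) ?Rintegral_set0// => s /zx /andP[as_ _].
  split => //=; rewrite in_itv/= => /andP[_ sx].
  by have := lt_le_trans xa as_; rewrite ltNge sx.
have [xb|bx] := leP x (grid p j.+1).
  apply: Rintegral_eq_supp => s /zx /andP[as_ sb] /=; rewrite !in_itv/=.
  by rewrite as_ (le_trans (grid_ge0 p j)).
have := Zcell_integral Zz (P := 1) _; rewrite size_poly1 => /(_ isT).
under eq_Rintegral do rewrite hornerC mulr1.
move=> <-; apply: Rintegral_eq_supp => s /zx /andP[as_ sb] /=; rewrite !in_itv/=.
by rewrite as_ sb (le_trans (grid_ge0 p j))// (le_trans sb)// ltW.
Qed.

Lemma prim_ae f g x : locbounded f -> locbounded g -> 0 <= x <= 1 ->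
  {ae leb, forall t : measurableTypeR R, 0 < t < 1 -> f t = g t} -> prim f x = prim g x.
Proof.
move=> [mf _] [mg _] /andP[x0 x1] fg.
rewrite [LHS]/Rintegral [RHS]/Rintegral; congr fine; apply: ae_eq_integral => //.
- by apply/measurable_EFinP; exact: measurable_funTS.
- by apply/measurable_EFinP; exact: measurable_funTS.
(* The hypothesis speaks of the open interval and [prim] integrates over a closed one, so both
   endpoints are discarded as null sets. *)
have ne (c : R) : {ae leb, forall t : measurableTypeR R, t <> c}.
  exists [set c]; split => //; first exact: lebesgue_measure_set1.
  by move=> t /= /contrapT.
have FF : Filter (nbhs (almost_everywhere leb)) by exact: ae_filter_ringOfSetsType.
have := @filterI _ _ FF _ _ fg (@filterI _ _ FF _ _ (ne 0) (ne 1)).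
apply: filterS => t [fgt [/eqP t0 /eqP t1]]; rewrite /= in_itv/= => /andP[t0' tx].
by rewrite fgt// !lt_neqAle eq_sym t0 t0' t1 (le_trans tx).
Qed.

Lemma prim_oo f g x : locbounded f -> locbounded g -> 0 <= x <= 1 ->
  (forall t, 0 < t < 1 -> f t = g t) -> prim f x = prim g x.
Proof. by move=> bf bg x01 fg; apply: prim_ae => //; exact: aeW. Qed.

Lemma poly_antideriv (P : {poly R}) :
  exists2 Q : {poly R}, (size Q <= (size P).+1)%N & Q^`() = P.
Proof.
exists (\poly_(i < (size P).+1) (P`_i.-1 / i%:R)); first exact: size_poly.
apply/polyP => i; rewrite coef_deriv coef_poly ltnS; case: ltnP => h.
  by rewrite -(mulr_natr (_ / _)) divfK// pnatr_eq0.
by rewrite mul0rn nth_default.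
Qed.

Lemma ac_horner (Q : {poly R}) : ac (horner Q) (cut01 (horner Q^`())).
Proof.
have dQ (x : R) : 0 <= x <= 1 -> is_derive x 1 (horner Q) (Q^`()).[x].
  by move=> _; exact: is_derive_poly.
apply: (ac_C1 dQ); apply: continuous_subspaceT; exact: horner_continuous.
Qed.

Lemma Sspace0P k y : Sspace k.+1 0 y <-> exists2 P : {poly R}, (size P <= k.+2)%N &
  forall x, 0 <= x <= 1 -> y x = P.[x].
Proof.
have g1 : grid 0 1 = 1 :> R by rewrite -(grid_last 0).
split=> [[_ yP]|[P sP yP]].
  by have [//|P sP yE] := yP 0%N; exists P => // x; rewrite -(grid0 0) -g1; exact: yE.
split.
  apply: (@subspace_eq_continuous _ _ _ (horner P)).
    by move=> x; rewrite mem_setE in_itv/= => /yP.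
  by apply: continuous_subspaceT; exact: horner_continuous.
by case => // _; exists P => //; rewrite grid0 g1.
Qed.

Lemma prim_Z0 k z : Zspace k 0 z -> locbounded z -> Sspace k.+1 0 (prim z).
Proof.
move=> [Qz _] bz; apply/Sspace0P; have [//|P sP zP] := Qz 0%N.
rewrite grid0 (grid_last 0) in zP.
have [Q sQ QP] := poly_antideriv P; have acQ := ac_horner Q.
exists (Q - Q.[0]%:P).
  rewrite (leq_trans (size_polyD _ _))// geq_max (leq_trans sQ)//= size_polyN.
  by rewrite (leq_trans (size_polyC_leq1 _)).
move=> x x01; rewrite hornerD hornerN hornerC (acQ.2 x x01) addrAC subrr add0r.
apply: prim_oo => //; first exact: acQ.1.
by move=> t /andP[t0 t1]; rewrite cut01E ?QP ?zP ?t0// !ltW.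
Qed.

Lemma cst_Y0 k (c : R) : Sspace k.+1 0 (fun=> c).
Proof.
apply/Sspace0P; exists c%:P; last by move=> x _; rewrite hornerC.
exact: leq_trans (size_polyC_leq1 _) _.
Qed.

Lemma locbounded_if (a b : R) f : locbounded f ->
  locbounded (fun x => if a <= x < b then f x else 0).
Proof.
move=> bf; have -> : (fun x => if a <= x < b then f x else 0) =
    fun x => f x * \1_(`[a, b[%classic) x.
  apply/funext => x; rewrite indicE mem_setE in_itv/=.
  by case: ifP; rewrite ?mulr1 ?mulr0.
exact: locbounded_indic.
Qed.

Lemma cell_disjoint p i j (x : R) : grid p i < x < grid p i.+1 ->
  grid p j <= x < grid p j.+1 -> i = j.
Proof.
move=> /andP[h1 h2] /andP[h3 h4].
have := le_lt_trans h3 h2; have := lt_trans h1 h4.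
by rewrite !ltr_grid !ltnS => a b; apply/eqP; rewrite eqn_leq a b.
Qed.

(** A polynomial on one coarse cell, extended by zero, belongs to the coarser space, so
    orthogonality to that space localises to each cell. Half-open cells avoid overlaps at mesh
    points. *)
Lemma Zspace_cell k p j z : (j < 2 ^ p)%N -> locbounded z -> Zspace k p.+1 z ->
  Zcell k p j (fun x => if grid p j <= x < grid p j.+1 then z x else 0).
Proof.
move=> jp bz [Qz zq]; split.
- move=> x xj; rewrite ifN//; apply: contra xj => /andP[-> h]; exact: ltW.
- move=> i i2; have ip : (2 * j + i < 2 ^ p.+1)%N by rewrite expnS; lia.
  have [P sP zP] := Qz _ ip; exists P => // x /[dup] xi /andP[h1 h2].
  rewrite ifT ?zP// -!(grid_double p) (le_trans _ (ltW h1)) ?ler_grid ?leq_addr//=.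
  by rewrite (lt_le_trans h2)// ler_grid; lia.
- move=> P sP.
  pose q x := if grid p j <= x < grid p j.+1 then P.[x] else 0.
  have Qq : Qspace k p q.
    move=> i ip; have [->|ij] := eqVneq i j.
      by exists P => // x /andP[h1 h2]; rewrite /q (ltW h1) h2.
    exists 0; first by rewrite size_poly0.
    move=> x xi; rewrite horner0 /q ifN//; apply: contra ij => xj.
    by rewrite (cell_disjoint xi xj).
  transitivity (dot01 z q); last exact: zq.
  rewrite dot01E.
  have -> : (fun x => z x * q x) =
      (fun x => if grid p j <= x < grid p j.+1 then z x * P.[x] else 0).
    by apply/funext => x; rewrite /q; case: ifP; rewrite ?mulr0.
  rewrite int01_prim; last first.
    by apply: locbounded_if; apply: locboundedM => //; exact: locbounded_horner.
  rewrite /prim; transitivity (\int[leb]_(x in `[grid p j, grid p j.+1])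
      (if grid p j <= x < grid p j.+1 then z x * P.[x] else 0)).
    by apply: eq_Rintegral => x _; case: ifP; rewrite ?mul0r.
  apply: Rintegral_eq_supp => x; case: ifPn => [|_]; last by rewrite eqxx.
  move=> /andP[h1 h2] _; rewrite /= !in_itv/= h1 (ltW h2) (le_trans (grid_ge0 p j) h1).
  by rewrite (le_trans (ltW h2))// grid_le1.
Qed.

(** * Differentiation and integration between the spaces Y and Z *)

Section Wavelets.
Variables (k : nat) (psi : nat -> nat -> 'I_k.+1 -> R -> R).
Hypothesis hpsi : wavelet_basis psi.

Lemma psi_Zcell p j r : (j < 2 ^ p)%N -> Zcell k p j (psi p.+1 j r).
Proof. by move=> jp; have [Zpsi _ _] := hpsi jp. Qed.

Lemma locbounded_psi p j r : (j < 2 ^ p)%N -> locbounded (psi p.+1 j r).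
Proof. by move=> jp; apply: locbounded_Zcell (psi_Zcell r jp). Qed.

Lemma thetaE p j r x : (j < 2 ^ p)%N -> 0 <= x <= 1 ->
  theta psi p.+1 j r x = prim (psi p.+1 j r) x.
Proof. by move=> jp x01; rewrite (prim_Zcell jp (psi_Zcell r jp))// /theta/=. Qed.

(** Almost everywhere [z] is the sum of its restrictions to cells, each a combination of wavelets;
    integration replaces every wavelet by its [theta] at the same level. *)
Lemma prim_Zspace m z : Zspace k m z -> locbounded z -> Yspace psi m (prim z).
Proof.
case: m => [|p] Zz bz; first exact: prim_Z0.
pose zc j x := if grid p j <= x < grid p j.+1 then z x else 0.
have ex (j : 'I_(2 ^ p)) : exists c : 'I_k.+1 -> R, {ae leb, forall x : measurableTypeR R, 0 < x < 1 ->
    zc j x = \sum_r c r * psi p.+1 j r x}.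
  have [_ _ span] := hpsi (ltn_ord j); apply: span.
  exact: Zspace_cell.
have /choice[c cP] := ex.
(* [Yspace] indexes coefficients by all natural numbers, whereas they were chosen for the 2^p cells
   only; the default 0 is never reached in the sum. *)
exists (fun j r => if insub j is Some j' then c j' r else 0) => x x01.
have bS (j : 'I_(2 ^ p)) : locbounded (fun x => \sum_r c j r * psi p.+1 j r x).
  by apply: locbounded_sum => r; apply: locboundedZ; exact: locbounded_psi.
transitivity (prim (fun x => \sum_(j < 2 ^ p) \sum_r c j r * psi p.+1 j r x) x).
  apply: prim_ae => //; first exact: locbounded_sum.
  have : {ae leb, forall (x : measurableTypeR R) (j : 'I_(2 ^ p)), 0 < x < 1 ->
      zc j x = \sum_r c j r * psi p.+1 j r x}.
    apply: (@filter_forall _ _ (fun (j : 'I_(2 ^ p)) (x : measurableTypeR R) =>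
      0 < x < 1 -> zc j x = \sum_r c j r * psi p.+1 j r x)).
    exact: cP.
  apply: filterS => t h t01; have [t0 t1] := andP t01.
  have [|j jp tj] := @grid_cell p t; first by rewrite ltW.
  rewrite (bigD1 (Ordinal jp))//= -h// /zc/= tj big1 ?addr0// => i ij.
  rewrite -h// /zc ifN//; apply: contra ij => ti; apply/eqP/val_inj => /=.
  have [/andP[a1 a2] /andP[a3 a4]] := (tj, ti).
  have := le_lt_trans a1 a4; have := le_lt_trans a3 a2.
  by rewrite !ltr_grid !ltnS => b1 b2; apply/eqP; rewrite eqn_leq b1 b2.
rewrite prim_sum//; apply: eq_bigr => j _.
rewrite prim_sum; last by move=> r; apply: locboundedZ; exact: locbounded_psi.
apply: eq_bigr => r _; rewrite primZ; last exact: locbounded_psi.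
by rewrite thetaE// insubT//= => jp; congr (c _ _ * _); exact: val_inj.
Qed.

Lemma dot01_psi p j r q : (j < 2 ^ p)%N -> Qspace k p q ->
  int01 (fun x => psi p.+1 j r x * cut01 q x) = 0.
Proof.
move=> jp Qq; have [P sP qP] := Qq j jp; have Zpsi := psi_Zcell r jp.
have bp := locbounded_psi r jp.
rewrite int01_prim; last exact/locboundedM/locbounded_cut01_Qspace/Qq.
rewrite -(Zcell_integral Zpsi sP) /prim.
transitivity (\int[leb]_(x in `[grid p j, grid p j.+1]) (psi p.+1 j r x * cut01 q x)).
  apply: Rintegral_eq_supp => x; have [xj|/(Zcell_out Zpsi) ->] :=
    boolP (grid p j <= x <= grid p j.+1); last by rewrite mul0r eqxx.
  by move=> _; rewrite /= !in_itv/= xj (cell_sub01 jp xj).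
have lt1 : grid p j < grid p j.+1 :> R by rewrite ltr_grid.
(* [q] agrees with the polynomial [P] only in the interior of the cell; passing to the open cell
   drops the mesh points. *)
have oo h : locbounded h -> \int[leb]_(x in `[grid p j, grid p j.+1]) h x =
    \int[leb]_(x in `]grid p j, grid p j.+1[) h x.
  move=> [mh _]; rewrite [LHS]/Rintegral [RHS]/Rintegral integral_itv_bndoo//.
  by apply/measurable_EFinP; exact: measurable_funTS.
rewrite oo; last exact/locboundedM/locbounded_cut01_Qspace/Qq.
rewrite oo; last exact/locboundedM/locbounded_horner.
apply: eq_Rintegral => x; rewrite mem_setE in_itv/= => xj.
by rewrite cut01E ?qP//; have /andP[h1 h2] := cell01 jp xj; rewrite !ltW.
Qed.

(** The derivative of a [theta] is a wavelet of the same level, and at level 0 the degree drops by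
    one. Hence [d] preserves the multi-index, which keeps exterior derivatives in the sparse
    spaces. *)
Lemma Yspace_deriv m y : Yspace psi m y ->
  exists g, [/\ locbounded g, Zspace k m g & ac y g].
Proof.
case: m => [|p] /=.
  move=> /Sspace0P[P sP yP]; have acP := ac_horner P.
  exists (cut01 (horner P^`())); split; first exact: acP.1.
    split => //; apply: Qspace_cut01 => j _; exists P^`() => //.
    have [->|P0] := eqVneq P 0; first by rewrite deriv0 size_poly0.
    by rewrite -ltnS (leq_trans (lt_size_deriv P0)).
  by apply: ac_eq acP => // x x01; rewrite yP.
move=> [c yE].
pose g x := \sum_(j < 2 ^ p) \sum_(r < k.+1) c j r * psi p.+1 j r x.
have bp (j : 'I_(2 ^ p)) r : locbounded (psi p.+1 j r) by exact: locbounded_psi.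
have bS (j : 'I_(2 ^ p)) : locbounded (fun x => \sum_r c j r * psi p.+1 j r x).
  by apply: locbounded_sum => r; exact: locboundedZ.
have bg : locbounded g by exact: locbounded_sum.
have primg x : 0 <= x <= 1 -> y x = prim g x.
  move=> x01; rewrite yE// prim_sum//; apply: eq_bigr => j _.
  rewrite prim_sum; last by move=> r; exact: locboundedZ.
  by apply: eq_bigr => r _; rewrite primZ// thetaE.
exists g; split => //; last first.
  by split=> // x x01; rewrite !primg ?lexx ?ler01// prim0 add0r.
split.
  apply: Qspace_sum => j; apply: Qspace_sum => r; apply: QspaceZ.
  exact: Zcell_Qspace (psi_Zcell r (ltn_ord j)).
move=> q Qq; have bq := locbounded_cut01_Qspace Qq.
transitivity (int01 (fun x => \sum_(j < 2 ^ p) \sum_(r < k.+1)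
    c j r * (psi p.+1 j r x * cut01 q x))).
  rewrite dot01E; apply: eq_int01 => x /andP[x0 x1].
  rewrite mulr_suml; apply: eq_bigr => j _; rewrite mulr_suml; apply: eq_bigr => r _.
  by rewrite cut01E ?mulrA// !ltW.
rewrite int01_sum; last first.
  by move=> j; apply: locbounded_sum => r; apply/locboundedZ/locboundedM.
rewrite big1// => j _; rewrite int01_sum; last by move=> r; apply/locboundedZ/locboundedM.
rewrite big1// => r _; rewrite int01Z; last exact: locboundedM.
by rewrite dot01_psi ?mulr0.
Qed.

Lemma Yspace_eq m y y' : (forall x : R, 0 <= x <= 1 -> y x = y' x) ->
  Yspace psi m y -> Yspace psi m y'.
Proof.
move=> yy'; case: m => [|p] /=.
  by move=> /Sspace0P[P sP yP]; apply/Sspace0P; exists P => // x x01; rewrite -yy'// yP.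
by move=> [c yE]; exists c => x x01; rewrite -yy'// yE.
Qed.

Lemma YspaceZ m c y : Yspace psi m y -> Yspace psi m (fun x => c * y x).
Proof.
case: m => [|p] /=.
  move=> /Sspace0P[P sP yP]; apply/Sspace0P; exists (c *: P).
    by rewrite (leq_trans (size_scale_leq _ _)).
  by move=> x x01; rewrite yP// hornerZ.
move=> [e yE]; exists (fun j r => c * e j r) => x x01; rewrite yE// mulr_sumr.
by apply: eq_bigr => j _; rewrite mulr_sumr; apply: eq_bigr => r _; rewrite mulrA.
Qed.

Lemma locbounded_cut01_Yspace m y : Yspace psi m y -> locbounded (cut01 y).
Proof.
move=> /Yspace_deriv[g [bg _ [_ yE]]].
have -> : cut01 y = fun x => (y 0 + prim g x) * \1_(`[0, 1]%classic) x.
  apply/funext => x; rewrite /cut01 indicE mem_setE in_itv/=.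
  by case: ifPn => x01; rewrite ?mulr0 ?mulr1// yE.
apply: locbounded_indic => //; apply: locboundedD; first exact: locbounded_cst.
exact: locbounded_prim.
Qed.

End Wavelets.

End Spaces.

(** * Equality almost everywhere, iterated averages and L2 norms of representatives *)

Section AlmostEverywhere.
Context {R : realType} {d : nat}.
Implicit Types (x : d.-tuple R) (i j : 'I_d) (u v w : d.-tuple R -> R).
Local Notation mu := (cube_measure R d).

Definition aeq u v := {ae mu, forall x, u x = v x}.

Lemma aeqE u v : (u = v %[ae mu]) <-> aeq u v.
Proof. by split; apply: filterS => x h; [exact: h|move=> _; exact: h]. Qed.

Lemma aeq_refl u : aeq u u.
Proof. exact: aeW. Qed.

Lemma aeq_sym u v : aeq u v -> aeq v u.
Proof. by apply: filterS => x ->. Qed.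

Lemma aeq_trans u v w : aeq u v -> aeq v w -> aeq u w.
Proof. by apply: filterS2 => x -> ->. Qed.

Lemma aeq_cube u v : (forall x, cube x -> u x = v x) -> aeq u v.
Proof. by move=> uv; apply: filterS (ae_cube d) => x; exact: uv. Qed.

Lemma aeq_cubec u v : (forall x, cubec x -> u x = v x) -> aeq u v.
Proof. by move=> uv; apply: aeq_cube => x /cube_cubec; exact: uv. Qed.

Lemma aeq_sum (I : Type) (r : seq I) (P : pred I) (F G : I -> d.-tuple R -> R) :
  (forall a, P a -> aeq (F a) (G a)) ->
  aeq (fun x => \sum_(a <- r | P a) F a x) (fun x => \sum_(a <- r | P a) G a x).
Proof.
move=> FG; elim: r => [|a r IH]; first by apply: aeW => x; rewrite !big_nil.
move: IH; have [Pa|nPa] := boolP (P a).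
  have := FG a Pa; apply: filterS2 => x e1 e2.
  by rewrite !big_cons Pa e1 e2.
by apply: filterS => x e; rewrite !big_cons (negbTE nPa) e.
Qed.

Lemma aeq_mul u v u' v' : aeq u u' -> aeq v v' -> aeq (fun x => u x * v x) (fun x => u' x * v' x).
Proof. by apply: filterS2 => x -> ->. Qed.

Lemma aeq_Rintegral u v : measurable_fun setT u -> measurable_fun setT v -> aeq u v ->
  \int[mu]_x u x = \int[mu]_x v x.
Proof.
move=> mu_ mv uv; rewrite /Rintegral; congr fine; apply: ae_eq_integral => //.
- exact/measurable_EFinP.
- exact/measurable_EFinP.
- by apply: filterS uv => x -> _.
Qed.

Lemma Rintegral_unif_ae (f g : R -> R) : measurable_fun setT f -> measurable_fun setT g ->
  {ae unif R, forall t : measurableTypeR R, f t = g t} -> \int[unif R]_t f t = \int[unif R]_t g t.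
Proof.
move=> mf mg fg; rewrite /Rintegral; congr fine; apply: ae_eq_integral => //.
- exact/measurable_EFinP.
- exact/measurable_EFinP.
- by apply: filterS fg => x -> _.
Qed.

Lemma prim_unif_ae (f g : R -> R) (x : R) : measurable_fun setT f -> measurable_fun setT g ->
  {ae unif R, forall t : measurableTypeR R, f t = g t} -> 0 <= x <= 1 -> prim f x = prim g x.
Proof.
move=> mf mg fg x01; rewrite !prim_indic//; apply: Rintegral_unif_ae.
- by apply: measurable_funM => //; exact: measurable_indic.
- by apply: measurable_funM => //; exact: measurable_indic.
- by apply: filterS fg => t ->.
Qed.

Lemma aeq_average_at i u v : measurable_fun setT u -> measurable_fun setT v ->
  aeq u v -> aeq (average_at i u) (average_at i v).
Proof.
move=> mu_ mv /(ae_upd i); apply: filterS => x uv; rewrite !average_at_unif//.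
by apply: Rintegral_unif_ae => //; exact: measurable_line.
Qed.

Lemma aeq_primitive_at i u v : measurable_fun setT u -> measurable_fun setT v ->
  aeq u v -> aeq (primitive_at i u) (primitive_at i v).
Proof.
move=> mu_ mv /(ae_upd i) uv; apply: filterS2 uv (ae_cube d) => x uv cx.
have ml := measurable_line x i mu_; have mr := measurable_line x i mv.
have e1 : prim (line x i u) (tnth x i) = prim (line x i v) (tnth x i).
  exact: prim_unif_ae ml mr uv (cube_cubec cx i).
have e2 : int01 (prim (line x i u)) = int01 (prim (line x i v)).
  apply: eq_int01 => t /andP[t0 t1]; apply: (prim_unif_ae ml mr uv).
  by rewrite !ltW.
by rewrite !primitive_atE e1 e2.
Qed.

Definition Pavg (s : seq 'I_d) u := foldr average_at u s.

Lemma measurable_Pavg s u : measurable_fun setT u -> measurable_fun setT (Pavg s u).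
Proof. by move=> mu_; elim: s => //= i s; exact: measurable_average_at. Qed.

Lemma aeq_Pavg s u v : measurable_fun setT u -> measurable_fun setT v ->
  aeq u v -> aeq (Pavg s u) (Pavg s v).
Proof.
move=> mu_ mv uv; elim: s => //= i s.
by apply: aeq_average_at; exact: measurable_Pavg.
Qed.

Lemma Pavg_tens s u : tens u -> tens (Pavg s u).
Proof. by move=> tu; elim: s => //= i s; exact: average_at_tens. Qed.

Lemma Pavg0 s : Pavg s (fun=> 0 : R) = fun=> 0.
Proof. by elim: s => //= i s ->; exact: average_at0. Qed.

Lemma PavgD s u v : tens u -> tens v ->
  Pavg s (fun x => u x + v x) = fun x => Pavg s u x + Pavg s v x.
Proof. by move=> tu tv; elim: s => //= i s ->; rewrite average_atD//; exact: Pavg_tens. Qed.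

Lemma PavgZ s c u : tens u -> Pavg s (fun x => c * u x) = fun x => c * Pavg s u x.
Proof. by move=> tu; elim: s => //= i s ->; rewrite average_atZ//; exact: Pavg_tens. Qed.

Lemma PavgB (i : 'I_d) s u v : tens u -> tens v ->
  Pavg s (fun x => u x - v x) = fun x => Pavg s u x - Pavg s v x.
Proof.
move=> tu tv; under [X in Pavg s X]eq_fun do rewrite -mulN1r.
rewrite PavgD//; last exact: (tensZ i).
by rewrite PavgZ//; apply/funext => x; rewrite mulN1r.
Qed.

Lemma Pavg_sum (I : Type) (r : seq I) (P : pred I) s (F : I -> d.-tuple R -> R) :
  (forall a, P a -> tens (F a)) ->
  Pavg s (fun x => \sum_(a <- r | P a) F a x) = fun x => \sum_(a <- r | P a) Pavg s (F a) x.
Proof.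
move=> tF; elim: r => [|a r IH].
  have -> : (fun x => \sum_(a <- [::] | P a) F a x) = fun=> 0.
    by apply/funext => x; rewrite big_nil.
  by rewrite Pavg0; apply/funext => x; rewrite big_nil.
have [Pa|nPa] := boolP (P a); last first.
  have -> : (fun x => \sum_(b <- a :: r | P b) F b x) = fun x => \sum_(b <- r | P b) F b x.
    by apply/funext => x; rewrite big_cons (negbTE nPa).
  by rewrite IH; apply/funext => x; rewrite big_cons (negbTE nPa).
have -> : (fun x => \sum_(b <- a :: r | P b) F b x) =
    fun x => F a x + \sum_(b <- r | P b) F b x.
  by apply/funext => x; rewrite big_cons Pa.
rewrite PavgD; [|exact: tF|exact: tens_sum].
by apply/funext => x; rewrite big_cons Pa IH.
Qed.

Lemma primitive_at_sum (I : Type) (r : seq I) (P : pred I) i (F : I -> d.-tuple R -> R) :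
  (forall a, P a -> tens (F a)) ->
  primitive_at i (fun x => \sum_(a <- r | P a) F a x) =
  fun x => \sum_(a <- r | P a) primitive_at i (F a) x.
Proof.
move=> tF; elim: r => [|a r IH].
  have -> : (fun x => \sum_(a <- [::] | P a) F a x) = fun=> 0.
    by apply/funext => x; rewrite big_nil.
  by rewrite primitive_at0; apply/funext => x; rewrite big_nil.
have [Pa|nPa] := boolP (P a); last first.
  have -> : (fun x => \sum_(b <- a :: r | P b) F b x) = fun x => \sum_(b <- r | P b) F b x.
    by apply/funext => x; rewrite big_cons (negbTE nPa).
  by rewrite IH; apply/funext => x; rewrite big_cons (negbTE nPa).
have -> : (fun x => \sum_(b <- a :: r | P b) F b x) =
    fun x => F a x + \sum_(b <- r | P b) F b x.
  by apply/funext => x; rewrite big_cons Pa.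
rewrite primitive_atD; [|exact: tF|exact: tens_sum].
by apply/funext => x; rewrite big_cons Pa IH.
Qed.

Lemma Pavg_indep s u j : j \in s -> indep j (Pavg s u).
Proof.
elim: s => //= i s IH; rewrite inE => /orP[/eqP ->|js].
  exact: average_at_indep.
by apply: average_at_indepW; exact: IH.
Qed.

Lemma Pavg_average_at i s u : i \notin s -> tens u ->
  average_at i (Pavg s u) = Pavg s (average_at i u).
Proof.
elim: s => //= j s IH; rewrite inE negb_or => /andP[ij is_] tu.
by rewrite average_atC ?IH//; exact: Pavg_tens.
Qed.

Lemma Pavg_contraction s u : tens u ->
  \int[mu]_x (Pavg s u x ^+ 2) <= \int[mu]_x (u x ^+ 2).
Proof.
move=> tu; elim: s => //= i s; apply: le_trans.
by apply: average_at_contraction; exact: Pavg_tens.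
Qed.

Lemma Pavg_cubec s u v : (forall x, cubec x -> u x = v x) ->
  forall x, cubec x -> Pavg s u x = Pavg s v x.
Proof.
move=> uv; elim: s => //= i s IH x cx; rewrite !average_atE; apply: eq_int01.
by move=> t /andP[t0 t1]; apply: IH; apply: cubec_upd => //; rewrite !ltW.
Qed.

Lemma dtens_Pavg s j u g : j \notin s -> dtens j u g -> dtens j (Pavg s u) (Pavg s g).
Proof.
move=> + ug; elim: s => //= i s IH; rewrite inE negb_or eq_sym => /andP[ij js].
by apply: dtens_average => //; exact: IH.
Qed.

Lemma dtens_Pavg_in s j u : j \in s -> tens u -> dtens j (Pavg s u) (fun=> 0).
Proof.
move=> + tu; elim: s => //= i s IH; rewrite inE.
have [-> _|ij /= js] := eqVneq j i; first by apply: dtens_average_same; exact: Pavg_tens.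
by rewrite -(average_at0 i); apply: dtens_average; [rewrite eq_sym|exact: IH].
Qed.

Lemma Lnorm2_tens u v : measurable_fun setT u -> tens v -> aeq u v ->
  u \in Lfun mu 2%:E /\ fine ('N[mu]_2%:E [EFin \o u])%E ^+ 2 = \int[mu]_x (v x ^+ 2).
Proof.
move=> mu_ tv uv.
have iv := tens_integrable (tensM tv tv).
have E : ('N[mu]_2%:E [EFin \o u] `^ 2 = \int[mu]_x (v x ^+ 2)%:E)%E.
  rewrite poweR_Lnorm//; apply: ae_eq_integral => //.
  - apply: (measurableT_comp (measurable_poweR _)) => //.
    by apply: measurableT_comp => //; exact/measurable_EFinP.
  - by case/integrableP: iv.
  - by apply: filterS uv => x /= -> _; rewrite powR_mulrn// -normrX ger0_norm ?sqr_ge0.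
have fin : (\int[mu]_x (v x ^+ 2)%:E)%E \is a fin_num by exact: integrable_fin_num.
have N0 := @Lnorm_ge0 _ _ R mu 2%:E (EFin \o u).
have Nfin : ('N[mu]_2%:E [EFin \o u])%E \is a fin_num.
  rewrite ge0_fin_numE//; apply: (@lty_poweRy _ _ 2) => //.
  by rewrite E ltey_eq fin.
split.
  apply/andP; split; rewrite inE//=.
  by rewrite /finite_norm ltey_eq Nfin.
rewrite /Rintegral -E -[in RHS](fineK Nfin) poweR_EFin /= powR_mulrn//.
exact: fine_ge0.
Qed.

Lemma Lfun2_measurable u : u \in Lfun mu 2%:E -> measurable_fun setT u.
Proof. by move=> /andP[]; rewrite inE. Qed.

Lemma Lfun2_integrable u : u \in Lfun mu 2%:E -> mu.-integrable setT (EFin \o u).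
Proof.
move=> u2; apply/Lfun1_integrable; apply: Lfun_subset12 u2.
have h : (cube_measure R d setT \is a fin_num)%E by rewrite cube_measure_setT.
exact: h.
Qed.

End AlmostEverywhere.

(** * The sparse spaces *)

Section SparseTensors.
Context {R : realType} {d k n : nat}.
Variable psi : nat -> nat -> 'I_k.+1 -> R -> R.
Hypotheses (hd : (0 < d)%N) (hpsi : wavelet_basis psi).
Implicit Types (x : d.-tuple R) (i j : 'I_d) (I J : {set 'I_d}) (u v : d.-tuple R -> R).
Implicit Types (f : 'I_d -> R -> R).
Local Notation mu := (cube_measure R d).

Definition adm I (m : 'I_d -> nat) f :=
  forall i, if i \in I then Zspace k (m i) (f i) else Yspace psi (m i) (f i).

Definition admf I f := lbfactors f /\
  exists2 m : 'I_d -> nat, (\sum_i m i <= n + d - 1)%N & adm I m f.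

(** The pointwise counterpart of [sparse_coef]: each product carries its own multi-index, which
    replaces the sum over M_n by a list. *)
Definition sparse I u := exists2 s, List.Forall (admf I) s & u = ten s.

(** A product stored with the derivatives of its Y-factors, already known to lie in Z at the same
    level; for [i] in [I] the second component is only required to be locally bounded. *)
Definition spterm I (t : term) := lbterm t /\
  exists2 m : 'I_d -> nat, (\sum_i m i <= n + d - 1)%N &
    forall i, if i \in I then Zspace k (m i) (t.1 i) else
      [/\ Yspace psi (m i) (t.1 i), Zspace k (m i) (t.2 i) & ac (t.1 i) (t.2 i)].

Lemma sparse0 I : sparse I (fun=> 0).
Proof. by exists [::] => //; apply/funext => x; rewrite /ten big_nil. Qed.

Lemma sparseD I u v : sparse I u -> sparse I v -> sparse I (fun x => u x + v x).
Proof.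
move=> [s as_ ->] [t at_ ->]; exists (s ++ t); first by apply/List.Forall_app.
by apply/funext => x; rewrite ten_cat.
Qed.

Lemma sparse_rank1 I f : admf I f -> sparse I (rank1 f).
Proof.
move=> af; exists [:: f]; first by constructor.
by apply/funext => x; rewrite /ten big_seq1.
Qed.

Lemma sparse_rec I (P : (d.-tuple R -> R) -> Prop) :
  P (fun=> 0) ->
  (forall u v, sparse I u -> sparse I v -> P u -> P v -> P (fun x => u x + v x)) ->
  (forall f, admf I f -> P (rank1 f)) -> forall u, sparse I u -> P u.
Proof.
move=> P0 PD P1 u [s as_ ->]; elim: as_ => [|f {}s af as_ IH].
  by rewrite (_ : ten _ = fun=> 0)//; apply/funext => x; rewrite /ten big_nil.
rewrite (_ : ten _ = fun x => rank1 f x + ten s x); last first.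
  by apply/funext => x; rewrite /ten big_cons.
by apply: PD => //; [exact: sparse_rank1|exists s|exact: P1].
Qed.

Lemma sparse_tens I u : sparse I u -> tens u.
Proof. by move=> [s as_ ->]; exists s => //; apply: List.Forall_impl as_ => f []. Qed.

Lemma sparse_sum I (A : Type) (r : seq A) (P : pred A) (F : A -> d.-tuple R -> R) :
  (forall a, P a -> sparse I (F a)) -> sparse I (fun x => \sum_(a <- r | P a) F a x).
Proof.
move=> sF; elim: r => [|a r IH].
  by under eq_fun do rewrite big_nil; exact: sparse0.
under eq_fun do rewrite big_cons.
by case: (boolP (P a)) => // Pa; apply: sparseD => //; exact: sF.
Qed.

(** M_n is closed under lowering an entry, so one factor may be replaced by another of at most its
    level. Allowing [I] and [J] to differ at [i] covers averages, primitives and derivatives at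
    once. *)
Lemma admf_set I J m f i (l : nat) (h : R -> R) : lbfactors f -> (\sum_i m i <= n + d - 1)%N ->
  adm I m f -> locbounded h -> (l <= m i)%N ->
  (forall j, j != i -> (j \in J) = (j \in I)) ->
  (if i \in J then Zspace k l h else Yspace psi l h) -> admf J (setfactor f i h).
Proof.
move=> bf sm am bh lm JI hl; split; first exact: lbfactors_set.
exists (fun j => if j == i then l else m j).
  apply: leq_trans sm; apply: leq_sum => j _.
  by case: eqP => // ->.
move=> j; rewrite /setfactor; have [->//|ji] := eqVneq j i.
by rewrite JI//; exact: am.
Qed.

Lemma sparseZ i I c u : sparse I u -> sparse I (fun x => c * u x).
Proof.
move: u; apply: sparse_rec => [|u v _ _ tu tv|f [bf [m sm am]]].
- by under eq_fun do rewrite mulr0; exact: sparse0.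
- by under eq_fun do rewrite mulrDr; exact: sparseD.
rewrite (rank1Z i); apply: sparse_rank1.
apply: (@admf_set I I m f i (m i)) => //; first exact: locboundedZ.
by have := am i; case: ifP => _; [exact: ZspaceZ|exact: YspaceZ].
Qed.

Lemma sparse_average I j u : j \notin I -> sparse I u -> sparse I (average_at j u).
Proof.
move=> jI; move: u; apply: sparse_rec => [|u v tu tv su sv|f [bf [m sm am]]].
- by rewrite average_at0; exact: sparse0.
- by rewrite average_atD; [exact: sparseD|exact: sparse_tens tu|exact: sparse_tens tv].
rewrite average_at_rank1//; apply: sparse_rank1.
apply: (@admf_set I I m f j 0%N) => //; first exact: locbounded_cst.
by rewrite (negbTE jI); exact: cst_Y0.
Qed.

Lemma sparse_Pavg I s u : all (fun j => j \notin I) s -> sparse I u -> sparse I (Pavg s u).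
Proof.
move=> + su; elim: s => //= j s IH /andP[jI sI].
by apply: sparse_average => //; exact: IH.
Qed.

Lemma sparse_primitive I i u : i \in I -> sparse I u -> sparse (I :\ i)%SET (primitive_at i u).
Proof.
move=> iI; move: u; apply: sparse_rec => [|u v tu tv su sv|f [bf [m sm am]]].
- by rewrite primitive_at0; exact: sparse0.
- by rewrite primitive_atD; [exact: sparseD|exact: sparse_tens tu|exact: sparse_tens tv].
rewrite primitive_at_rank1//.
(* The primitive from 0 has level [m i], but the constant correcting its mean lies in Y_0, so the
   two go to different multi-indices. *)
have -> : rank1 (setfactor f i (primitive0 (f i))) = fun x =>
    rank1 (setfactor f i (prim (f i))) x +
    rank1 (setfactor f i (fun=> - int01 (prim (f i)))) x.
  by apply/funext => x; rewrite !rank1_setfactor primitive0E mulrBr mulrN.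
have JI j : j != i -> (j \in (I :\ i)%SET) = (j \in I) by move=> ji; rewrite !inE ji.
have iJ : (i \in (I :\ i)%SET) = false by rewrite !inE eqxx.
apply: sparseD; apply: sparse_rank1.
- apply: (@admf_set I _ m f i (m i)) => //; first exact: locbounded_prim.
  rewrite iJ; apply: prim_Zspace => //.
  by have := am i; rewrite iI.
- apply: (@admf_set I _ m f i 0%N) => //; first exact: locbounded_cst.
  by rewrite iJ; exact: cst_Y0.
Qed.

Lemma spterm_ex I f : admf I f -> exists2 t, spterm I t & t.1 = f.
Proof.
move=> [bf [m sm am]].
have /choice[h hP] : forall i, exists h, locbounded h /\
    (if i \in I then True else Zspace k (m i) h /\ ac (f i) h).
  move=> i; have := am i; case: ifP => _ fi.
    by exists (fun=> 0); split => //; exact: locbounded_cst.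
  by have [h [bh zh ah]] := Yspace_deriv hpsi fi; exists h.
exists (f, h) => //; split; first by split => // i; case: (hP i).
exists m => // i; have := am i; have [_] := hP i; case: ifP => //= _ [zh ah] yf.
by split.
Qed.

Lemma sparse_terms I u : sparse I u ->
  exists2 s, List.Forall (spterm I) s & u = tenX finset.set0 s.
Proof.
move=> [s as_ ->].
suff [t st ts] : exists2 t, List.Forall (spterm I) t & [seq p.1 | p <- t] = s.
  exists t => //; rewrite /tenX; congr ten; rewrite -ts; apply: eq_map => p.
  by rewrite sel0.
elim: as_ => [|f {}s af _ [t st ts]]; first by exists [::].
by have [p sp pf] := spterm_ex af; exists (p :: t); [constructor|rewrite /= pf ts].
Qed.

Lemma spterm_lb I s : List.Forall (spterm I) s -> List.Forall lbterm s.
Proof. by apply: List.Forall_impl => t []. Qed.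

Lemma sparse_tenX0 I s : List.Forall (spterm I) s -> sparse I (tenX finset.set0 s).
Proof.
move=> ss; exists [seq sel finset.set0 t | t <- s] => //.
elim: ss => [|t {}s [[b1 b2] [m sm am]] _ IH] /=; constructor => //; rewrite sel0.
split => //; exists m => // i.
by have := am i; case: ifP => // _ [].
Qed.

Lemma sparse_tenX1 I j s : j \notin I -> List.Forall (spterm I) s ->
  sparse (j |: I)%SET (tenX [set j]%SET s).
Proof.
move=> jI ss; exists [seq sel [set j]%SET t | t <- s] => //.
elim: ss => [|t {}s [[b1 b2] [m sm am]] _ IH] /=; constructor => //; rewrite sel1.
have am1 : adm I m t.1 by move=> i; have := am i; case: ifP => // _ [].
apply: (@admf_set I _ m t.1 j (m j)) => //.
- by move=> i ij; rewrite !inE (negbTE ij).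
- by rewrite !inE eqxx/=; have := am j; rewrite (negbTE jI) => -[].
Qed.

Lemma dtens_tenX I j s : j \notin I -> List.Forall (spterm I) s ->
  dtens j (tenX finset.set0 s) (tenX [set j]%SET s).
Proof.
move=> jI ss; exists s; split => //; apply: List.Forall_impl ss => t [bt [m sm am]].
by split => //; have := am j; rewrite (negbTE jI) => -[].
Qed.

(** The second derivative selects both differentiated factors and is therefore symmetric in [i] and
    [j], the source of [d d = 0]. *)
Lemma dtens_tenX2 I i j s : i \notin I -> j \notin I -> i != j -> List.Forall (spterm I) s ->
  dtens i (tenX [set j]%SET s) (tenX [set i; j]%SET s).
Proof.
move=> iI jI ij ss; exists [seq (sel [set j]%SET t, t.2) | t <- s]; split.
- elim: ss => [|t {}s [[b1 b2] [m sm am]] _ IH] /=; constructor => //; split.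
    by split => //= l; rewrite /sel; case: ifP.
  by rewrite /= /sel inE (negbTE ij); have := am i; rewrite (negbTE iI) => -[].
- by rewrite /tenX -map_comp; congr ten; apply: eq_map => t; rewrite /= sel0.
- rewrite /tenX -map_comp; congr ten; apply: eq_map => t; apply/funext => l /=.
  by rewrite /sel /= !inE; case: (l == i).
Qed.

Lemma sparse_cst (c : R) : sparse finset.set0 (fun=> c).
Proof.
have -> : (fun=> c) = fun x : d.-tuple R => c * rank1 (fun _ _ => 1) x.
  by apply/funext => x; rewrite /rank1 big1 ?mulr1.
apply: (sparseZ (Ordinal hd)); apply: sparse_rank1.
split; first by move=> i; exact: locbounded_cst.
exists (fun=> 0%N); first by rewrite big1.
by move=> i; rewrite inE; exact: cst_Y0.
Qed.

(** Truncating the factors to the unit interval makes them locally bounded, stays within the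
    one-dimensional spaces and changes nothing on the closed cube. *)
Lemma Wspace_sparse m I u : (\sum_i m i <= n + d - 1)%N -> Wspace psi m I u ->
  exists2 v, sparse I v & forall x, cubec x -> u x = v x.
Proof.
move=> sm [N [f [fa uE]]].
exists (fun x => \sum_(a < N) rank1 (fun i => cut01 (f a i)) x).
  apply: sparse_sum => a _; apply: sparse_rank1; split.
    move=> i; have := fa a i; case: ifP => _; last exact: (locbounded_cut01_Yspace hpsi).
    by move=> [Q _]; exact: locbounded_cut01_Qspace Q.
  exists m => // i; have := fa a i; case: ifP => _ fi; first exact: Zspace_cut01.
  by apply: Yspace_eq fi => t t01; rewrite cut01E.
move=> x cx; rewrite uE; apply: eq_bigr => a _; apply: eq_bigr => i _.
by rewrite cut01E//; exact: cx.
Qed.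

Lemma sparse_coefP I u : sparse_coef n psi I u -> exists2 v, sparse I v & aeq u v.
Proof.
move=> [w [wW /aeqE uw]].
have /choice[v vP] : forall m : {ffun 'I_d -> 'I_(n + d)}, exists v, Mset m ->
    sparse I v /\ forall x, cubec x -> w m x = v x.
  move=> m; have [Mm|] := boolP (Mset m); last by exists (fun=> 0).
  by have [v sv wv] := Wspace_sparse Mm (wW m Mm); exists v.
exists (fun x => \sum_(m | Mset m) v m x).
  by apply: sparse_sum => m /vP[].
apply: aeq_trans uw _; apply: aeq_cubec => x cx; apply: eq_bigr => m /vP[_ ->//].
Qed.

Lemma Wspace0 m I : Wspace psi m I (fun=> 0).
Proof.
exists 0%N, (fun _ _ _ => 0); split => [[]//|x].
by rewrite big_ord0.
Qed.

Lemma WspaceD m I u v : Wspace psi m I u -> Wspace psi m I v ->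
  Wspace psi m I (fun x => u x + v x).
Proof.
move=> [N [f [fa uE]]] [M [h [ha vE]]].
exists (N + M)%N, (fun a => match fintype.split a with inl b => f b | inr b => h b end); split.
  by move=> a i; case: (fintype.split a) => b; [exact: fa|exact: ha].
move=> x; rewrite uE vE big_split_ord/=; congr (_ + _); apply: eq_bigr => a _.
  by rewrite -[lshift M a]/(unsplit (inl a)) unsplitK.
by rewrite -[rshift N a]/(unsplit (inr a)) unsplitK.
Qed.

Lemma sparse_coef_aeq I u v : sparse I v -> aeq u v -> sparse_coef n psi I u.
Proof.
move=> sv uv.
suff [w wW wE] : exists2 w : {ffun 'I_d -> 'I_(n + d)} -> d.-tuple R -> R,
    (forall m, Mset m -> Wspace psi (fun i => m i) I (w m)) &
    v = fun x => \sum_(m | Mset m) w m x.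
  by exists w; split => //; apply/aeqE; rewrite -wE.
move: v sv {uv}; apply: sparse_rec => [|v v' _ _ [w wW ->] [w' wW' ->]|f [bf [m sm am]]].
- exists (fun _ _ => 0) => [m _|]; first exact: Wspace0.
  by apply/funext => x; rewrite big1.
- exists (fun m x => w m x + w' m x) => [m Mm|]; last by apply/funext => x; rewrite big_split.
  by apply: WspaceD; [exact: wW|exact: wW'].
(* Entries of a multi-index in M_n are at most n + d - 1, and d > 0 makes this less than n + d, so
   the multi-index fits the finite type. *)
have lt i : (m i < n + d)%N.
  by move: sm; rewrite (bigD1 i)//=; lia.
pose m0 : {ffun 'I_d -> 'I_(n + d)} := [ffun i => Ordinal (lt i)].
have m0E i : m0 i = m i :> nat by rewrite ffunE.
exists (fun m' x => if m' == m0 then rank1 f x else 0) => [m' Mm'|].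
  case: (eqVneq m' m0) => [->|_]; last exact: Wspace0.
  exists 1%N, (fun=> f); split; last by move=> x; rewrite big_ord1.
  by move=> _ i; rewrite m0E; exact: am.
apply/funext => x; rewrite (bigD1 m0)/=; last first.
  by rewrite /Mset (eq_bigr m)// => i _; exact: m0E.
by rewrite eqxx big1 ?addr0// => m' /andP[_ /negbTE ->].
Qed.

End SparseTensors.

(** * The exterior derivative *)

Section StrongDerivative.
Context {R : realType} {d : nat}.
Implicit Types (x : d.-tuple R) (i j : 'I_d) (I J K : {set 'I_d}).
Implicit Types (u v g : d.-tuple R -> R) (w eta r : dform R d) (D : 'I_d -> dform R d).
Local Notation mu := (cube_measure R d).

Lemma dtensZ j c u g : dtens j u g -> dtens j (fun x => c * u x) (fun x => c * g x).
Proof.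
move: u g; apply: dtens_rec => [|u v g h _ _ e1 e2|f h bf fh].
- by under [X in dtens _ X _]eq_fun do rewrite mulr0; under [X in dtens _ _ X]eq_fun do rewrite mulr0;
    exact: dtens0.
- by under [X in dtens _ X _]eq_fun do rewrite mulrDr; under [X in dtens _ _ X]eq_fun do rewrite mulrDr;
    exact: dtensD.
rewrite (rank1Z j) (_ : (fun x => c * _) =
    rank1 (setfactor (setfactor f j (fun t => c * f j t)) j (fun t => c * h t))).
  apply: dtens_rank1; last by rewrite setfactorE; exact: acZ.
  by apply: lbfactors_set => //; exact: locboundedZ.
apply/funext => x; rewrite !rank1_setfactor mulrCA; congr (_ * _).
by apply: eq_bigr => i /negbTE ij; rewrite /setfactor ij.
Qed.

Definition sgn j J : R := (-1) ^+ #|[set i in J | (i < j)%N]|.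

Lemma sgn_setD1_gt i j J : i \in J -> (i < j)%N -> sgn j (J :\ i)%SET = - sgn j J.
Proof.
move=> iJ ij; rewrite /sgn [in RHS](cardsD1 i) inE iJ ij/= exprS mulN1r opprK.
congr (_ ^+ _); apply: eq_card => l; rewrite !inE.
by case: (l == i).
Qed.

Lemma sgn_setD1_le i j J : (j <= i)%N -> sgn j (J :\ i)%SET = sgn j J.
Proof.
move=> ji; congr (_ ^+ _); apply: eq_card => l; rewrite !inE.
by have [->|] := eqVneq l i; rewrite //= ltnNge ji /= andbF.
Qed.

(* D j I stands for the derivative of w_I in x_j, and dd D J for the coefficient
   of dx_J in d w. *)
Definition dd D J x : R := \sum_(j in J) sgn j J * D j (J :\ j)%SET x.

(** Separates the form [w], known up to null sets, from a tensor representative [r] on which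
    calculus is pointwise. Only directions outside [I] occur, as only these enter the exterior
    derivative. *)
Definition strong_rep w r D := [/\ forall I, measurable_fun setT (w I),
  forall I, aeq (w I) (r I) & forall I j, j \notin I -> dtens j (r I) (D j I)].

Lemma strong_rep_tensD w r D I j : strong_rep w r D -> j \notin I -> tens (D j I).
Proof. by move=> [_ _ rD] jI; exact: dtens_tensr (rD _ _ jI). Qed.

Lemma dd_tens w r D J : strong_rep w r D -> tens (dd D J).
Proof.
move=> rD; apply: tens_sum => j jJ; apply: (tensZ j).
by apply: strong_rep_tensD rD _; rewrite !inE eqxx.
Qed.

Lemma Rintegral_lincomb (A : Type) (s : seq A) (P : pred A) (c : A -> R)
    (F : A -> d.-tuple R -> R) :
  (forall a, P a -> mu.-integrable setT (EFin \o F a)) ->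
  \int[mu]_x (\sum_(a <- s | P a) c a * F a x) = \sum_(a <- s | P a) c a * \int[mu]_x F a x.
Proof.
move=> iF.
have icF a : P a -> mu.-integrable setT (EFin \o (fun x => c a * F a x)).
  by move=> Pa; exact: (integrableZl measurableT (c a) (iF a Pa)).
suff [//] : \int[mu]_x (\sum_(a <- s | P a) c a * F a x) =
      \sum_(a <- s | P a) c a * \int[mu]_x F a x /\
    mu.-integrable setT (EFin \o (fun x => \sum_(a <- s | P a) c a * F a x)).
elim: s => [|a s [IH1 IH2]].
  split.
    rewrite big_nil (@eq_Rintegral _ _ _ mu setT (fun=> 0)) ?Rintegral_cst ?mul0r// => x _.
    by rewrite big_nil.
  by under eq_fun do rewrite big_nil; exact: integrable0.
have [Pa|nPa] := boolP (P a); last first.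
  rewrite big_cons (negbTE nPa); under eq_fun do rewrite big_cons (negbTE nPa).
  by split => //; under eq_Rintegral do rewrite big_cons (negbTE nPa).
rewrite big_cons Pa; under eq_fun do rewrite big_cons Pa.
split; last exact: (integrableD measurableT (icF a Pa) IH2).
rewrite (RintegralD measurableT (icF a Pa) IH2) IH1; congr (_ + _).
exact: (RintegralZl (c a) measurableT (iF a Pa)).
Qed.

Lemma measurable_mul_test u phi : measurable_fun setT u -> test_function phi ->
  measurable_fun setT (fun x => u x * phi (row_of x)).
Proof.
by move=> mu_ tphi; apply: measurable_funM => //; exact: measurable_test.
Qed.

Lemma weak_dd w r D J phi : strong_rep w r D -> test_function phi ->
  \int[mu]_x (dd D J x * phi (row_of x)) =
  - \sum_(j in J) sgn j J *
      \int[mu]_x (w (J :\ j)%SET x * 'D_(delta_mx 0 j) phi (row_of x)).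
Proof.
move=> rD tphi; have [mw wr wD] := rD.
have jJ j : j \notin (J :\ j)%SET by rewrite !inE eqxx.
rewrite (@eq_Rintegral _ _ _ mu setT (fun x => \sum_(j in J) sgn j J *
    (D j (J :\ j)%SET x * phi (row_of x)))); last first.
  by move=> x _; rewrite /dd mulr_suml; apply: eq_bigr => j _; rewrite mulrA.
rewrite Rintegral_lincomb; last first.
  by move=> j _; apply: tens_test_integrable => //; exact: strong_rep_tensD rD _.
rewrite -sumrN; apply: eq_bigr => j _; rewrite -mulrN; congr (_ * _).
rewrite (dtens_weak (wD _ _ (jJ j)) tphi); congr (- _).
have tdphi := test_partial j tphi.
apply: aeq_Rintegral.
- apply: (measurable_mul_test _ tdphi); apply: tens_measurable.
  exact: dtens_tensl (wD _ _ (jJ j)).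
- exact: (measurable_mul_test _ tdphi).
- by apply: aeq_mul; [exact/aeq_sym|exact: aeq_refl].
Qed.

Lemma weak_d_intro w r D eta : strong_rep w r D ->
  (forall J, measurable_fun setT (eta J)) -> (forall J, aeq (eta J) (dd D J)) ->
  weak_d w eta.
Proof.
move=> rD me etaE J phi tphi; have := weak_dd J rD tphi; rewrite /sgn => <-.
apply: aeq_Rintegral.
- exact: measurable_mul_test.
- by apply: measurable_mul_test => //; apply: tens_measurable; exact: dd_tens rD.
- by apply: aeq_mul => //; exact: aeq_refl.
Qed.

Lemma integrable_mul_test u phi : mu.-integrable setT (EFin \o u) -> test_function phi ->
  mu.-integrable setT (EFin \o (fun x => u x * phi (row_of x))).
Proof.
move=> iu tphi; have [M phiM] := test_bounded tphi.
apply: (@integrableMl _ _ R mu setT measurableT (EFin \o u) (phi \o row_of)) => //.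
  exact: measurable_test.
exists M; split; first exact: num_real.
by move=> y My x _; exact: le_trans (phiM _) (ltW My).
Qed.

(** [eta J] and [dd D J] pair equally with every test function; square integrability on a finite
    measure space supplies the integrability needed to conclude. *)
Lemma weak_d_elim w r D eta : strong_rep w r D -> L2form eta -> weak_d w eta ->
  forall J, aeq (eta J) (dd D J).
Proof.
move=> rD L2e we J.
have ie := Lfun2_integrable (L2e J).
have tD := dd_tens J rD; have iD := tens_integrable tD.
have : {ae mu, forall x, eta J x - dd D J x = 0}.
  apply: fundamental_lemma => [|phi tphi]; first exact: (integrableB measurableT ie iD).
  rewrite (@eq_Rintegral _ _ _ mu setT
      (fun x => eta J x * phi (row_of x) - dd D J x * phi (row_of x))); last first.
    by move=> x _; rewrite mulrBl.
  rewrite (RintegralB measurableT (integrable_mul_test ie tphi) (integrable_mul_test iD tphi)).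
  by rewrite we// (weak_dd J rD tphi) subrr.
by apply: filterS => x /eqP; rewrite subr_eq0 => /eqP.
Qed.

End StrongDerivative.

(** * The homotopy operator *)

Section Homotopy.
Context {R : realType} {d : nat}.
Implicit Types (x : d.-tuple R) (i j : 'I_d) (I J K : {set 'I_d}).
Implicit Types (u v g : d.-tuple R -> R) (w eta r : dform R d) (D : 'I_d -> dform R d).
Local Notation mu := (cube_measure R d).

(** Holds for every [i] when [J] is empty, so the coefficient of degree 0 in [H w] collects a term
    for each coordinate. *)
Definition below i J := [forall j in J, (i < j)%N].

Definition firsts (m : nat) : seq 'I_d := [seq j : 'I_d <- enum 'I_d | (j < m)%N].

Lemma mem_firsts m j : (j \in firsts m) = (j < m)%N.
Proof. by rewrite mem_filter mem_enum andbT. Qed.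

Lemma map_firsts m : (m <= d)%N -> map val (firsts m) = iota 0 m.
Proof.
move=> md; rewrite -(filter_iota_ltn 0 md) -val_enum_ord filter_map.
by congr map; apply: eq_filter.
Qed.

Lemma firstsS i : firsts i.+1 = rcons (firsts i) i.
Proof.
apply: (inj_map val_inj); rewrite map_rcons !map_firsts//; last exact: ltnW.
by rewrite -addn1 iotaD cats1.
Qed.

Lemma firsts0 : firsts 0 = [::].
Proof. by apply: (inj_map val_inj); rewrite map_firsts. Qed.

(* The coefficient of dx_J in P_{<i} (h_i r) when i is below J, in which case the
   sign in h_i is +1; all other coefficients vanish. *)
Definition hterm r i J := Pavg (firsts i) (primitive_at i (r (i |: J)%SET)).

Definition hv r : dform R d := fun J x => \sum_(i | below i J) hterm r i J x.

Lemma foldr_p_op w s J :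
  foldr (@p_op R d) w s J = if has (mem J) s then cst 0 else Pavg s (w J).
Proof.
elim: s => //= j s IH; rewrite /p_op; case: ifP => // _; rewrite IH.
by case: ifP => //= _; exact: average_at0.
Qed.

Lemma below_notin i J : below i J -> i \notin J.
Proof. by move=> /'forall_implyP/(_ i) h; apply/negP => /h; rewrite ltnn. Qed.

(** Each p_j kills the coefficients containing [j], so P_{<i} leaves only sets [J] without elements
    below [i]; as [h_i] also excludes [i] itself, no element of [J] precedes [i] and the sign is
    trivial. *)
Lemma homotopyE w : homotopy w = hv w.
Proof.
apply/funext => J; apply/funext => x; rewrite /homotopy /hv [RHS]big_mkcond/=.
apply: eq_bigr => i _; rewrite /P_lt foldr_p_op -/(firsts i) /h_op.
have [/hasP[j]|nh] := boolP (has _ _).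
  rewrite mem_firsts /= => ji jJ; rewrite ifN//; apply/negP => /'forall_implyP/(_ j jJ).
  by rewrite ltnNge ltnW.
case: ifPn => iJ.
  rewrite Pavg0; rewrite ifN//; apply/negP => /below_notin.
  by rewrite iJ.
have bi : below i J.
  apply/'forall_implyP => j jJ; rewrite ltn_neqAle leqNgt.
  have -> /= : val i != val j by apply: contraNneq iJ => /val_inj ->.
  by apply: contra nh => ji; apply/hasP; exists j => //; rewrite mem_firsts.
rewrite bi /hterm (_ : (fun x => _) = primitive_at i (w (i |: J)%SET))//.
apply/funext => y; rewrite (_ : #|_| = 0%N) ?expr0 ?mul1r//.
apply: eq_card0 => j; rewrite !inE; apply/negP => /andP[jJ].
by move/'forall_implyP/(_ j jJ) : bi; lia.
Qed.

Lemma hterm_tens r i J : tens (r (i |: J)%SET) -> tens (hterm r i J).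
Proof. by move=> tr; apply: Pavg_tens; exact: primitive_at_tens. Qed.

Lemma measurable_hterm w i J : measurable_fun setT (w (i |: J)%SET) -> measurable_fun setT (hterm w i J).
Proof. by move=> mw; apply: measurable_Pavg; exact: measurable_primitive_at. Qed.

Lemma measurable_hv w J : (forall I, measurable_fun setT (w I)) -> measurable_fun setT (hv w J).
Proof.
move=> mw.
have -> : hv w J = fun x => \sum_i (if below i J then hterm w i J x else 0).
  by apply/funext => x; rewrite /hv big_mkcond.
by apply: measurable_sum => i; case: (below i J); [exact: measurable_hterm|exact: measurable_cst].
Qed.

Lemma aeq_hv w r J : (forall I, measurable_fun setT (w I)) -> (forall I, tens (r I)) ->
  (forall I, aeq (w I) (r I)) -> aeq (hv w J) (hv r J).
Proof.
move=> mw tr wr; apply: aeq_sum => i _; apply: aeq_Pavg.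
- exact: measurable_primitive_at.
- by apply: measurable_primitive_at; exact: tens_measurable.
- by apply: aeq_primitive_at => //; exact: tens_measurable.
Qed.

(** The derivative of [hterm r i J] in [x_j]: zero if [x_j] has been averaged out, the integrand
    itself if [j = i] since A_i is a primitive, and otherwise the derivative commutes with averages
    and A_i. *)
Definition dhterm r D j i J : d.-tuple R -> R :=
  if (j < i)%N then fun=> 0 else if j == i then Pavg (firsts i) (r (i |: J)%SET)
  else Pavg (firsts i) (primitive_at i (D j (i |: J)%SET)).

Lemma dtens_hterm w r D i j J : strong_rep w r D -> (forall I, tens (r I)) -> j \notin J ->
  dtens j (hterm r i J) (dhterm r D j i J).
Proof.
move=> [_ _ rD] tr jJ; rewrite /dhterm; case: ltnP => [ji|ij].
  by apply: dtens_Pavg_in; [rewrite mem_firsts|exact: primitive_at_tens].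
have jf : j \notin firsts i by rewrite mem_firsts -leqNgt.
have [ji|nij] := eqVneq j i.
  by apply: dtens_Pavg => //; rewrite ji; exact: dtens_primitive_same.
apply: dtens_Pavg => //; apply: dtens_primitive; first by rewrite eq_sym.
by apply: rD; rewrite !inE negb_or nij.
Qed.

Lemma strong_rep_homotopy w r D : strong_rep w r D -> (forall I, tens (r I)) ->
  strong_rep (homotopy w) (hv r) (fun j J x => \sum_(i | below i J) dhterm r D j i J x).
Proof.
move=> rD tr; have [mw wr _] := rD; rewrite homotopyE; split.
- by move=> J; exact: measurable_hv.
- by move=> J; exact: aeq_hv.
- by move=> J j jJ; apply: dtens_sum => i _; exact: dtens_hterm rD tr jJ.
Qed.

(** Since A_i d_i u = u - p_i u, the summand of index [i] is P_{<i} u - P_{<i+1} u. The bound [m] is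
    the least index of the coefficient set for forms of positive degree, and [d] for functions. *)
Lemma Pavg_telescope u (g : 'I_d -> d.-tuple R -> R) (m : nat) x : (m <= d)%N -> tens u ->
  (forall i, (i < m)%N -> dtens i u (g i)) -> cubec x ->
  u x = Pavg (firsts m) u x +
    \sum_(i < d | (i < m)%N) Pavg (firsts i) (primitive_at i (g i)) x.
Proof.
move=> md tu ug cx.
have E i : (i < m)%N -> Pavg (firsts i) (primitive_at i (g i)) x =
    Pavg (firsts i) u x - Pavg (firsts i.+1) u x.
  move=> im; rewrite (Pavg_cubec (firsts i) (fun y => @primitive_at_deriv _ _ i _ _ y (ug i im)))//.
  rewrite (PavgB i)//; last exact: average_at_tens.
  by rewrite firstsS /Pavg foldr_rcons.
rewrite (eq_bigr _ E) (big_ord_narrow md)/=.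
rewrite -(big_mkord xpredT (fun i : nat => Pavg (firsts i) u x - Pavg (firsts i.+1) u x)).
rewrite (telescope_sumr_eq (fun i : nat => - Pavg (firsts i) u x))//.
  by rewrite firsts0 /=; ring.
by move=> i _; ring.
Qed.

Lemma Pavg_primitive_lincomb (A : Type) (t : seq A) (P : pred A) s i (c : A -> R)
    (F : A -> d.-tuple R -> R) : (forall a, P a -> tens (F a)) ->
  Pavg s (primitive_at i (fun x => \sum_(a <- t | P a) c a * F a x)) =
  fun x => \sum_(a <- t | P a) c a * Pavg s (primitive_at i (F a)) x.
Proof.
move=> tF; rewrite primitive_at_sum; last by move=> a Pa; apply: (tensZ i); exact: tF.
rewrite Pavg_sum; last by move=> a Pa; apply/primitive_at_tens/(tensZ i)/tF.
apply/funext => x; apply: eq_bigr => a Pa; rewrite primitive_atZ; last exact: tF.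
by rewrite PavgZ//; apply/primitive_at_tens/tF.
Qed.

(** With [m] the least element of [K]: an index i < m lies below every [K :\ j]. For i = m this
    forces j = m, which gives P_{<m} r_K. For i > m it again forces j = m, but then [x_j] has been
    averaged out and the derivative is 0. *)
Lemma dhterm_setD1 r D K m i j x : m \in K -> (forall l, l \in K -> (m <= l)%N) -> j \in K ->
  (if below i (K :\ j)%SET then dhterm r D j i (K :\ j)%SET x else 0) =
  (if (i == m) && (j == m) then Pavg (firsts m) (r K) x else 0) +
  (if (i < m)%N then Pavg (firsts i) (primitive_at i (D j (i |: K :\ j)%SET)) x else 0).
Proof.
move=> mK mmin jK; have mj := mmin j jK; rewrite /dhterm.
case: (ltngtP i m) => [im|im|/val_inj im].
- rewrite (_ : below i _ = true); last first.
    by apply/'forall_implyP => l; rewrite !inE => /andP[_ /mmin]; lia.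
  rewrite ifN; last by rewrite -leqNgt; lia.
  rewrite ifN; last by apply/eqP => h; move: mj; rewrite h; lia.
  by rewrite ifN ?add0r//; apply/negP => /andP[/eqP h]; move: im; rewrite h ltnn.
- rewrite (_ : (i == m) = false) /= ?addr0; last by apply/eqP => h; move: im; rewrite h ltnn.
  case: ifP => // bi; have [jm|jm] := eqVneq j m; first by rewrite jm im.
  have mKj : m \in (K :\ j)%SET by rewrite !inE eq_sym jm.
  by move/'forall_implyP/(_ m mKj) : bi; lia.
- rewrite im eqxx/= addr0; have [->|jm] := eqVneq j m.
    rewrite ltnn finset.setD1K// ifT//; apply/'forall_implyP => l; rewrite !inE => /andP[lm /mmin].
    by rewrite leq_eqVlt => /orP[/eqP/val_inj h|//]; move: lm; rewrite h eqxx.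
  rewrite ifN//; apply/negP => /'forall_implyP/(_ m); rewrite !inE eq_sym jm mK ltnn.
  by move/(_ isT).
Qed.

Lemma dd_dhterm r D K m x : m \in K -> (forall l, l \in K -> (m <= l)%N) ->
  (forall i j, (i < m)%N -> j \in K -> tens (D j (i |: K :\ j)%SET)) ->
  dd (fun j J x => \sum_(i | below i J) dhterm r D j i J x) K x =
  Pavg (firsts m) (r K) x + \sum_(i < d | (i < m)%N) Pavg (firsts i)
    (primitive_at i (fun x => \sum_(j in K) sgn j K * D j (i |: K :\ j)%SET x)) x.
Proof.
move=> mK mmin tD; rewrite /dd.
under eq_bigr => j jK.
  rewrite big_mkcond/=; under eq_bigr => i _ do rewrite (dhterm_setD1 r D i x mK mmin jK).
  rewrite big_split/= -big_mkcond/= mulrDr -[X in _ + _ * X]big_mkcond/=.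
  over.
rewrite big_split/=; congr (_ + _).
  rewrite (bigD1 m)//= [X in _ + X]big1 ?addr0; last first.
    by move=> j /andP[_ jm]; rewrite big_pred0 ?mulr0// => i; rewrite (negbTE jm) andbF.
  under eq_bigl do rewrite eqxx andbT.
  rewrite big_pred1_eq /sgn (_ : #|_| = 0%N) ?expr0 ?mul1r//; apply: eq_card0 => l.
  by rewrite !inE; apply/negP => /andP[/mmin]; lia.
under eq_bigr do rewrite mulr_sumr.
rewrite exchange_big/=; apply: eq_bigr => i im.
by rewrite Pavg_primitive_lincomb// => j jK; exact: tD.
Qed.

(* Closedness of w on the sets i |: K, with i below K, turns the terms of index i
   into P_{<i} (A_i d_i w_K), which telescope because A_i d_i = id - p_i. *)
Lemma dd_homotopy w r D K : strong_rep w r D -> (forall I, tens (r I)) ->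
  (forall J, aeq (dd D J) (fun=> 0)) -> K != finset.set0 ->
  aeq (dd (fun j J x => \sum_(i | below i J) dhterm r D j i J x) K) (r K).
Proof.
move=> rD tr D0 /set0Pn[m0 m0K]; have [_ _ wD] := rD.
have [m mK mmin] := arg_minnP (fun j : 'I_d => val j) m0K.
have {}mmin l : l \in K -> (m <= l)%N by exact: mmin.
have DK i j : (i < m)%N -> j \in K -> tens (D j (i |: K :\ j)%SET).
  move=> im jK; apply: strong_rep_tensD rD _; rewrite !inE eqxx orbF.
  by apply: contraTN im => /eqP <-; rewrite -leqNgt; exact: mmin.
(* Inserting [i] below [K] gives [i] the sign +1 and flips the sign of each [j] in [K], so
   closedness at [i |: K] can be solved for the derivative of [r K] in [x_i]. *)
have H i : (i < m)%N -> aeq (fun x => \sum_(j in K) sgn j K * D j (i |: K :\ j)%SET x) (D i K).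
  move=> im; have iK : i \notin K by apply: contraTN im => /mmin; rewrite -leqNgt.
  apply: filterS (D0 (i |: K)%SET) => x; rewrite /dd (big_setU1 _ iK)/=.
  have -> : sgn i (i |: K)%SET = 1 :> R.
    rewrite /sgn (_ : #|_| = 0%N)//; apply: eq_card0 => l; rewrite !inE.
    by apply/negP => /andP[/orP[/eqP ->|/mmin]] /=; lia.
  rewrite mul1r finset.setU1K// => /eqP; rewrite addr_eq0 => /eqP ->; rewrite -sumrN.
  apply: eq_bigr => j jK; have ij : (i < j)%N by have := mmin j jK; lia.
  have -> : ((i |: K) :\ j = i |: K :\ j)%SET.
    apply/setP => l; rewrite !inE; have [->|] := eqVneq l i; last by [].
    by rewrite /= andbT; apply/eqP => h; move: ij; rewrite h ltnn.
  rewrite -mulNr; congr (_ * _).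
  by rewrite -(@sgn_setD1_gt R d i j) ?finset.setU1K// !inE eqxx.
have E x : cubec x -> dd (fun j J x => \sum_(i | below i J) dhterm r D j i J x) K x =
    Pavg (firsts m) (r K) x + \sum_(i < d | (i < m)%N) Pavg (firsts i)
      (primitive_at i (fun x => \sum_(j in K) sgn j K * D j (i |: K :\ j)%SET x)) x.
  by move=> _; exact: dd_dhterm.
apply: aeq_trans (aeq_cubec E) _.
have F : aeq (fun x => Pavg (firsts m) (r K) x + \sum_(i < d | (i < m)%N) Pavg (firsts i)
      (primitive_at i (fun x => \sum_(j in K) sgn j K * D j (i |: K :\ j)%SET x)) x)
   (fun x => Pavg (firsts m) (r K) x + \sum_(i < d | (i < m)%N) Pavg (firsts i)
      (primitive_at i (D i K)) x).
  have : aeq (fun x => \sum_(i < d | (i < m)%N) Pavg (firsts i)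
      (primitive_at i (fun x => \sum_(j in K) sgn j K * D j (i |: K :\ j)%SET x)) x)
   (fun x => \sum_(i < d | (i < m)%N) Pavg (firsts i) (primitive_at i (D i K)) x).
    apply: aeq_sum => i im.
    have tS : tens (fun x => \sum_(j in K) sgn j K * D j (i |: K :\ j)%SET x).
      by apply: tens_sum => j jK; apply: (tensZ j); exact: DK.
    have iK : i \notin K by apply: contraTN im => /mmin; rewrite -leqNgt.
    have tD : tens (D i K) by exact: strong_rep_tensD rD iK.
    apply: aeq_Pavg.
    - exact: (tens_measurable (primitive_at_tens i _)).
    - exact: (tens_measurable (primitive_at_tens i _)).
    - by apply: aeq_primitive_at; [exact: tens_measurable|exact: tens_measurable|exact: H].
  by apply: filterS => x h; exact: (congr1 (fun a => Pavg (firsts m) (r K) x + a) h).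
apply: aeq_trans F _; apply: aeq_cubec => x cx.
rewrite [RHS](@Pavg_telescope _ (fun i => D i K) m)// => [|i im]; first exact: ltnW.
by apply: wD; apply: contraTN im => /mmin; rewrite -leqNgt.
Qed.

End Homotopy.

(** * The norm bound for the homotopy operator *)

Section HomotopyNorm.
Context {R : realType} {d : nat}.
Implicit Types (x : d.-tuple R) (i j : 'I_d) (I J K : {set 'I_d}) (w r : dform R d).
Local Notation mu := (cube_measure R d).

Lemma Rintegral_tens_sum (A : Type) (s : seq A) (P : pred A) (F : A -> d.-tuple R -> R) :
  (forall a, P a -> tens (F a)) ->
  \int[mu]_x (\sum_(a <- s | P a) F a x) = \sum_(a <- s | P a) \int[mu]_x F a x.
Proof.
move=> tF; have := @Rintegral_lincomb R d A s P (fun=> 1) F.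
under eq_Rintegral do under eq_bigr do rewrite mul1r.
move=> ->; last by move=> a Pa; exact/tens_integrable/tF.
by apply: eq_bigr => a _; rewrite mul1r.
Qed.

(* Averaging in x_i kills the term of index i, whereas the term of index i' > i does
   not depend on x_i. *)
Lemma hterm_orthogonal r i i' J : (forall I, tens (r I)) -> (i < i')%N ->
  \int[mu]_x (hterm r i J x * hterm r i' J x) = 0.
Proof.
move=> tr ii'; have tT l : tens (hterm r l J) by exact: hterm_tens.
have ind : indep i (hterm r i' J) by apply: Pavg_indep; rewrite mem_firsts.
rewrite -(Rintegral_average i (tensM (tT i) (tT i'))).
rewrite (@eq_Rintegral _ _ _ mu setT (fun=> 0)); first by rewrite Rintegral_cst// mul0r.
move=> x _; rewrite average_at_mulr// Pavg_average_at; last 2 first.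
- by rewrite mem_firsts ltnn.
- exact: primitive_at_tens.
rewrite (_ : average_at i _ = fun=> 0) ?Pavg0 ?mul0r//.
by apply/funext => y; exact: average_at_primitive_at.
Qed.

Lemma hterm_norm r i J : tens (r (i |: J)%SET) ->
  \int[mu]_x (hterm r i J x ^+ 2) <= pi ^- 2 * \int[mu]_x (r (i |: J)%SET x ^+ 2).
Proof.
move=> tr; apply: le_trans (Pavg_contraction _ (primitive_at_tens i tr)) _.
exact: primitive_at_contraction.
Qed.

(** Pythagoras: all cross terms vanish by orthogonality, used with the roles of the two indices
    exchanged when necessary. *)
Lemma hv_norm r J : (forall I, tens (r I)) ->
  \int[mu]_x (hv r J x ^+ 2) = \sum_(i | below i J) \int[mu]_x (hterm r i J x ^+ 2).
Proof.
move=> tr; have tT i : tens (hterm r i J) by exact: hterm_tens.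
rewrite (@eq_Rintegral _ _ _ mu setT (fun x => \sum_(i | below i J) \sum_(i' | below i' J)
    hterm r i J x * hterm r i' J x)); last first.
  by move=> x _; rewrite expr2 /hv mulr_suml; apply: eq_bigr => i _; rewrite mulr_sumr.
rewrite Rintegral_tens_sum; last by move=> i _; apply: tens_sum => i' _; exact: tensM.
apply: eq_bigr => i bi; rewrite Rintegral_tens_sum; last by move=> i' _; exact: tensM.
rewrite (bigD1 i)//= big1 ?addr0// => i' /andP[_].
rewrite -val_eqE neq_ltn => /orP[h|h]; last exact: hterm_orthogonal.
by rewrite -(hterm_orthogonal J tr h); apply: eq_Rintegral => x _; exact: mulrC.
Qed.

(** The pair (J, i) is recovered from K = [i |: J], because [i] must be the least element of [K]; so
    no [K] is counted twice. *)
Lemma sum_below (F : {set 'I_d} -> R) : (forall K, 0 <= F K) ->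
  \sum_J \sum_(i | below i J) F (i |: J)%SET <= \sum_K F K.
Proof.
move=> F0; pose Q i K := (i \in K) && below i (K :\ i)%SET.
have Quniq i i' K : Q i K -> Q i' K -> i = i'.
  move=> /andP[iK /'forall_implyP bi] /andP[iK' /'forall_implyP bi'].
  apply/eqP; apply/negPn/negP => ii'.
  have := bi i'; have := bi' i; rewrite !inE ii' eq_sym ii' iK iK' => /(_ isT) h1 /(_ isT) h2.
  by have := ltn_trans h1 h2; rewrite ltnn.
rewrite (exchange_big_dep xpredT)//=.
have E i : \sum_(J | below i J) F (i |: J)%SET = \sum_(K | Q i K) F K.
  rewrite [RHS](reindex_onto (fun J => i |: J)%SET (fun K => K :\ i)%SET); last first.
    by move=> K /andP[iK _]; exact: finset.setD1K.
  apply: eq_bigl => J; have [iJ|iJ] := boolP (i \in J).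
    rewrite (_ : below i J = false); last by apply/negP => /below_notin; rewrite iJ.
    apply/esym/negP => /andP[_ /eqP h]; move: iJ; rewrite -h !inE eqxx.
    by [].
  by rewrite /Q finset.setU1K// eqxx andbT !inE eqxx.
under eq_bigr do rewrite E.
rewrite (exchange_big_dep xpredT)//=; apply: ler_sum => K _.
have [i Qi|Q0] := pickP (fun i => Q i K); last by rewrite big_pred0.
rewrite (bigD1 i)//= big1 ?addr0// => i' /andP[Qi'].
by rewrite (Quniq _ _ _ Qi' Qi) eqxx.
Qed.

Lemma form_norm_tens w r : (forall I, measurable_fun setT (w I)) -> (forall I, tens (r I)) ->
  (forall I, aeq (w I) (r I)) ->
  L2form w /\ form_norm w = Num.sqrt (\sum_I \int[mu]_x (r I x ^+ 2)).
Proof.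
move=> mw tr wr; split; first by move=> I; have [] := Lnorm2_tens (mw I) (tr I) (wr I).
by congr Num.sqrt; apply: eq_bigr => I _; have [] := Lnorm2_tens (mw I) (tr I) (wr I).
Qed.

Lemma homotopy_norm w r : (forall I, measurable_fun setT (w I)) -> (forall I, tens (r I)) ->
  (forall I, aeq (w I) (r I)) -> form_norm (homotopy w) <= pi^-1 * form_norm w.
Proof.
move=> mw tr wr; have [_ ->] := form_norm_tens mw tr wr.
have thr J : tens (hv r J) by apply: tens_sum => i _; exact: hterm_tens.
rewrite homotopyE; have [_ ->] := form_norm_tens (fun J => measurable_hv J mw) thr
  (fun J => aeq_hv J mw tr wr).
have -> : pi^-1 = Num.sqrt (pi ^- 2) :> R.
  by rewrite -exprVn sqrtr_sqr ger0_norm// invr_ge0 pi_ge0.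
rewrite -sqrtrM ?invr_ge0 ?sqr_ge0// ler_wsqrtr//.
have F0 K : 0 <= \int[mu]_x (r K x ^+ 2) by apply: Rintegral_ge0 => x _; exact: sqr_ge0.
apply: (@le_trans _ _ (\sum_J \sum_(i | below i J) pi ^- 2 * \int[mu]_x (r (i |: J)%SET x ^+ 2))).
  apply: ler_sum => J _; rewrite hv_norm//; apply: ler_sum => i _; exact: hterm_norm.
under eq_bigr do rewrite -mulr_sumr.
rewrite -mulr_sumr ler_wpM2l ?invr_ge0 ?sqr_ge0//.
exact: (sum_below F0).
Qed.

End HomotopyNorm.

(** * Exactness of the sparse complex *)

Section SparseComplex.
Context {R : realType} {d k n : nat}.
Variable psi : nat -> nat -> 'I_k.+1 -> R -> R.
Hypotheses (hd : (0 < d)%N) (hpsi : wavelet_basis psi).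
Implicit Types (x : d.-tuple R) (i j : 'I_d) (I J K : {set 'I_d}) (v w : dform R d).
Implicit Types s : {set 'I_d} -> seq (@term R d).
Local Notation mu := (cube_measure R d).
Local Notation sparse := (@sparse R d k n psi).

(** In the wrong degree the representative is the empty list, hence exactly 0, and this vanishing
    survives [H] and [d] by computation. *)
Definition Vrep (l : nat) w s := forall I, [/\ List.Forall (@spterm R d k n psi I) (s I),
  aeq (w I) (tenX finset.set0 (s I)) & #|I| != l -> s I = [::]].

Lemma tenX_nil (X : {set 'I_d}) : tenX X [::] = (fun=> 0 : R).
Proof. by apply/funext => x; rewrite /tenX /ten big_nil. Qed.

Lemma Vspace_rep l w : Vspace d n psi l w -> exists s, Vrep l w s.
Proof.
move=> [_ wI]; suff /choice[s sP] : forall I, exists t : seq (@term R d),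
    [/\ List.Forall (@spterm R d k n psi I) t,
        aeq (w I) (tenX finset.set0 t) & #|I| != l -> t = [::]] by exists s.
move=> I; have := wI I; case: ifP => _.
  move=> /(sparse_coefP hpsi)[u /(sparse_terms hpsi)[t st ->] wu].
  by exists t.
by move=> /aeqE w0; exists [::]; split => //; rewrite tenX_nil.
Qed.

Lemma Vrep_tens l w s I : Vrep l w s -> tens (tenX finset.set0 (s I)).
Proof. by move=> /(_ I)[ss _ _]; apply: tenX_tens; exact: spterm_lb ss. Qed.

Lemma Vrep_strong l w s : L2form w -> Vrep l w s ->
  strong_rep w (fun I => tenX finset.set0 (s I)) (fun j I => tenX [set j]%SET (s I)).
Proof.
move=> L2w ws; split.
- by move=> I; exact: Lfun2_measurable.
- by move=> I; have [] := ws I.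
- by move=> I j jI; have [ss _ _] := ws I; exact: dtens_tenX ss.
Qed.

Lemma L2form0 : L2form (@form0 R d).
Proof.
by have [] := @form_norm_tens R d (@form0 R d) (@form0 R d)
  (fun=> measurable_cst _) (fun=> tens0) (fun=> aeq_refl _).
Qed.

Lemma sparse_hterm s i J : List.Forall (@spterm R d k n psi (i |: J)%SET) (s (i |: J)%SET) ->
  below i J -> sparse J (hterm (fun I => tenX finset.set0 (s I)) i J).
Proof.
move=> ss bi; have iJ := below_notin bi; apply: sparse_Pavg.
  apply/allP => j; rewrite mem_firsts => ji; apply/negP => jJ.
  by move/'forall_implyP/(_ j jJ) : bi; lia.
rewrite -[X in sparse X _](finset.setU1K iJ); apply: (sparse_primitive hpsi).
  by rewrite !inE eqxx.
exact: sparse_tenX0.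
Qed.

Lemma kernel_homotopy (l : nat) v : (1 <= l <= d)%N -> Zkernel d n psi l v ->
  [/\ Vspace d n psi l.-1 (homotopy v), weak_d (homotopy v) v &
      form_norm (homotopy v) <= pi^-1 * form_norm v].
Proof.
move=> /andP[l1 ld] [Vv dv]; have [L2v _] := Vv; have [s vs] := Vspace_rep Vv.
have rD := Vrep_strong L2v vs; have [mv vr _] := rD.
have tr I := Vrep_tens I vs; have rH := strong_rep_homotopy rD tr.
have D0 J : aeq (dd (fun j I => tenX [set j]%SET (s I)) J) (fun=> 0).
  exact/aeq_sym/(weak_d_elim rD L2form0 dv).
have [mh hr _] := rH.
have th J : tens (hv (fun I => tenX finset.set0 (s I)) J).
  by apply: tens_sum => i _; exact: hterm_tens.
split; last exact: homotopy_norm mv tr vr.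
- split; first by have [] := form_norm_tens mh th hr.
  move=> J; case: eqP => Jl.
    apply: (sparse_coef_aeq hd _ (hr J)); apply: sparse_sum => i bi.
    by apply: sparse_hterm => //; have [] := vs (i |: J)%SET.
  apply/aeqE; apply: aeq_trans (hr J) _; apply: aeW => x; apply: big1 => i bi.
  have [_ _ s0] := vs (i |: J)%SET; rewrite /hterm s0 ?tenX_nil ?primitive_at0 ?Pavg0//.
  by rewrite cardsU1 (below_notin bi); apply/eqP; lia.
(* The empty set is treated apart: it has no least element to telescope to. Both sides vanish there,
   the left one because [v] has degree at least 1, the right one as an empty sum. *)
- apply: (weak_d_intro rH mv) => J; have [->|J0] := eqVneq J finset.set0.
    have [_ v0 s0] := vs finset.set0; apply: aeq_trans v0 _.
    rewrite s0 ?cards0 ?tenX_nil; last by rewrite eq_sym -lt0n.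
    by apply: aeW => x; rewrite /dd big_set0.
  by apply: aeq_trans (vr J) _; exact/aeq_sym/(dd_homotopy rD tr D0 J0).
Qed.

Lemma indep_cst (u : d.-tuple R -> R) : (forall j, indep j u) -> forall x y, u x = u y.
Proof.
(* The tuple [z m] takes its first [m] coordinates from [y] and the others from [x], so each step
   changes one coordinate. *)
move=> iu x y; pose z (m : nat) : d.-tuple R :=
  [tuple if (j < m)%N then tnth y j else tnth x j | j < d].
have zE m : (m <= d)%N -> u (z m) = u x.
  elim: m => [_|m IH md]; first by congr u; apply: eq_from_tnth => j; rewrite tnth_mktuple.
  rewrite -(IH (ltnW md)) -(iu (Ordinal md) (z m) (tnth y (Ordinal md))); congr u.
  apply: eq_from_tnth => j; rewrite tnth_upd !tnth_mktuple -val_eqE/= ltnS leq_eqVlt.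
  by case: eqP => //= jm; congr tnth; apply: val_inj.
rewrite -(zE d (leqnn d)); congr u; apply: eq_from_tnth => j.
by rewrite tnth_mktuple ltn_ord.
Qed.

(** If all partial derivatives vanish, telescoping over all [d] coordinates leaves only the full
    average, which depends on no coordinate. Conversely constants are admissible at level 0 and have
    zero derivative. *)
Lemma kernel0 : Zkernel d n psi 0 = constant_forms R d.
Proof.
apply/seteqP; split => v.
- move=> [Vv dv]; have [L2v vI] := Vv; have [s vs] := Vspace_rep Vv; split => //.
  have rD := Vrep_strong L2v vs; have [mv vr wD] := rD; have tr := Vrep_tens finset.set0 vs.
  pose u := tenX finset.set0 (s finset.set0).
  have D0 i : aeq (tenX [set i]%SET (s finset.set0)) (fun=> 0).
    apply: filterS (aeq_sym (weak_d_elim rD L2form0 dv [set i]%SET)) => x.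
    rewrite /dd big_set1 (_ : ([set i] :\ i)%SET = finset.set0); last first.
      by apply/setP => j; rewrite !inE; case: eqP.
    rewrite /sgn (_ : #|_| = 0%N) ?expr0 ?mul1r//; apply: eq_card0 => j; rewrite !inE.
    by apply/negP => /andP[/eqP ->]; rewrite ltnn.
  have i0 i : i \notin finset.set0 by rewrite inE.
  have uP : aeq u (Pavg (firsts d) u).
    have : aeq (fun x => \sum_(i < d | (i < d)%N) Pavg (firsts i)
        (primitive_at i (tenX [set i]%SET (s finset.set0))) x) (fun=> 0).
      apply: (@aeq_trans _ _ _ (fun x => \sum_(i < d | (i < d)%N) 0)); last first.
        by apply: aeW => x; rewrite big1.
      apply: aeq_sum => i _; have tD := dtens_tensr (wD _ _ (i0 i)).
      rewrite [X in aeq _ X](_ : _ = Pavg (firsts i) (primitive_at i (fun=> 0))); last first.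
        by rewrite primitive_at0 Pavg0.
      apply: aeq_Pavg.
      + exact: (tens_measurable (primitive_at_tens i _)).
      + by rewrite primitive_at0; exact: measurable_cst.
      + by apply: aeq_primitive_at => //; exact: tens_measurable.
    apply: filterS2 (ae_cube d) => x /cube_cubec cx S0.
    rewrite [LHS](@Pavg_telescope _ _ _ (fun i => tenX [set i]%SET (s finset.set0)) d)//.
      by rewrite S0 addr0.
    by move=> i _; exact: wD.
  (* An arbitrary base point at which the constant full average is evaluated. *)
  pose x0 : d.-tuple R := [tuple 0 | _ < d].
  exists (Pavg (firsts d) u x0) => I; case: eqP => [->|/eqP I0].
    apply/aeqE; apply: aeq_trans (vr _) _; apply: aeq_trans uP _; apply: aeW => x.
    by apply: indep_cst => j; apply: Pavg_indep; rewrite mem_firsts.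
  by have := vI I; rewrite ifN// cards_eq0.
- move=> [L2v [c vc]]; have vc' I : aeq (v I) (fun=> if I == finset.set0 then c else 0).
    exact/aeqE/vc.
  split.
    split => // I; case: ifPn => [/eqP/cards0_eq ->|I0].
      apply: (sparse_coef_aeq hd _ (vc' finset.set0)); rewrite eqxx.
      exact: sparse_cst.
    by have := vc I; rewrite ifN// -cards_eq0.
  have tc (a : R) : tens (fun _ : d.-tuple R => a) by exact: sparse_tens (sparse_cst psi hd a).
  have rD : strong_rep v (fun I _ => if I == finset.set0 then c else 0) (fun _ _ _ => 0).
    split => //; first by move=> I; exact: Lfun2_measurable.
    move=> I j _; have := dtens_average_same j (tc (if I == finset.set0 then c else 0)).
    by rewrite (_ : average_at j _ = fun=> if I == finset.set0 then c else 0)//;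
      apply/funext => x; exact: int01_cst.
  apply: (weak_d_intro rD) => J; first exact: measurable_cst.
  by apply: aeW => x; rewrite /dd big1// => j _; rewrite mulr0.
Qed.

Lemma antisym_sum J (e : 'I_d -> 'I_d -> R) :
  (forall i j, i \in J -> j \in J -> i != j -> e i j = - e j i) ->
  \sum_(i in J) \sum_(j in (J :\ i)%SET) e i j = 0.
Proof.
move=> eN; set S := LHS; suff h : S = - S by lra.
rewrite [in RHS]/S (exchange_big_dep (mem J))/=; last by move=> i j _; rewrite !inE => /andP[].
rewrite -sumrN; apply: eq_bigr => i iJ; rewrite -sumrN; apply: eq_big => j.
  by rewrite !inE iJ andbT andbC eq_sym.
by rewrite !inE => /andP[ji jJ]; rewrite eN// eq_sym.
Qed.

(** Removing the smaller index flips the sign of the larger one, whereas removing the larger leaves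
    the sign of the smaller unchanged. *)
Lemma sgn_antisym J i j : i \in J -> j \in J -> i != j ->
  sgn i J * sgn j (J :\ i)%SET = - (sgn j J * sgn i (J :\ j)%SET) :> R.
Proof.
move=> iJ jJ; rewrite -val_eqE neq_ltn => /orP[ij|ji].
- by rewrite (sgn_setD1_gt iJ ij) sgn_setD1_le ?(ltnW ij)// mulrN mulrC.
- by rewrite (sgn_setD1_gt jJ ji) sgn_setD1_le ?(ltnW ji)// mulrN opprK mulrC.
Qed.

(** Differentiating a Y-factor gives a Z-factor of the same level, so the derivative has a
    representative in the sparse space of degree [l]. It is closed because second derivatives are
    symmetric and the signs antisymmetric. *)
Lemma image_sub_kernel (l : nat) : (1 <= l)%N -> Bimage d n psi l `<=` Zkernel d n psi l.
Proof.
move=> l1 v [L2v [w Vw wv]]; have [L2w _] := Vw; have [s ws] := Vspace_rep Vw.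
have rD := Vrep_strong L2w ws; have vE := weak_d_elim rD L2v wv.
have sp J j : j \in J -> sparse J (tenX [set j]%SET (s (J :\ j)%SET)).
  move=> jJ; have [ss _ _] := ws (J :\ j)%SET; rewrite -[X in sparse X _](finset.setD1K jJ).
  by apply: sparse_tenX1 ss; rewrite !inE eqxx.
split.
  split => // J; case: ifPn => Jl.
    apply: (sparse_coef_aeq hd _ (vE J)); apply: sparse_sum => j jJ.
    by apply: (sparseZ j); exact: sp.
  apply/aeqE; apply: aeq_trans (vE J) _; apply: aeW => x; apply: big1 => j jJ.
  have [_ _ s0] := ws (J :\ j)%SET; rewrite s0 ?tenX_nil ?mulr0//.
  by have := cardsD1 j J; rewrite jJ; move: Jl => /eqP Jl cJ; apply/eqP; lia.
have rD2 : strong_rep v (dd (fun j I => tenX [set j]%SET (s I))) (fun i J x =>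
    \sum_(j in J) sgn j J * tenX [set i; j]%SET (s (J :\ j)%SET) x).
  split => //; first by move=> J; exact: Lfun2_measurable.
  move=> J i iJ; apply: dtens_sum => j jJ; apply: dtensZ.
  have [ss _ _] := ws (J :\ j)%SET; apply: dtens_tenX2 ss.
  - by rewrite !inE (negbTE iJ) andbF.
  - by rewrite !inE eqxx.
  - by apply: contraNneq iJ => ->.
apply: (weak_d_intro rD2) => J; first exact: measurable_cst.
apply: aeW => x; rewrite /dd; apply: esym.
under eq_bigr do rewrite mulr_sumr.
apply: antisym_sum => i j iJ jJ ij; rewrite !mulrA (sgn_antisym iJ jJ ij) mulNr.
by rewrite finset.setUC (_ : ((J :\ i) :\ j)%SET = ((J :\ j) :\ i)%SET)//; apply/setP => a;
  rewrite !inE andbCA.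
Qed.

End SparseComplex.

Theorem theorem5p4 (R : realType) (d k n : nat) (hd : (1 <= d)%N)
    (psi : nat -> nat -> 'I_k.+1 -> R -> R) (hpsi : wavelet_basis psi) :
  (forall l : nat, (1 <= l <= d)%N ->
     forall v : dform R d, Zkernel d n psi l v ->
       [/\ Vspace d n psi l.-1 (homotopy v),
           weak_d (homotopy v) v &
           form_norm (homotopy v) <= pi^-1 * form_norm v])
  /\ Zkernel d n psi 0 = constant_forms R d
  /\ (forall l : nat, (1 <= l <= d)%N ->
        Zkernel d n psi l = Bimage d n psi l).
Proof.
split; first by move=> l ld v; exact: kernel_homotopy.
split; first exact: kernel0.
move=> l ld; apply/seteqP; split => v; last first.
  by apply: image_sub_kernel => //; case/andP: ld.
move=> Zv; have [Vh dh _] := kernel_homotopy hd hpsi ld Zv.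
by case: Zv => -[L2v _] _; split => //; exists (homotopy v).
Qed.
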